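(* Let $\mathbb K$ be an algebraically closed field of characteristic $2$ and let $N=(N_1,\dots,N_5)$ be a shearing vector. Let $\mathfrak{mb}_3(11;\widetilde N)$ be the Lie algebra of vector fields in $11$ indeterminates defined in the context, and let $\mathfrak L(N)$ be the Lie algebra whose space is $\mathfrak{svect}(5;N)$ and whose bracket is $$[[D^f,D^g]]=[D^f,D^g]+\sum_{(i,j,k)\in S_3}\left(\frac{\partial f_4}{\partial u_i}\frac{\partial g_5}{\partial u_j}+\frac{\partial f_5}{\partial u_i}\frac{\partial g_4}{\partial u_j}\right)\partial_{u_k},$$ where $D^f=\sum_{i=1}^5 f_i\partial_{u_i}$, $D^g=\sum_{i=1}^5 g_i\partial_{u_i}$, $[\cdot,\cdot]$ is the usual commutator of vector fields, and $S_3$ is the set of permutations of $\{1,2,3\}$. Then $\mathfrak L(N)$ is a true deform of $\mathfrak{svect}(5;N)$ and, as an abstract Lie algebra, $\mathfrak{mb}_3(11;\widetilde N)$ is isomorphic to $\mathfrak L(N)$; thus all W-gradings (W-regradings) of $\mathfrak{mb}_3(11;\widetilde N)$ are W-gradings of the true deform $\mathfrak L(N)$ of $\mathfrak{svect}(5;N)$.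
   Context: Divided powers: for a shearing vector $N=(N_1,\dots,N_m)$, $N_i\in\{1,2,\dots\}\cup\{\infty\}$, $\mathcal O(m;N)$ is the commutative $\mathbb K$-algebra with basis $u^{(r)}=\prod_i u_i^{(r_i)}$, $0\le r_i<2^{N_i}$ (with $2^\infty=\infty$), and multiplication $u^{(r)}u^{(s)}=\prod_i\binom{r_i+s_i}{r_i}u^{(r+s)}$ (zero if $r+s$ is out of range). The distinguished partial derivative $\partial_{u_i}$ lowers the $i$th exponent by $1$ (and kills monomials with $r_i=0$). $\mathfrak{vect}(m;N)$ is the Lie algebra of all $\sum f_i\partial_{u_i}$ with $f_i\in\mathcal O(m;N)$; $\mathfrak{svect}(m;N)$ is its subalgebra of elements with $\sum_i\partial_{u_i}f_i=0$. True deform: a deform of a Lie algebra $\mathfrak g$ is the result of a deformation of its bracket (here $[\cdot,\cdot]+t\,c(\cdot,\cdot)$ with cocycle $c$, at $t=1$). It is semi-trivial if the cocycle represents a nontrivial cohomology class but the resulting algebra is isomorphic to $\mathfrak g$; a true deform is a deform which is neither trivial nor semi-trivial. The algebra $\mathfrak{mb}_3(11;\widetilde N)$: this is the desuperization (obtained by forgetting parity and squaring) of the characteristic-$2$ version of the exceptional Lie superalgebra $\mathfrak{mb}(3|8)$; it is the complete generalized Cartan prolong of its negative part. Explicitly, take $11$ (even) indeterminates $u_1,u_2,u_3,\chi_1=u_4,\chi_2=u_5$ with heights given by $N_1,\dots,N_5$ and $\eta_1,\eta_2,\eta_3,\zeta_1,\zeta_2,\zeta_3$ with all heights given by $1$ (this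 defines $\widetilde N$). For $i=1,2,3$ and $(i,j,k)$ an even permutation of $(1,2,3)$, set $$Y_{\eta_i}=\partial_{\eta_i}+\zeta_k\partial_{u_j}+\zeta_j\partial_{u_k}+(\zeta_k\eta_j+\zeta_j\eta_k)\partial_{\chi_1}+\zeta_j\zeta_k\partial_{\chi_2},\quad Y_{\zeta_i}=\partial_{\zeta_i},\quad Y_{u_i}=\partial_{u_i}+\eta_i\partial_{\chi_1}+\zeta_i\partial_{\chi_2},\quad Y_{\chi_s}=\partial_{\chi_s}.$$ Then $\mathfrak{mb}_3(11;\widetilde N)$ consists of all vector fields $$X^F=F_1Y_{\chi_1}+F_2Y_{\chi_2}+\sum_{i=1}^3\big(Y_{u_i}(F_2)Y_{\zeta_i}+Y_{u_i}(F_1)Y_{\eta_i}+Y_{\zeta_i}(F_2)Y_{u_i}\big),$$ where $F_1,F_2$ are elements of the divided power algebra in these indeterminates satisfying $Y_{\zeta_i}(F_1)=0$, $Y_{\eta_i}(F_1)=Y_{\zeta_i}(F_2)$, $Y_{\eta_i}(F_2)=0$ for $i=1,2,3$. It is graded by $\deg\eta_i=\deg\zeta_i=1$, $\deg u_i=2$ $(i\le 3)$, $\deg\chi_s=3$. W-gradings: given a Lie algebra $\mathcal L$ and a maximal subalgebra $\mathcal L_0$ of finite codimension, let $\mathcal L_{-1}$ be a minimal $\mathcal L_0$-invariant subspace strictly containing $\mathcal L_0$ and, for $i\ge1$, put $\mathcal L_{-i-1}=[\mathcal L_{-1},\mathcal L_{-i}]+\mathcal L_{-i}$ and $\mathcal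 L_i=\{D\in\mathcal L_{i-1}\mid[D,\mathcal L_{-1}]\subset\mathcal L_{i-1}\}$. This is a Weisfeiler (W-)filtration; a grading associated with it is called a W-grading, and passing from one W-grading to another is a (W-)regrading. For finite shearing vectors, the W-gradings are those corresponding to the W-gradings of the version of the algebra with unconstrained (infinite) non-critical heights. *)

(* Defs.v *)
From HB Require Import structures.
From mathcomp Require Import all_boot all_order all_algebra all_fingroup.
From mathcomp Require Import classical_sets functions.
From mathcomp Require Import finmap monalg.

Set Implicit Arguments.
Unset Strict Implicit.
Unset Printing Implicit Defensive.

Import GRing.Theory.
Local Open Scope classical_set_scope.
Local Open Scope ring_scope.

(* Lie algebras are given as a subset [car] of a K-vector space V together with
   an operation on V of which only the restriction to [car] matters.  This lets
   the algebras with different shearing vectors live in one common V.          *)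

Section LinearAlgebra.
Variables (K : fieldType) (V W : lmodType K).
Implicit Types (A : set V) (b : V -> V -> V).

Definition subspace A : Prop :=
  A 0 /\ forall (a : K) x y, A x -> A y -> A (a *: x + y).

Definition lspan A : set V := smallest subspace A.

Definition linear_on A (f : V -> W) : Prop :=
  forall (a : K) x y, A x -> A y -> f (a *: x + y) = a *: f x + f y.

Definition closed_on A b : Prop := forall x y, A x -> A y -> A (b x y).

Definition bilinear_on A b : Prop :=
  forall (a : K) x y z, A x -> A y -> A z ->
    b (a *: x + y) z = a *: b x z + b y z /\
    b z (a *: x + y) = a *: b z x + b z y.

Definition alternating_on A b : Prop := forall x, A x -> b x x = 0.

End LinearAlgebra.

Record lie (K : fieldType) (V : lmodType K) := Lie {
  car : set V;
  brk : V -> V -> V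
}.

Section LieAlgebra.
Variables (K : fieldType) (V : lmodType K).
Implicit Types (g : lie V) (A : set V).

Definition jacobi_on A (b : V -> V -> V) : Prop :=
  forall x y z, A x -> A y -> A z ->
    b x (b y z) + b y (b z x) + b z (b x y) = 0.

Definition is_lie_algebra g : Prop :=
  [/\ subspace (car g), closed_on (car g) (brk g), bilinear_on (car g) (brk g),
      alternating_on (car g) (brk g) & jacobi_on (car g) (brk g)].

End LieAlgebra.

Definition lie_isomorphism (K : fieldType) (V W : lmodType K)
    (g : lie V) (h : lie W) (phi : V -> W) : Prop :=
  [/\ is_lie_algebra g, is_lie_algebra h,
      linear_on (car g) phi,
      set_bij (car g) (car h) phi
    & forall x y, car g x -> car g y -> phi (brk g x y) = brk h (phi x) (phi y)].

Definition isomorphic (K : fieldType) (V W : lmodType K)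
    (g : lie V) (h : lie W) : Prop :=
  exists phi : V -> W, lie_isomorphism g h phi.

Section Deforms.
Variables (K : fieldType) (V : lmodType K).
Implicit Types (g : lie V) (c : V -> V -> V).

(* 2-cocycles and 2-coboundaries with values in the adjoint module; cochains
   are alternating, which in characteristic 2 is stronger than antisymmetric. *)
Definition cocycle g c : Prop :=
  [/\ closed_on (car g) c, bilinear_on (car g) c, alternating_on (car g) c
    & forall x y z, car g x -> car g y -> car g z ->
        brk g x (c y z) + brk g y (c z x) + brk g z (c x y)
        + c x (brk g y z) + c y (brk g z x) + c z (brk g x y) = 0].

Definition coboundary g c : Prop :=
  exists alpha : V -> V,
    [/\ forall x, car g x -> car g (alpha x), linear_on (car g) alpha
      & forall x y, car g x -> car g y ->
          c x y = brk g x (alpha y) + brk g (alpha x) y - alpha (brk g x y)].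

Definition deform g c (t : K) : lie V :=
  Lie (car g) (fun x y => brk g x y + t *: c x y).

Definition is_deformation g c : Prop :=
  [/\ is_lie_algebra g, cocycle g c & forall t : K, is_lie_algebra (deform g c t)].

Definition trivial_deform g c : Prop := coboundary g c.

Definition semi_trivial_deform g c : Prop :=
  ~ coboundary g c /\ isomorphic (deform g c 1) g.

(* The deform is the algebra at t = 1.  It is trivial when the cohomology class
   of c vanishes. *)
Definition true_deform g c : Prop :=
  [/\ is_deformation g c, ~ trivial_deform g c & ~ semi_trivial_deform g c].

End Deforms.

Section Weisfeiler.
Variables (K : fieldType) (V : lmodType K).
Implicit Types (g : lie V) (B C M : set V).

Definition subalgebra g B : Prop :=
  [/\ subspace B, B `<=` car g & closed_on B (brk g)].

Definition maximal_subalgebra g B : Prop :=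
  [/\ subalgebra g B, B `<` car g
    & forall C, subalgebra g C -> B `<=` C -> C `<` car g -> C = B].

Definition finite_codim g B : Prop :=
  exists s : seq V, lspan (B `|` [set` s]) = car g.

Definition invariant_above g (L0 M : set V) : Prop :=
  [/\ subspace M, M `<=` car g, L0 `<` M
    & forall x y, L0 x -> M y -> M (brk g x y)].

Definition minimal_invariant_above g (L0 M : set V) : Prop :=
  invariant_above g L0 M /\
  forall M', invariant_above g L0 M' -> M' `<=` M -> M' = M.

Definition W_filtration g (L : int -> set V) : Prop :=
  [/\ maximal_subalgebra g (L 0), finite_codim g (L 0),
      minimal_invariant_above g (L 0) (L (-1)),
      forall n : nat, (0 < n)%N ->
        L (- n%:Z - 1) =
        lspan ([set brk g x y | x in L (-1) & y in L (- n%:Z)] `|` L (- n%:Z))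
    & forall n : nat, (0 < n)%N ->
        L n%:Z = [set D | L (n%:Z - 1) D /\
                   forall E, L (-1) E -> L (n%:Z - 1) (brk g D E)]].

Definition Z_grading g (G : int -> set V) : Prop :=
  [/\ forall i, subspace (G i),
      forall i j x y, G i x -> G j y -> G (i + j) (brk g x y),
      lspan (\bigcup_i G i) = car g
    & forall i, G i `&` lspan (\bigcup_(j in [set j | j != i]) G j) = [set 0]].

Definition filtration_of (G : int -> set V) (j : int) : set V :=
  lspan (\bigcup_(i in [set i | j <= i]) G i).

Definition W_grading g (G : int -> set V) : Prop :=
  Z_grading g G /\ W_filtration g (filtration_of G).

(* W-gradings of an algebra g with constrained heights, which is a subalgebra of
   its version ginf with infinite non-critical heights: the gradings of g cut
   out by a W-grading of ginf.  For g = ginf this is W_grading g.            *)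
Definition W_grading_in (ginf g : lie V) (G : int -> set V) : Prop :=
  Z_grading g G /\
  exists H : int -> set V, W_grading ginf H /\ forall i, G i = H i `&` car g.

End Weisfeiler.

(* [None] is the infinite height. *)
Definition height := option nat.

Definition shearing_vector (I : Type) (N : I -> height) : Prop :=
  forall i, N i <> Some 0%N.

Definition unconstrained (I : Type) : I -> height := fun=> None.

Definition below_height (h : height) (r : nat) : bool :=
  if h is Some n then (r < 2 ^ n)%N else true.

Section DividedPowers.
Variables (K : fieldType) (I : finType).

Definition mindex := {ffun I -> nat}.

(* Finitely supported combinations of all u^(r); O(I; N) is the subspace
   [divpow N] of those supported on the exponents in range.               *)
Definition dp := {malg K[mindex]}.

Definition vfield := {ffun I -> dp}.

Variable N : I -> height.

Definition in_range (r : mindex) : bool := [forall i, below_height (N i) (r i)].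

Definition divpow : set dp := [set f | forall r, r \in msupp f -> in_range r].

Definition dpmul (f g : dp) : dp :=
  \sum_(r <- msupp f) \sum_(s <- msupp g)
    let rs : mindex := [ffun i => (r i + s i)%N] in
    if in_range rs
    then << f@_r * g@_s * (\prod_i 'C(r i + s i, r i))%N%:R *g rs >> else 0.

Definition dpone : dp := << ([ffun=> 0%N] : mindex) >>.

Definition dpvar (v : I) : dp := << ([ffun i => (i == v : nat)] : mindex) >>.

Definition dpartial (v : I) (f : dp) : dp :=
  \sum_(r <- msupp f)
    if r v == 0%N then 0
    else << f@_r *g ([ffun i => (r i - (i == v))%N] : mindex) >>.

Definition vpartial (v : I) : vfield := [ffun w => if w == v then dpone else 0].

Definition vmul (f : dp) (D : vfield) : vfield := [ffun v => dpmul f (D v)].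

Definition vapply (D : vfield) (f : dp) : dp :=
  \sum_v dpmul (D v) (dpartial v f).

Definition vbracket (D E : vfield) : vfield :=
  [ffun v => vapply D (E v) - vapply E (D v)].

Definition vect : lie vfield := Lie [set D : vfield | forall v, divpow (D v)] vbracket.

Definition svect : lie vfield :=
  Lie (car vect `&` [set D : vfield | \sum_v dpartial v (D v) = 0]) vbracket.

End DividedPowers.

(* u_1, u_2, u_3, chi_1 = u_4, chi_2 = u_5. *)
Definition iu (i : 'I_3) : 'I_5 := @lshift 3 2 i.
Definition ichi (s : 'I_2) : 'I_5 := @rshift 3 2 s.

Section DeformOfSvect.
Variables (K : fieldType) (N : 'I_5 -> height).

Definition svect_cocycle (D E : vfield K 'I_5) : vfield K 'I_5 :=
  let f4 := D (ichi 0) in let f5 := D (ichi 1) in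
  let g4 := E (ichi 0) in let g5 := E (ichi 1) in
  \sum_(s : 'S_3)
    vmul N (dpmul N (dpartial (iu (s 0)) f4) (dpartial (iu (s 1)) g5) +
            dpmul N (dpartial (iu (s 0)) f5) (dpartial (iu (s 1)) g4))
         (vpartial K (iu (s 2%:R))).

Definition Ldeform : lie (vfield K 'I_5) := deform (svect K N) svect_cocycle 1.

End DeformOfSvect.

(* The 11 indeterminates: u_1, ..., u_5, then the eta_i, then the zeta_i. *)
Definition var11 : finType := ('I_5 + ('I_3 + 'I_3))%type.

Definition vu (i : 'I_3) : var11 := inl (iu i).
Definition vchi (s : 'I_2) : var11 := inl (ichi s).
Definition veta (i : 'I_3) : var11 := inr (inl i).
Definition vzeta (i : 'I_3) : var11 := inr (inr i).

Definition Ntilde (N : 'I_5 -> height) (v : var11) : height :=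
  if v is inl i then N i else Some 1%N.

Section Mb3.
Variables (K : fieldType) (N : 'I_5 -> height).

Local Notation "f *o g" := (dpmul (Ntilde N) f g) (at level 40).
Local Notation "f *v D" := (vmul (Ntilde N) f D) (at level 40).
Local Notation eta i := (dpvar K (veta i)).
Local Notation zeta i := (dpvar K (vzeta i)).
Local Notation d v := (vpartial K v).

(* In 'I_3 addition is modulo 3, so (i, i + 1, i + 2) is an even permutation. *)
Definition Yeta (i : 'I_3) : vfield K var11 :=
  let j := i + 1 in let k := i + 2%:R in
  d (veta i) + zeta k *v d (vu j) + zeta j *v d (vu k)
  + (zeta k *o eta j + zeta j *o eta k) *v d (vchi 0)
  + (zeta j *o zeta k) *v d (vchi 1).

Definition Yzeta (i : 'I_3) : vfield K var11 := d (vzeta i).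

Definition Yu (i : 'I_3) : vfield K var11 :=
  d (vu i) + eta i *v d (vchi 0) + zeta i *v d (vchi 1).

Definition Ychi (s : 'I_2) : vfield K var11 := d (vchi s).

Local Notation "D @v f" := (vapply (Ntilde N) D f) (at level 30).

Definition mb3_field (F1 F2 : dp K var11) : vfield K var11 :=
  F1 *v Ychi 0 + F2 *v Ychi 1
  + \sum_(i : 'I_3) ((Yu i @v F2) *v Yzeta i + (Yu i @v F1) *v Yeta i
                     + (Yzeta i @v F2) *v Yu i).

Definition mb3_generating (F1 F2 : dp K var11) : Prop :=
  [/\ divpow (Ntilde N) F1, divpow (Ntilde N) F2
    & forall i : 'I_3, [/\ Yzeta i @v F1 = 0, Yeta i @v F1 = Yzeta i @v F2
                         & Yeta i @v F2 = 0]].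

Definition mb3 : lie (vfield K var11) :=
  Lie [set X | exists F1 F2, mb3_generating F1 F2 /\ X = mb3_field F1 F2]
      (vbracket (Ntilde N)).

End Mb3.

(* Main.v *)
(** The isomorphism takes a field of [mb_3] to its coefficients along u_1, ..., u_5,
    restricted to eta = zeta = 0.  For X^F these are the restrictions of Y_zeta_i F2,
    F1 and F2.  In the frame of the Y's the only commutators between odd directions are
    [Y_eta_i, Y_zeta_k] = Y_u_j, and the terms they contribute to a bracket become the
    cocycle.  The three conditions on F determine all odd derivatives of F1 and F2, which
    gives injectivity; the relation
    sum_i Y_u_i Y_zeta_i F2 + Y_chi1 F1 + Y_chi2 F2 = 0 forces the divergence to vanish
    and is the only obstruction to extending five functions of u to a pair F.

    The cocycle c is not a coboundary: c(u_1 d_4, u_2 d_5) = d_3, whereas the constant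
    term of this component of a coboundary vanishes.

    Suppose psi maps the deform isomorphically onto svect, and let B_1 < B_0 be the
    preimages of the fields vanishing at the origin to order 2, resp. 1.  Both brackets
    respect the filtration by weights w with w_1 + w_2 + w_3 = w_4 + w_5.  As B_0 has
    codimension 5 and B_1 codimension at most 30, few monomial fields of distinct weights
    can fail to be leading terms of elements of B_0 or B_1; playing brackets against this
    count makes h = u_4 d_4 + u_1 d_1 a leading term of an element of B_1.  The bracket of
    this element with d_4, which has the least possible weight, is d_4, so psi(d_4)
    vanishes to every order. *)
Require Import Defs.
From Stdlib Require Import Ring Ring_theory.
From HB Require Import structures.
From mathcomp Require Import all_boot all_order all_algebra all_fingroup.
From mathcomp Require Import boolp classical_sets functions.
From mathcomp Require Import finmap monalg zify.

Set Implicit Arguments.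
Unset Strict Implicit.
Unset Printing Implicit Defensive.

Import Order.TTheory GRing.Theory Num.Theory.
Local Open Scope classical_set_scope.
Local Open Scope ring_scope.

(** In characteristic 2 the truncated algebra sits inside the untruncated one as a subalgebra, so
    every identity is proved without truncation and the heights matter only for membership. For the
    same reason the test fields in the non-isomorphism argument are squarefree monomials u_S d_i
    with i outside S: they lie in svect for every shearing vector, even with all heights 1.

    An arbitrary isomorphism need not respect any visible structure; what survives is the
    codimension of the transported subspaces and the way leading terms multiply. The count must fail
    for svect itself, where B_0 really misses all five constant fields. It is the cocycle that tips
    it: the fields u_a d_4 and u_b d_5, which commute in svect, now have bracket d_k, and this gives
    two more forced absences than codimension 5 can accommodate.

    On the side of mb_3, the inverse of the restriction map is a Taylor expansion in the odd
    variables, its coefficients being dictated by the three conditions on F. The cyclic symmetry of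
    the indices 1, 2, 3 reduces each frame relation to one index. *)

Section LinearExtension.
Variables (K : fieldType) (T : choiceType) (V : lmodType K).
Implicit Types (f g : {malg K[T]}) (Q : T -> V).

Definition lext Q f : V := \sum_(r <- msupp f) f@_r *: Q r.

Lemma lextEw Q f (d : {fset T}) :
  (msupp f `<=` d)%fset -> lext Q f = \sum_(r <- d) f@_r *: Q r.
Proof.
move=> sfd; rewrite /lext [RHS](big_fsetID _ (mem (msupp f))) /=.
rewrite [X in _ = _ + X]big1_fset ?addr0; last first.
  by move=> r; rewrite !inE /= => /andP[_ /mcoeff_outdom->] _; rewrite scale0r.
by apply: eq_fbigl => r; rewrite !inE /= andb_idl// => /(fsubsetP sfd).
Qed.

Lemma lext_linear Q : linear (lext Q).
Proof.
move=> a f g; set d := (msupp f `|` msupp g)%fset.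
have sf : (msupp f `<=` d)%fset by apply: fsubsetUl.
have sg : (msupp g `<=` d)%fset by apply: fsubsetUr.
have sfg : (msupp (a *: f + g) `<=` d)%fset.
  apply: fsubset_trans (msuppD_le _ _) _.
  by apply: fsetSU; apply: msuppZ_le.
rewrite (lextEw _ sfg) (lextEw _ sf) (lextEw _ sg) scaler_sumr -big_split /=.
by apply: eq_bigr => r _; rewrite mcoeffD mcoeffZ scalerDl scalerA.
Qed.

HB.instance Definition _ Q :=
  GRing.isLinear.Build K {malg K[T]} V *:%R (lext Q) (lext_linear Q).

Lemma lextU Q r : lext Q << r >> = Q r.
Proof. by rewrite /lext msuppU oner_eq0 big_seq_fset1 mcoeffUU scale1r. Qed.

Lemma monalgUZ (a : K) (r : T) : << a *g r >> = a *: << r >> :> {malg K[T]}.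
Proof. by apply/malgP => k; rewrite mcoeffZ !mcoeffU mulrnAr mulr1. Qed.

Lemma malg_sumZ f : f = \sum_(r <- msupp f) f@_r *: << r >>.
Proof. by rewrite {1}[f]monalgE; apply: eq_bigr => r _; rewrite monalgUZ. Qed.

Lemma lin_ext (F G : {linear {malg K[T]} -> V}) :
  (forall r, F << r >> = G << r >>) -> F =1 G.
Proof.
move=> FG f; rewrite [f]malg_sumZ !linear_sum; apply: eq_bigr => r _.
by rewrite !linearZ /= FG.
Qed.

End LinearExtension.

Section Support.
Variables (K : fieldType) (T : choiceType).
Implicit Types (P : T -> Prop) (f g : {malg K[T]}).

Definition supp_in P : set {malg K[T]} :=
  [set f | forall r, r \in msupp f -> P r].

Lemma supp_inP P f : supp_in P f <-> forall r, f@_r != 0 -> P r.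
Proof. by split=> H r; [rewrite mcoeff_neq0 | rewrite -mcoeff_neq0]; apply: H. Qed.

Lemma supp_in_subspace P : subspace (supp_in P).
Proof.
split=> [r|a f g Pf Pg]; first by rewrite msupp0 inE.
apply/supp_inP => r; rewrite mcoeffD mcoeffZ => nz.
have [/eqP f0|f0] := boolP (f@_r == 0); last first.
  by apply: (proj1 (supp_inP P f) Pf).
by move: nz; rewrite f0 mulr0 add0r; apply: (proj1 (supp_inP P g) Pg).
Qed.

Lemma supp_in1 P r : P r -> supp_in P << r >>.
Proof. by move=> Pr s; rewrite msuppU oner_eq0 inE => /eqP->. Qed.

Lemma supp_in_sub P P' : (forall r, P r -> P' r) -> supp_in P `<=` supp_in P'.
Proof. by move=> PP' f Pf r /Pf /PP'. Qed.

End Support.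

Section Subspaces.
Variables (K : fieldType) (V : lmodType K) (A : set V).
Hypothesis subA : subspace A.

Lemma subspace0 : A 0. Proof. by case: subA. Qed.

Lemma subspaceD x y : A x -> A y -> A (x + y).
Proof. by move=> Ax Ay; rewrite -[x]scale1r; apply: (proj2 subA). Qed.

Lemma subspaceZ a x : A x -> A (a *: x).
Proof. by move=> Ax; rewrite -[a *: x]addr0; apply: (proj2 subA) => //; apply: subspace0. Qed.

Lemma subspaceN x : A x -> A (- x).
Proof. by rewrite -scaleN1r; apply: subspaceZ. Qed.

Lemma subspaceB x y : A x -> A y -> A (x - y).
Proof. by move=> Ax Ay; apply: subspaceD => //; apply: subspaceN. Qed.

Lemma subspace_sum (J : eqType) (s : seq J) (F : J -> V) :
  (forall j, j \in s -> A (F j)) -> A (\sum_(j <- s) F j).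
Proof.
elim: s => [|j s IH] AF; first by rewrite big_nil; apply: subspace0.
rewrite big_cons; apply: subspaceD; first by apply: AF; rewrite mem_head.
by apply: IH => i si; apply: AF; rewrite inE si orbT.
Qed.

Lemma subspace_sumT (J : finType) (F : J -> V) :
  (forall j, A (F j)) -> A (\sum_j F j).
Proof. by move=> AF; apply: subspace_sum => j _. Qed.

Lemma lext_in (T : choiceType) (Q : T -> V) (f : {malg K[T]}) :
  (forall r, r \in msupp f -> A (Q r)) -> A (lext Q f).
Proof. by move=> AQ; apply: subspace_sum => r /AQ; apply: subspaceZ. Qed.

End Subspaces.

(** * Divided powers *)

(** Linearity is a proposition here and not a structure on the function, so that an identity between
    multilinear expressions can be reduced to monomials in one argument at a time. *)
Lemma lin_eq (K : fieldType) (T : choiceType) (V : lmodType K)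
    (F G : {malg K[T]} -> V) :
  linear F -> linear G -> (forall r, F << r >> = G << r >>) -> F =1 G.
Proof.
move=> lF lG FG.
pose F' : {linear {malg K[T]} -> V} :=
  HB.pack F (GRing.isLinear.Build K {malg K[T]} V *:%R F lF).
pose G' : {linear {malg K[T]} -> V} :=
  HB.pack G (GRing.isLinear.Build K {malg K[T]} V *:%R G lG).
exact: (@lin_ext _ _ _ F' G').
Qed.

Section Monomials.
Variable I : finType.
Implicit Types (r s t : mindex I) (v w : I).

Definition madd r s : mindex I := [ffun i => (r i + s i)%N].
Definition mdec v r : mindex I := [ffun i => (r i - (i == v))%N].
Definition mbin r s : nat := (\prod_i 'C(r i + s i, r i))%N.

Lemma maddC r s : madd r s = madd s r.
Proof. by apply/ffunP => i; rewrite !ffunE addnC. Qed.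

Lemma maddA r s t : madd r (madd s t) = madd (madd r s) t.
Proof. by apply/ffunP => i; rewrite !ffunE addnA. Qed.

Lemma mbinC r s : mbin r s = mbin s r.
Proof.
apply: eq_bigr => i _; rewrite -bin_sub ?leq_addr // addnC.
by rewrite -[in X in 'C(_, X)](addnC (r i)) addKn.
Qed.

(** Both sides are the trinomial coefficient: multiplied by the factorials of [a], [b] and [c], each
    becomes the factorial of [a + b + c]. *)
Lemma mul_binA a b c :
  ('C(a + b, a) * 'C(a + b + c, a + b) = 'C(b + c, b) * 'C(a + (b + c), a))%N.
Proof.
have pos : (0 < a`! * b`! * c`!)%N by rewrite !muln_gt0 !fact_gt0.
have := @bin_fact (a + b + c) (a + b) (leq_addr _ _).
have := @bin_fact (a + b) a (leq_addr _ _).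
have := @bin_fact (a + (b + c)) a (leq_addr _ _).
have := @bin_fact (b + c) b (leq_addr _ _).
rewrite !addKn -[(a + b + c)%N]addnA => E1 E2 E3 E4.
apply/eqP; rewrite -(eqn_pmul2r pos); apply/eqP.
transitivity (a + (b + c))`!; first by rewrite -E4 -E3; lia.
by rewrite -E2 -E1; lia.
Qed.

Lemma mbinA r s t :
  (mbin r s * mbin (madd r s) t = mbin s t * mbin r (madd s t))%N.
Proof.
rewrite /mbin -!big_split /=; apply: eq_bigr => i _.
by rewrite !ffunE mul_binA.
Qed.

Lemma mbin_leibniz v r s : (0 < r v + s v)%N ->
  mbin r s = ((r v != 0)%N * mbin (mdec v r) s +
              (s v != 0)%N * mbin r (mdec v s))%N.
Proof.
have mbinD1 r' s' : (forall i, i != v -> r' i = r i) ->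
    (forall i, i != v -> s' i = s i) ->
    mbin r' s' =
      ('C(r' v + s' v, r' v) * \prod_(i | i != v) 'C(r i + s i, r i))%N.
  move=> rr' ss'; rewrite /mbin (bigD1 v) //=; congr (_ * _)%N.
  by apply: eq_bigr => i iv; rewrite rr' ?ss'.
have dec t i : i != v -> mdec v t i = t i.
  by move=> /negbTE iv; rewrite ffunE iv subn0.
move=> pos; rewrite (mbinD1 r s) // (mbinD1 (mdec v r) s) //; last exact: dec.
rewrite (mbinD1 r (mdec v s)) //; last exact: dec.
rewrite !ffunE eqxx !mulnA -mulnDl; congr (_ * _)%N.
case: (r v) (s v) pos => [|a] [|b] //= _.
- by rewrite !bin0.
- by rewrite !addn0 subn1 /= !binn.
by rewrite !subn1 /= !mul1n addSn binS addnC addnS addSn.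
Qed.

End Monomials.

Section DividedPowerRing.
Variables (K : fieldType) (I : finType).
Implicit Types (r s t : mindex I) (v w : I) (N : I -> height) (f g h : dp K I).

Definition mmul N r s : dp K I :=
  if in_range N (madd r s) then (mbin r s)%:R *: << madd r s >> else 0.

Lemma dpmulE N f g : dpmul N f g = lext (fun r => lext (mmul N r) g) f.
Proof.
apply: eq_bigr => r _; rewrite /lext scaler_sumr; apply: eq_bigr => s _.
rewrite /mmul /mbin /=; set rs : mindex I := finfun _.
have -> : madd r s = rs by [].
by case: ifP => _; rewrite ?scaler0 // monalgUZ !scalerA.
Qed.

Lemma dpmul_linear_l N g : linear (fun f => dpmul N f g).
Proof. by move=> a f f'; rewrite !dpmulE linearP. Qed.

Lemma dpmul_linear N f : linear (dpmul N f).
Proof.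
move=> a g g'; rewrite !dpmulE /lext scaler_sumr -big_split /=.
apply: eq_bigr => r _; rewrite -/(lext _ _) -/(lext _ _) -/(lext _ _) linearP.
by rewrite scalerDr !scalerA mulrC.
Qed.

HB.instance Definition _ N f :=
  GRing.isLinear.Build K (dp K I) (dp K I) *:%R (dpmul N f) (@dpmul_linear N f).

(** The product with its arguments exchanged, so that linearity in the left factor can be registered
    as well. *)
Definition dpmulr N g f := dpmul N f g.

HB.instance Definition _ N g :=
  GRing.isLinear.Build K (dp K I) (dp K I) *:%R (dpmulr N g)
    (@dpmul_linear_l N g).

Lemma dpmulDl N f f' g : dpmul N (f + f') g = dpmul N f g + dpmul N f' g.
Proof. exact: (linearD (dpmulr N g)). Qed.
Lemma dpmulDr N f g g' : dpmul N f (g + g') = dpmul N f g + dpmul N f g'.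
Proof. exact: linearD. Qed.
Lemma dpmulZl N a f g : dpmul N (a *: f) g = a *: dpmul N f g.
Proof. exact: (linearZ_LR (dpmulr N g)). Qed.
Lemma dpmulZr N a f g : dpmul N f (a *: g) = a *: dpmul N f g.
Proof. exact: linearZ_LR. Qed.
Lemma dpmul0l N g : dpmul N 0 g = 0.
Proof. exact: (linear0 (dpmulr N g)). Qed.
Lemma dpmul0r N f : dpmul N f 0 = 0.
Proof. exact: linear0. Qed.

Lemma dpmulU N r s : dpmul N << r >> << s >> = mmul N r s.
Proof. by rewrite dpmulE !lextU. Qed.

Lemma dpartialE v f :
  dpartial v f = lext (fun r => if r v == 0%N then 0 else << mdec v r >>) f.
Proof.
apply: eq_bigr => r _; case: ifP => _; first by rewrite scaler0.
by rewrite monalgUZ.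
Qed.

Lemma dpartial_linear v : linear (@dpartial K I v).
Proof. by move=> a f g; rewrite !dpartialE linearP. Qed.

HB.instance Definition _ v :=
  GRing.isLinear.Build K (dp K I) (dp K I) *:%R (dpartial v) (@dpartial_linear v).

Lemma dpartialU v r :
  dpartial v << r >> = if r v == 0%N then 0 else << mdec v r >> :> dp K I.
Proof. by rewrite dpartialE lextU. Qed.

Lemma dpartialC v w f : dpartial v (dpartial w f) = dpartial w (dpartial v f).
Proof.
move: f; apply: lin_eq => [a f g|a f g|r].
- by rewrite (dpartial_linear w) (dpartial_linear v).
- by rewrite (dpartial_linear v) (dpartial_linear w).
rewrite !dpartialU; have [->|vw] := eqVneq v w; first by [].
have dw : mdec w r v = r v by rewrite ffunE (negbTE vw) subn0.
have dv : mdec v r w = r w by rewrite ffunE eq_sym (negbTE vw) subn0.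
have [rw|rw] := boolP (r w == 0%N); have [rv|rv] := boolP (r v == 0%N);
  rewrite ?linear0 // !dpartialU ?dw ?dv ?(negbTE rw) ?(negbTE rv) ?rw ?rv //.
by congr << _ >>; apply/ffunP => i; rewrite !ffunE subnAC.
Qed.

Local Notation "f ** g" := (dpmul (@unconstrained I) f g) (at level 40).

Lemma mmul_unconstrained r s :
  mmul (@unconstrained I) r s = (mbin r s)%:R *: << madd r s >>.
Proof. by rewrite /mmul ifT //; apply/forallP. Qed.

Lemma dpmulC f g : f ** g = g ** f.
Proof.
move: f; apply: lin_eq => [||r]; [exact: dpmul_linear_l|exact: dpmul_linear|].
move: g; apply: lin_eq => [||s]; [exact: dpmul_linear|exact: dpmul_linear_l|].
by rewrite !dpmulU !mmul_unconstrained mbinC maddC.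
Qed.

Lemma dpmulA f g h : f ** (g ** h) = (f ** g) ** h.
Proof.
move: f; apply: lin_eq => [|a x y|r]; [exact: dpmul_linear_l| |].
  by rewrite dpmulDl dpmulZl dpmulDl dpmulZl.
move: g; apply: lin_eq => [a x y|a x y|s].
- by rewrite !(dpmulDl, dpmulZl, dpmulDr, dpmulZr).
- by rewrite !(dpmulDl, dpmulZl, dpmulDr, dpmulZr).
move: h; apply: lin_eq => [a x y|a x y|t].
- by rewrite !(dpmulDl, dpmulZl, dpmulDr, dpmulZr).
- by rewrite !(dpmulDl, dpmulZl, dpmulDr, dpmulZr).
rewrite !dpmulU !mmul_unconstrained dpmulZl dpmulZr !dpmulU.
by rewrite !mmul_unconstrained !scalerA -!natrM -mbinA maddA.
Qed.

Lemma dpmul1 f : dpone K I ** f = f.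
Proof.
move: f; apply: lin_eq => [||r]; [exact: dpmul_linear|by []|].
rewrite dpmulU mmul_unconstrained.
have -> : madd [ffun=> 0%N] r = r by apply/ffunP => i; rewrite !ffunE.
by rewrite /mbin big1 ?scale1r // => i _; rewrite ffunE bin0.
Qed.

Lemma dpartialM v f g :
  dpartial v (f ** g) = dpartial v f ** g + f ** dpartial v g.
Proof.
move: f; apply: lin_eq => [a x y|a x y|r].
- by rewrite dpmulDl dpmulZl linearP.
- by rewrite linearP /= !dpmulDl !dpmulZl scalerDr addrACA.
move: g; apply: lin_eq => [a x y|a x y|s].
- by rewrite dpmulDr dpmulZr linearP.
- by rewrite !linearP /= ?linearP /= scalerDr addrACA.
rewrite !dpmulU mmul_unconstrained linearZ /= !dpartialU ffunE addn_eq0.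
have decl : r v != 0%N -> madd (mdec v r) s = mdec v (madd r s).
  rewrite -lt0n => rv; apply/ffunP => i; rewrite !ffunE.
  by case: eqP => [->|_] /=; rewrite ?subn0 // addnBAC.
have decr : s v != 0%N -> madd r (mdec v s) = mdec v (madd r s).
  rewrite -lt0n => sv; apply/ffunP => i; rewrite !ffunE.
  by case: eqP => [->|_] /=; rewrite ?subn0 // addnBA.
have [rv|rv] := boolP (r v == 0%N); have [sv|sv] := boolP (s v == 0%N) => /=;
  rewrite ?scaler0 ?dpmul0l ?dpmul0r ?addr0 ?add0r //
    !dpmulU !mmul_unconstrained ?decl ?decr //
    -?scalerDl -?natrD (@mbin_leibniz _ v r s) ?rv ?sv ?mul1n ?mul0n ?addn0 //;
  by rewrite addn_gt0 !lt0n ?rv ?sv ?orbT.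
Qed.

Lemma dpartial1 v : dpartial v (dpone K I) = 0.
Proof. by rewrite dpartialU ffunE. Qed.

Lemma dpartial_var v w : dpartial v (dpvar K w) = if v == w then dpone K I else 0.
Proof.
rewrite dpartialU !ffunE; case: (eqVneq v w) => //= ->.
by congr << _ >>; apply/ffunP => i; rewrite !ffunE subnn.
Qed.

End DividedPowerRing.

Local Opaque dpmul dpartial.

Lemma oppr_lmod2 (K : fieldType) (V : lmodType K) (x : V) :
  2%N \in [pchar K] -> - x = x.
Proof.
by move=> ch; rewrite -scaleN1r oppr_pchar2 ?scale1r.
Qed.

Lemma addrr_lmod2 (K : fieldType) (V : lmodType K) (x : V) :
  2%N \in [pchar K] -> x + x = 0.
Proof. by move=> ch; rewrite -[X in X + _](oppr_lmod2 _ ch) addNr. Qed.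

(** From j C(2^n, j) = 2^n C(2^n - 1, j - 1): an odd binomial would force 2^n to divide j, which is
    positive and smaller. *)
Lemma bin_pow2_even n j : (0 < j < 2 ^ n)%N -> (2 %| 'C(2 ^ n, j))%N.
Proof.
case: j => // j /= jn; apply: contraLR jn; rewrite -leqNgt.
rewrite dvdn2 negbK => oddC; apply: dvdn_leq => //.
have cop : coprime (2 ^ n) 'C(2 ^ n, j.+1) by rewrite coprimeXl // coprime2n.
by rewrite -(Gauss_dvdl _ cop) -mul_bin_diag dvdn_mulr.
Qed.

(* Vandermonde reduces a binomial with top [2 ^ n + t] to those with tops
   [2 ^ n], which are even, and [t], which vanish. *)
Lemma bin_overflow_even n a b :
  (a < 2 ^ n)%N -> (b < 2 ^ n)%N -> (2 ^ n <= a + b)%N -> (2 %| 'C(a + b, a))%N.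
Proof.
move=> an bn nab; rewrite -(subnKC nab) -binomial.Vandermonde.
apply: (big_ind (fun m => 2 %| m)%N) => [//|x y dx dy|[j ja] _ /=].
  exact: dvdn_add.
case: j ja => [|j] ja.
  by rewrite subn0 [X in (_ * X)%N]bin_small ?muln0 //; lia.
by rewrite dvdn_mulr // bin_pow2_even //=; lia.
Qed.

(** The six letters stand for the six compositions of three fields, applied to one coefficient. *)
Lemma jacobi_cancel (V : zmodType) (a b c d e f : V) :
  (a - b) - (c - d) + ((c - e) - (f - b)) + ((f - d) - (a - e)) = 0.
Proof.
have E x y z t : (x - y) - (z - t) = (x + t) - (y + z) :> V.
  by rewrite opprB opprD addrACA.
rewrite !E [c + b]addrC [f + e]addrC [d + a]addrC.
by move: (a + d) (b + c) (e + f) => P Q R; rewrite !addrA !subrK subrr.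
Qed.

(** * The Lie algebra of derivations of a commutative algebra *)

Section Derivations.
Variables (K : fieldType) (A : lmodType K) (I : finType).
Variables (mul : A -> A -> A) (d : I -> A -> A).
Local Notation "f *o g" := (mul f g) (at level 40, left associativity).
Implicit Types (f g h : A) (D E F : {ffun I -> A}) (v w : I) (a : K).

Definition der_apply D f : A := \sum_v D v *o d v f.
Definition der_bracket D E : {ffun I -> A} :=
  [ffun v => der_apply D (E v) - der_apply E (D v)].
Local Notation "D @@ f" := (der_apply D f) (at level 30).

Hypothesis mul_linear_l : forall g, linear (fun f => f *o g).
Hypothesis mul_linear_r : forall f, linear (mul f).
Hypothesis d_linear : forall v, linear (d v).

Let lcE a D E v : (a *: D + E) v = a *: D v + E v.
Proof. by rewrite !ffunE. Qed.

Lemma der_apply_linear D : linear (der_apply D).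
Proof.
move=> a f g; rewrite /der_apply scaler_sumr -big_split; apply: eq_bigr => v _ /=.
by rewrite d_linear mul_linear_r.
Qed.

Lemma der_apply_linear_l f : linear (der_apply^~ f).
Proof.
move=> a D E; rewrite /der_apply scaler_sumr -big_split; apply: eq_bigr => v _ /=.
by rewrite lcE mul_linear_l.
Qed.

Lemma der_bracket_bilinear B : bilinear_on B der_bracket.
Proof.
move=> a D E F _ _ _; split; apply/ffunP => v; rewrite lcE !(ffunE _ v).
  rewrite (der_apply_linear_l (F v)) der_apply_linear.
  by rewrite scalerBr opprD addrACA.
rewrite (der_apply_linear_l (F v)) der_apply_linear.
by rewrite scalerBr opprD addrACA.
Qed.

Hypothesis mulC : forall f g, f *o g = g *o f.
Hypothesis mulA : forall f g h, f *o (g *o h) = f *o g *o h.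
Hypothesis dM : forall v f g, d v (f *o g) = d v f *o g + f *o d v g.
Hypothesis dC : forall v w f, d v (d w f) = d w (d v f).

Let mulr_additive f : {morph mul f : g h / g - h >-> g - h}.
Proof.
by move=> g h; rewrite -scaleN1r addrC mul_linear_r scaleN1r addrC.
Qed.
Let mull_additive g : {morph mul^~ g : f h / f - h >-> f - h}.
Proof.
by move=> f h; rewrite -scaleN1r addrC mul_linear_l scaleN1r addrC.
Qed.
Let d_additive v : {morph d v : f h / f - h >-> f - h}.
Proof.
by move=> f h; rewrite -scaleN1r addrC d_linear scaleN1r addrC.
Qed.
HB.instance Definition _ f := GRing.isAdditive.Build A A (mul f) (mulr_additive f).
HB.instance Definition _ v := GRing.isAdditive.Build A A (d v) (d_additive v).
Let mul' g f := f *o g.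
HB.instance Definition _ g := GRing.isAdditive.Build A A (mul' g) (mull_additive g).

Lemma der_applyM D f g : D @@ (f *o g) = (D @@ f) *o g + f *o (D @@ g).
Proof.
rewrite /der_apply raddf_sum -[(\sum_v _) *o g]/(mul' g _) raddf_sum -big_split /=.
apply: eq_bigr => v _; rewrite dM raddfD /= /mul' !mulA.
by rewrite [D v *o f]mulC.
Qed.

Lemma der_apply_additive D : {morph der_apply D : f g / f - g >-> f - g}.
Proof.
by move=> f h; rewrite -scaleN1r addrC der_apply_linear scaleN1r addrC.
Qed.

HB.instance Definition _ D :=
  GRing.isAdditive.Build A A (der_apply D) (@der_apply_additive D).

(** A composition of two fields is a first-order part plus a second-order part. The second-order
    parts are symmetric in the two fields, because the [d v] commute, and cancel. *)
Lemma der_apply_bracket D E f :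
  der_bracket D E @@ f = D @@ (E @@ f) - E @@ (D @@ f).
Proof.
have app2 P Q : P @@ (Q @@ f) = \sum_v (P @@ Q v) *o d v f +
    \sum_v \sum_w P w *o Q v *o d w (d v f).
  rewrite {2}/der_apply raddf_sum /= -big_split; apply: eq_bigr => v _ /=.
  rewrite der_applyM; congr (_ + _); rewrite {1}/der_apply raddf_sum /=.
  by apply: eq_bigr => w _; rewrite !mulA [Q v *o _]mulC.
rewrite !app2 opprD addrACA [X in _ = _ + (_ - X)]exchange_big /=.
rewrite [X in _ = _ + (X - _)](_ : _ = \sum_v \sum_w E v *o D w *o d v (d w f)).
  rewrite [X in _ = _ + X]subrr addr0 -sumrB; apply: eq_bigr => v _.
  by rewrite (ffunE _ v) -[_ *o _]/(mul' _ _) raddfB.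
apply: eq_bigr => v _; apply: eq_bigr => w _.
by rewrite [D w *o _]mulC dC.
Qed.

Lemma der_bracket_jacobi D E F :
  der_bracket D (der_bracket E F) + der_bracket E (der_bracket F D) +
  der_bracket F (der_bracket D E) = 0.
Proof.
apply/ffunP => v; have addE (P Q : {ffun I -> A}) : (P + Q) v = P v + Q v.
  by rewrite ffunE.
have brE P Q : der_bracket P Q v = P @@ Q v - Q @@ P v by rewrite ffunE.
rewrite !addE !(brE _ (der_bracket _ _)) !brE !raddfB /= !der_apply_bracket ffunE.
exact: jacobi_cancel.
Qed.

End Derivations.

(** * Truncation in characteristic 2 *)

Section TruncatedProduct.
Variables (K : fieldType) (I : finType).
Hypothesis char2 : 2%N \in [pchar K].
Implicit Types (r s t : mindex I) (v w : I) (N : I -> height) (f g h : dp K I).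

Local Notation "f ** g" := (dpmul (@unconstrained I) f g) (at level 40).

Lemma divpow_subspace N : subspace (@divpow K I N).
Proof. exact: supp_in_subspace. Qed.

Lemma below_height_le (hh : height) a b :
  (a <= b)%N -> below_height hh b -> below_height hh a.
Proof. by case: hh => //= n; apply: leq_ltn_trans. Qed.

Lemma in_range_mdec N v r : in_range N r -> in_range N (mdec v r).
Proof.
move=> /forallP rN; apply/forallP => i; rewrite ffunE.
by apply: below_height_le (rN i); apply: leq_subr.
Qed.

Lemma divpow_partial N v f : divpow N f -> divpow N (dpartial v f).
Proof.
move=> Nf; rewrite dpartialE; apply: (lext_in (divpow_subspace N)) => r /Nf Nr.
case: ifP => _; first exact: (subspace0 (divpow_subspace N)).
by apply: supp_in1; apply: in_range_mdec.
Qed.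

Lemma divpow_mul N f g : divpow N f -> divpow N g -> divpow N (dpmul N f g).
Proof.
move=> Nf Ng; rewrite dpmulE.
apply: (lext_in (divpow_subspace N)) => r _.
apply: (lext_in (divpow_subspace N)) => s _.
rewrite /mmul; case: ifP => rs; last exact: (subspace0 (divpow_subspace N)).
by apply: (subspaceZ (divpow_subspace N)); apply: supp_in1.
Qed.

(** A sum of exponents that leaves its range at some [i] carries an even binomial coefficient by
    [bin_overflow_even], so the untruncated product already discards it. *)
Lemma mmul_in_range N r s : in_range N r -> in_range N s ->
  mmul K N r s = mmul K (@unconstrained I) r s.
Proof.
move=> /forallP Nr /forallP Ns; rewrite mmul_unconstrained /mmul; case: ifP => //.
move=> /negbT /forallPn[i]; rewrite ffunE => Nrs.
suff : (2 %| mbin r s)%N by rewrite (dvdn_pcharf char2) => /eqP->; rewrite scale0r.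
rewrite /mbin (bigD1 i) //= dvdn_mulr //.
move: (Nr i) (Ns i) Nrs; rewrite /below_height; case: (N i) => // n rn sn.
by rewrite -leqNgt; apply: bin_overflow_even.
Qed.

Lemma dpmul_divpow N f g : divpow N f -> divpow N g -> dpmul N f g = f ** g.
Proof.
move=> Nf Ng; rewrite (dpmulE N) (dpmulE (@unconstrained I)).
apply: eq_big_seq => r /Nf Nr; congr (_ *: _).
by apply: eq_big_seq => s /Ng Ns; rewrite mmul_in_range.
Qed.

Lemma divpow1 N : divpow N (dpone K I).
Proof.
apply: supp_in1; apply/forallP => i; rewrite ffunE.
by rewrite /below_height; case: (N i) => // n; rewrite expn_gt0.
Qed.

Lemma divpow_var N v : N v <> Some 0%N -> divpow N (dpvar K v).
Proof.
move=> Nv; apply: supp_in1; apply/forallP => i; rewrite ffunE.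
case: eqP => [->|_] /=; last first.
  by rewrite /below_height; case: (N i) => // n; rewrite expn_gt0.
by case: (N v) Nv => //= -[|n] // _; rewrite -{1}(expn0 2) ltn_exp2l.
Qed.

End TruncatedProduct.

(** * Vector fields over divided powers *)

Section VectorFields.
Variables (K : fieldType) (I : finType).
Implicit Types (v w : I) (N : I -> height) (f g h : dp K I) (D E F : vfield K I).

Local Notation "f ** g" := (dpmul (@unconstrained I) f g) (at level 40).
Local Notation "D @@ f" := (vapply (@unconstrained I) D f) (at level 30).

Lemma vapply_linear N D : linear (vapply N D).
Proof.
exact: (der_apply_linear (@dpmul_linear K I N) (@dpartial_linear K I)).
Qed.

Lemma vapply_linear_l N f : linear (fun D => vapply N D f).
Proof. exact: (der_apply_linear_l _ (@dpmul_linear_l K I N)). Qed.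

Lemma vapplyM D f g : D @@ (f ** g) = (D @@ f) ** g + f ** (D @@ g).
Proof.
exact: (der_applyM (@dpmul_linear_l K I _) (@dpmul_linear K I _)
  (@dpmulC K I) (@dpmulA K I) (@dpartialM K I)).
Qed.

Lemma vapply_bracket D E f :
  vbracket (@unconstrained I) D E @@ f = D @@ (E @@ f) - E @@ (D @@ f).
Proof.
exact: (der_apply_bracket (@dpmul_linear_l K I _) (@dpmul_linear K I _)
  (@dpartial_linear K I) (@dpmulC K I) (@dpmulA K I) (@dpartialM K I)
  (@dpartialC K I)).
Qed.

Lemma vapply_var D v : D @@ dpvar K v = D v.
Proof.
rewrite /vapply (bigD1 v) //= big1 ?addr0 => [|w wv].
  by rewrite dpartial_var eqxx dpmulC dpmul1.
by rewrite dpartial_var (negbTE wv) dpmul0r.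
Qed.

Lemma vbracketE N D E v : vbracket N D E v = vapply N D (E v) - vapply N E (D v).
Proof. by rewrite ffunE. Qed.

Lemma vbracket_bilinear N A : bilinear_on A (@vbracket K I N).
Proof.
exact: (der_bracket_bilinear (@dpmul_linear_l K I _) (@dpmul_linear K I _)
  (@dpartial_linear K I)).
Qed.

Lemma vbracket_alternating N A : alternating_on A (@vbracket K I N).
Proof. by move=> D _; apply/ffunP => v; rewrite !ffunE subrr. Qed.

Hypothesis char2 : 2%N \in [pchar K].

Lemma vapply_divpow N D f : (forall v, divpow N (D v)) -> divpow N f ->
  vapply N D f = D @@ f.
Proof.
move=> ND Nf; apply: eq_bigr => v _; apply: dpmul_divpow => //.
exact: divpow_partial.
Qed.

Lemma divpow_vapply N D f : (forall v, divpow N (D v)) -> divpow N f ->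
  divpow N (vapply N D f).
Proof.
move=> ND Nf; rewrite /vapply.
apply: (subspace_sumT (divpow_subspace K N)) => v.
by apply: divpow_mul => //; apply: divpow_partial.
Qed.

Lemma vbracket_divpow N D E : (forall v, divpow N (D v)) ->
  (forall v, divpow N (E v)) -> vbracket N D E = vbracket (@unconstrained I) D E.
Proof. by move=> ND NE; apply/ffunP => v; rewrite !ffunE !vapply_divpow. Qed.

Lemma vect_subspace N : subspace (car (vect K N)).
Proof.
split=> [v|a D E ND NE v]; rewrite !ffunE; first exact: subspace0 (divpow_subspace K N).
by apply: (proj2 (divpow_subspace K N)).
Qed.

Lemma vect_closed N : closed_on (car (vect K N)) (vbracket N).
Proof.
move=> D E ND NE v; rewrite ffunE.
by apply: (subspaceB (divpow_subspace K N)); apply: divpow_vapply.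
Qed.

Lemma vbracket_jacobi N : jacobi_on (car (vect K N)) (vbracket N).
Proof.
move=> D E F ND NE NF.
have B P Q : car (vect K N) P -> car (vect K N) Q ->
    forall v, divpow N (vbracket (@unconstrained I) P Q v).
  by move=> NP NQ v; rewrite -(vbracket_divpow NP NQ); apply: vect_closed.
rewrite (vbracket_divpow NE NF) (vbracket_divpow NF ND) (vbracket_divpow ND NE).
rewrite !vbracket_divpow //; try exact: B.
exact: (der_bracket_jacobi (@dpmul_linear_l K I _) (@dpmul_linear K I _)
  (@dpartial_linear K I) (@dpmulC K I) (@dpmulA K I) (@dpartialM K I)
  (@dpartialC K I)).
Qed.

Lemma sub_vect_lie N (A : set (vfield K I)) :
  subspace A -> A `<=` car (vect K N) -> closed_on A (vbracket N) ->
  is_lie_algebra (Lie A (vbracket N)).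
Proof.
move=> subA AN clA; split=> //=; [exact: vbracket_bilinear|exact: vbracket_alternating|].
by move=> D E F /AN ND /AN NE /AN NF; apply: (vbracket_jacobi ND NE NF).
Qed.

End VectorFields.

(** * Identities in characteristic 2 *)

(* With the booleans under [xorb] and [andb] as coefficients, [ring] decides
   identities of characteristic 2. *)
Section Char2.
Variables (A : Type) (zero one : A) (add mul : A -> A -> A).
Hypothesis A_ring : ring_theory zero one add mul add id eq.

Definition of_bool (b : bool) : A := if b then one else zero.

Lemma of_bool_morph :
  ring_morph zero one add mul add id eq false true xorb andb xorb id Bool.eqb of_bool.
Proof.
have a0 x : add zero x = x by apply: (Radd_0_l A_ring).
have aC x y : add x y = add y x by apply: (Radd_comm A_ring).
have xx x : add x x = zero by apply: (Ropp_def A_ring).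
have m1 x : mul one x = x by apply: (Rmul_1_l A_ring).
have mC x y : mul x y = mul y x by apply: (Rmul_comm A_ring).
have m0 : mul zero zero = zero.
  have := Rdistr_l A_ring one one zero; rewrite (xx one) m1 xx; exact.
have m10 : mul zero one = zero by rewrite mC m1.
by split=> //; [case=> -[]|case=> -[]|case=> -[]|case=> -[]] => //=;
  rewrite ?xx ?a0 ?(aC one zero) ?a0 ?m1.
Qed.

Add Ring char2_ring : A_ring (morphism of_bool_morph).

Local Notation "x + y" := (add x y).
Local Notation "x * y" := (mul x y).

Section CocycleIdentities.
Variables (J : Type) (d : J -> A -> A).
Hypothesis dD : forall v f g, d v (f + g) = d v f + d v g.
Hypothesis dM : forall v f g, d v (f * g) = d v f * g + f * d v g.
Hypothesis dC : forall v w f, d v (d w f) = d w (d v f).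
Variables i1 i2 i3 i4 i5 : J.

Definition fld : Type := (A * A * A * A * A)%type.

Definition app (x : fld) (f : A) : A :=
  let: (x1, x2, x3, x4, x5) := x in
  x1 * d i1 f + x2 * d i2 f + x3 * d i3 f + x4 * d i4 f + x5 * d i5 f.

Definition div (x : fld) : A :=
  let: (x1, x2, x3, x4, x5) := x in
  d i1 x1 + d i2 x2 + d i3 x3 + d i4 x4 + d i5 x5.

Definition lbr (x y : fld) : fld :=
  let: (x1, x2, x3, x4, x5) := x in
  let: (y1, y2, y3, y4, y5) := y in
  (app x y1 + app y x1, app x y2 + app y x2, app x y3 + app y x3,
   app x y4 + app y x4, app x y5 + app y x5).

(** A component of the vector product grad x4 x grad y5 + grad x5 x grad y4 of gradients in the
    three u-directions; signs are immaterial in characteristic 2. *)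
Definition cross (i j : J) (x y : fld) : A :=
  let: (_, _, _, x4, x5) := x in
  let: (_, _, _, y4, y5) := y in
  d i x4 * d j y5 + d i x5 * d j y4 + (d j x4 * d i y5 + d j x5 * d i y4).

Definition coc (x y : fld) : fld :=
  (cross i2 i3 x y, cross i3 i1 x y, cross i1 i2 x y, zero, zero).

Let dCs := (dC i2 i1, dC i3 i1, dC i4 i1, dC i5 i1, dC i3 i2, dC i4 i2, dC i5 i2,
            dC i4 i3, dC i5 i3, dC i5 i4).

Lemma d0 v : d v zero = zero.
Proof.
have e : d v (zero + zero) = zero by rewrite dD; ring.
rewrite -[RHS]e; congr (d v _); ring.
Qed.

Lemma div_lbr x y : div x = zero -> div y = zero -> div (lbr x y) = zero.
Proof.
case: x => [[[[x1 x2] x3] x4] x5]; case: y => [[[[y1 y2] y3] y4] y5] dx dy.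
have -> : div (lbr (x1, x2, x3, x4, x5) (y1, y2, y3, y4, y5)) =
   app (x1, x2, x3, x4, x5) (div (y1, y2, y3, y4, y5)) +
   app (y1, y2, y3, y4, y5) (div (x1, x2, x3, x4, x5)).
  by rewrite /div /lbr /app !(dD, dM) !dCs; ring.
by rewrite dx dy /app !d0; ring.
Qed.

Lemma div_coc x y : div (coc x y) = zero.
Proof.
case: x => [[[[x1 x2] x3] x4] x5]; case: y => [[[[y1 y2] y3] y4] y5].
by rewrite /div /coc /cross !d0 !(dD, dM) !dCs; ring.
Qed.

(** Applying [coc y z] to x4 gives the triple products (x4, y4, z5) and (x4, y5, z4) of gradients.
    In the cyclic sum every triple product occurs twice. *)
Lemma coc_jacobi4 x y z :
  app (coc y z) x.1.2 + app (coc z x) y.1.2 + app (coc x y) z.1.2 = zero.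
Proof.
case: x => [[[[x1 x2] x3] x4] x5]; case: y => [[[[y1 y2] y3] y4] y5].
by case: z => [[[[z1 z2] z3] z4] z5] /=; ring.
Qed.

Lemma coc_jacobi5 x y z :
  app (coc y z) x.2 + app (coc z x) y.2 + app (coc x y) z.2 = zero.
Proof.
case: x => [[[[x1 x2] x3] x4] x5]; case: y => [[[[y1 y2] y3] y4] y5].
by case: z => [[[[z1 z2] z3] z4] z5] /=; ring.
Qed.

(** Transporting a vector product of gradients along a field costs the trace of its Jacobian in the
    three u-directions. For [z], vanishing divergence turns this trace into d_4 z4 + d_5 z5, which
    is what the derivatives of z4 and z5 along the directions 4 and 5 contribute to [cross] through
    the inner brackets. *)
Lemma coc_jacobi1 x y z : div x = zero -> div y = zero -> div z = zero ->
  app x (cross i2 i3 y z) + app (coc y z) x.1.1.1.1 +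
  (app y (cross i2 i3 z x) + app (coc z x) y.1.1.1.1) +
  (app z (cross i2 i3 x y) + app (coc x y) z.1.1.1.1) +
  cross i2 i3 x (lbr y z) + cross i2 i3 y (lbr z x) + cross i2 i3 z (lbr x y) = zero.
Proof.
(* Each divergence relation becomes a rewrite rule for [d i1] of the first component; the identity
   is then polynomial in the remaining derivatives. *)
have solve a b c e f : a + b + c + e + f = zero -> a = b + c + e + f.
  by move=> h; transitivity (a + (a + b + c + e + f)); [rewrite h|]; ring.
case: x => [[[[x1 x2] x3] x4] x5]; case: y => [[[[y1 y2] y3] y4] y5].
case: z => [[[[z1 z2] z3] z4] z5] /solve dx /solve dy /solve dz /=.
rewrite !(dD, dM) !dCs dx dy dz.
Time ring.
Qed.

End CocycleIdentities.
End Char2.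

Local Opaque dpmul dpartial.

(** * Indices modulo 3 and sums over permutations *)

Lemma ord3P (P : 'I_3 -> Prop) : P 0 -> P 1 -> P 2%:R -> forall i, P i.
Proof.
move=> P0 P1 P2 [[|[|[|//]]] lti].
- by have -> : Ordinal lti = 0 by apply: val_inj.
- by have -> : Ordinal lti = 1 by apply: val_inj.
- by have -> : Ordinal lti = 2%:R by apply: val_inj.
Qed.

Lemma ord3_const (T : Type) (F : 'I_3 -> T) :
  (forall k, F (k + 1) = F k) -> forall k, F k = F 0.
Proof.
move=> FE; apply: ord3P => //; first by rewrite -(add0r 1) FE.
by rewrite -[2%:R]/(1 + 1) FE -(add0r 1) FE.
Qed.

Lemma ord2P (P : 'I_2 -> Prop) : P 0 -> P 1 -> forall i, P i.
Proof.
move=> P0 P1 [[|[|//]] lti].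
- by have -> : Ordinal lti = 0 by apply: val_inj.
- by have -> : Ordinal lti = 1 by apply: val_inj.
Qed.

Lemma sum_ord3 (V : nmodType) (F : 'I_3 -> V) (k : 'I_3) :
  \sum_i F i = F k + F (k + 1) + F (k + 2%:R).
Proof.
rewrite !big_ord_recl big_ord0 addr0.
have -> : lift ord0 (lift ord0 (ord0 : 'I_1)) = 2%:R :> 'I_3 by apply: val_inj.
have -> : lift ord0 (ord0 : 'I_2) = 1 :> 'I_3 by apply: val_inj.
have -> : ord0 = 0 :> 'I_3 by [].
elim/ord3P: k.
- by rewrite !add0r addrA.
- have -> : 1 + 1 = 2%:R :> 'I_3 by [].
  have -> : 1 + 2%:R = 0 :> 'I_3 by apply: val_inj.
  by rewrite [RHS]addrC.
have -> : 2%:R + 1 = 0 :> 'I_3 by apply: val_inj.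
have -> : 2%:R + 2%:R = 1 :> 'I_3 by apply: val_inj.
by rewrite addrA addrC addrA.
Qed.

Lemma sum_ord5 (V : nmodType) (F : 'I_5 -> V) (k : 'I_3) :
  \sum_i F i = F (iu k) + F (iu (k + 1)) + F (iu (k + 2%:R)) +
               F (ichi 0) + F (ichi 1).
Proof.
rewrite -[LHS]/(\sum_(i < 3 + 2) F i) big_split_ord /= (sum_ord3 _ k) -!addrA.
do 3![congr (_ + _)]; rewrite !big_ord_recl big_ord0 addr0.
by congr (F _ + F _); apply: val_inj.
Qed.

Lemma ord5P (P : 'I_5 -> Prop) :
  (forall k, P (iu k)) -> P (ichi 0) -> P (ichi 1) -> forall v, P v.
Proof.
move=> Pu P0 P1 [[|[|[|[|[|//]]]]] ltv].
- by rewrite (_ : Ordinal ltv = iu 0) //; apply: val_inj.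
- by rewrite (_ : Ordinal ltv = iu 1) //; apply: val_inj.
- by rewrite (_ : Ordinal ltv = iu 2%:R) //; apply: val_inj.
- by rewrite (_ : Ordinal ltv = ichi 0) //; apply: val_inj.
by rewrite (_ : Ordinal ltv = ichi 1) //; apply: val_inj.
Qed.

Lemma sum_perm3 (V : nmodType) (G : 'I_3 -> 'I_3 -> 'I_3 -> V) :
  \sum_(s : 'S_3) G (s 0) (s 1) (s 2%:R) =
  \sum_k (G (k + 1) (k + 2%:R) k + G (k + 2%:R) (k + 1) k).
Proof.
(* The six permutations are the rotations and the reflections of Z/3, parametrized so that [p.1] is
   the image of 2. *)
pose rotp (p : 'I_3 * bool) (i : 'I_3) : 'I_3 :=
  if p.2 then p.1 + 1 + i else p.1 + 2%:R - i.
have rotp_inj p : injective (rotp p).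
  by case: p => a [] i j; rewrite /rotp /= => /addrI // /oppr_inj.
pose h p : 'S_3 := perm (@rotp_inj p).
have hE p i : h p i = rotp p i by rewrite permE.
have h_inj : injective h.
  case=> a b [a' b'] E.
  have e0 : h (a, b) 0 = h (a', b') 0 by rewrite E.
  have e1 : h (a, b) 1 = h (a', b') 1 by rewrite E.
  move: e0 e1; rewrite !hE /rotp /=.
  case: b b' {E} => -[] /=; elim/ord3P: a; elim/ord3P: a' => //= e0 e1;
  by have := congr1 val e0; have := congr1 val e1.
have h_bij : bijective h.
  apply: inj_card_bij => //.
  by rewrite card_Sn card_prod card_ord card_bool.
rewrite (reindex h) /=; last exact: onW_bij.
transitivity (\sum_(p : 'I_3 * bool)
    G (h (p.1, p.2) 0) (h (p.1, p.2) 1) (h (p.1, p.2) 2%:R)).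
  by apply: eq_bigr => -[].
rewrite -(pair_bigA _ (fun a b => G (h (a, b) 0) (h (a, b) 1) (h (a, b) 2%:R))) /=.
apply: eq_bigr => k _; rewrite big_bool /= !hE /rotp /=.
congr (G _ _ _ + G _ _ _); elim/ord3P: k => //=; exact: val_inj.
Qed.

(** * The untruncated algebra *)

(* The operations of the untruncated algebra are locked: comparing two distinct
   products by conversion would unfold them down to finite maps. *)
HB.lock Definition wmul (K : fieldType) (I : finType) (f g : dp K I) : dp K I :=
  dpmul (@unconstrained I) f g.
HB.lock Definition pd (K : fieldType) (I : finType) (v : I) (f : dp K I) : dp K I :=
  dpartial v f.
HB.lock Definition wone (K : fieldType) (I : finType) : dp K I := dpone K I.
HB.lock Definition vapp (K : fieldType) (I : finType) (D : vfield K I) (f : dp K I) :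
  dp K I := vapply (@unconstrained I) D f.
HB.lock Definition wbr (K : fieldType) (I : finType) (D E : vfield K I) : vfield K I :=
  vbracket (@unconstrained I) D E.

Notation "f ** g" := (wmul f g) (at level 40, left associativity).
Notation "D @@ f" := (vapp D f) (at level 30).

Section Wide.
Variables (K : fieldType) (I : finType).
Hypothesis char2 : 2%N \in [pchar K].
Implicit Types (N : I -> height) (f g h : dp K I) (D E F : vfield K I) (a : K).

Lemma woneE : wone K I = dpone K I.
Proof. by rewrite wone.unlock. Qed.
Lemma wmulC f g : f ** g = g ** f.
Proof. by rewrite wmul.unlock dpmulC. Qed.
Lemma wmulA f g h : f ** (g ** h) = f ** g ** h.
Proof. by rewrite wmul.unlock dpmulA. Qed.
Lemma wmul1 f : wone K I ** f = f.
Proof. by rewrite wmul.unlock wone.unlock dpmul1. Qed.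
Lemma wmulr1 f : f ** wone K I = f.
Proof. by rewrite wmulC wmul1. Qed.
Lemma wmul_linear f : linear (wmul f).
Proof. by move=> a g h; rewrite wmul.unlock dpmul_linear. Qed.
Lemma wmul_linear_l g : linear (fun f => f ** g).
Proof. by move=> a f h; rewrite wmul.unlock dpmul_linear_l. Qed.
HB.instance Definition _ f :=
  GRing.isLinear.Build K (dp K I) (dp K I) *:%R (wmul f) (wmul_linear f).
Lemma wmulDl f g h : (f + g) ** h = f ** h + g ** h.
Proof. by rewrite wmul.unlock dpmulDl. Qed.
Lemma wmul0l f : 0 ** f = 0.
Proof. by rewrite wmul.unlock dpmul0l. Qed.
Lemma wmul0r f : f ** 0 = 0.
Proof. by rewrite wmul.unlock dpmul0r. Qed.

Lemma pd_linear v : linear (@pd K I v).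
Proof. by move=> a f g; rewrite pd.unlock dpartial_linear. Qed.
HB.instance Definition _ v :=
  GRing.isLinear.Build K (dp K I) (dp K I) *:%R (pd v) (pd_linear v).
Lemma pdD v f g : pd v (f + g) = pd v f + pd v g.
Proof. exact: linearD. Qed.
Lemma pd0 v : pd v 0 = 0 :> dp K I.
Proof. exact: linear0. Qed.
Lemma pdM v f g : pd v (f ** g) = pd v f ** g + f ** pd v g.
Proof. by rewrite pd.unlock wmul.unlock dpartialM. Qed.
Lemma pdC v w f : pd v (pd w f) = pd w (pd v f).
Proof. by rewrite pd.unlock dpartialC. Qed.
Lemma pd_one v : pd v (wone K I) = 0.
Proof. by rewrite pd.unlock wone.unlock dpartial1. Qed.
Lemma pd_var v w : pd v (dpvar K w) = if v == w then wone K I else 0.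
Proof. by rewrite pd.unlock wone.unlock dpartial_var. Qed.

Lemma dpmul_wide N f g : divpow N f -> divpow N g -> dpmul N f g = f ** g.
Proof. by move=> Nf Ng; rewrite (dpmul_divpow char2 Nf Ng) wmul.unlock. Qed.
Lemma dpartial_wide v f : dpartial v f = pd v f. Proof. by rewrite pd.unlock. Qed.
Lemma divpow_wmul N f g : divpow N f -> divpow N g -> divpow N (f ** g).
Proof. by move=> Nf Ng; rewrite -(dpmul_wide Nf Ng); apply: divpow_mul. Qed.
Lemma divpow_pd N v f : divpow N f -> divpow N (pd v f).
Proof. by rewrite pd.unlock; apply: divpow_partial. Qed.
Lemma divpow_one N : divpow N (wone K I).
Proof. by rewrite wone.unlock; apply: divpow1. Qed.
Lemma divpow_unconstrained f : divpow (@unconstrained I) f.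
Proof. by move=> r _; apply/forallP. Qed.

Lemma vfieldD D E v : (D + E) v = D v + E v.
Proof. by rewrite ffunE. Qed.
Lemma vfieldZ a D v : (a *: D) v = a *: D v.
Proof. by rewrite ffunE. Qed.
Lemma vfield0 v : (0 : vfield K I) v = 0.
Proof. by rewrite ffunE. Qed.
Lemma vfield_lin a D E v : (a *: D + E) v = a *: D v + E v.
Proof. by rewrite vfieldD vfieldZ. Qed.

Lemma vappE D f : D @@ f = \sum_v D v ** pd v f.
Proof. by rewrite vapp.unlock wmul.unlock pd.unlock. Qed.
Lemma vapp_linear D : linear (vapp D).
Proof. by rewrite vapp.unlock; apply: vapply_linear. Qed.
HB.instance Definition _ D :=
  GRing.isLinear.Build K (dp K I) (dp K I) *:%R (vapp D) (vapp_linear D).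
Lemma vapp_linear_l f : linear (fun D => D @@ f).
Proof. by rewrite vapp.unlock; apply: vapply_linear_l. Qed.
Lemma vapp0 D : D @@ 0 = 0.
Proof. exact: linear0. Qed.
Lemma vappD D f g : D @@ (f + g) = D @@ f + D @@ g.
Proof. exact: linearD. Qed.
Lemma vappDl D E f : (D + E) @@ f = D @@ f + E @@ f.
Proof. by rewrite -[D in LHS]scale1r vapp_linear_l scale1r. Qed.
Lemma vappM D f g : D @@ (f ** g) = (D @@ f) ** g + f ** (D @@ g).
Proof. by rewrite vapp.unlock wmul.unlock vapplyM. Qed.
Lemma vapp_var D v : D @@ dpvar K v = D v.
Proof. by rewrite vapp.unlock vapply_var. Qed.
Lemma vapply_wide N D f : (forall v, divpow N (D v)) -> divpow N f ->
  vapply N D f = D @@ f.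
Proof. by move=> ND Nf; rewrite vapply_divpow // vapp.unlock. Qed.
Lemma divpow_vapp N D f : (forall v, divpow N (D v)) -> divpow N f ->
  divpow N (D @@ f).
Proof. by move=> ND Nf; rewrite -(vapply_wide ND Nf); apply: divpow_vapply. Qed.

Lemma wbrE D E v : wbr D E v = D @@ E v + E @@ D v.
Proof.
by rewrite wbr.unlock vapp.unlock vbracketE (oppr_lmod2 _ char2).
Qed.
Lemma wbr_apply D E f : wbr D E @@ f = D @@ (E @@ f) + E @@ (D @@ f).
Proof.
rewrite wbr.unlock vapp.unlock vapply_bracket; congr (_ + _).
by rewrite (oppr_lmod2 _ char2).
Qed.
Lemma vfield_ext D E : (forall f, D @@ f = E @@ f) -> D = E.
Proof. by move=> DE; apply/ffunP => v; rewrite -!vapp_var. Qed.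
Lemma vbracket_wide N D E : (forall v, divpow N (D v)) ->
  (forall v, divpow N (E v)) -> vbracket N D E = wbr D E.
Proof. by move=> ND NE; rewrite vbracket_divpow // wbr.unlock. Qed.

Lemma wide_ring_theory :
  ring_theory (0 : dp K I) (wone K I) +%R (@wmul K I) +%R id eq.
Proof.
split=> //; [exact: add0r|exact: addrC|exact: addrA|exact: wmul1|exact: wmulC
  |exact: wmulA|exact: wmulDl|].
by move=> x; apply: addrr_lmod2.
Qed.

End Wide.

Section SvectCocycle.
Variable K : fieldType.
Hypothesis char2 : 2%N \in [pchar K].
Local Notation vf := (vfield K 'I_5).
Local Notation fieldT := (fld (dp K 'I_5)).
Implicit Types (N : 'I_5 -> height) (D E F : vf) (f g : dp K 'I_5) (k : 'I_3).

(** The u-directions are listed cyclically from [k], so that an identity for the first component of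
    a quintuple yields the one for every [iu k]. *)
Definition comps k D : fieldT :=
  (D (iu k), D (iu (k + 1)), D (iu (k + 2%:R)), D (ichi 0), D (ichi 1)).

Local Notation at_k L k := (L (iu k) (iu (k + 1)) (iu (k + 2%:R)) (ichi 0) (ichi 1)).
Local Notation d5 := (@pd K 'I_5).

Lemma vapp_comps k D f : D @@ f = at_k (app +%R (@wmul K 'I_5) d5) k (comps k D) f.
Proof. by rewrite vappE (sum_ord5 _ k). Qed.

Lemma comps_bracket k D E :
  comps k (wbr D E) = at_k (lbr +%R (@wmul K 'I_5) d5) k (comps k D) (comps k E).
Proof. by rewrite /comps !(wbrE char2) !(vapp_comps k). Qed.

Definition grad2 D E i j : dp K 'I_5 :=
  pd (iu i) (D (ichi 0)) ** pd (iu j) (E (ichi 1)) +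
  pd (iu i) (D (ichi 1)) ** pd (iu j) (E (ichi 0)).

Definition wcoc D E : vf := [ffun v => \sum_k
  if v == iu k then grad2 D E (k + 1) (k + 2%:R) + grad2 D E (k + 2%:R) (k + 1) else 0].

Lemma vmul_vpartial N (f : dp K 'I_5) v w : divpow N f ->
  vmul N f (vpartial K v) w = if w == v then f else 0.
Proof.
move=> Nf; rewrite ffunE ffunE; case: eqP => _; last exact: dpmul0r.
by rewrite (dpmul_wide char2 Nf (@divpow1 K _ N)) -woneE wmulr1.
Qed.

Lemma divpow_grad2 N D E i j : (forall v, divpow N (D v)) ->
  (forall v, divpow N (E v)) -> divpow N (grad2 D E i j).
Proof.
by move=> ND NE; apply: (subspaceD (divpow_subspace K N));
  apply: (divpow_wmul char2); apply: divpow_pd.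
Qed.

Lemma ichi_iu s k : (ichi s == iu k) = false.
Proof. by apply/eqP => /(congr1 val) /= E; have := ltn_ord k; rewrite -E. Qed.

Lemma iu_inj : injective iu. Proof. exact: lshift_inj. Qed.

Lemma svect_cocycle_wide N D E : (forall v, divpow N (D v)) ->
  (forall v, divpow N (E v)) -> svect_cocycle N D E = wcoc D E.
Proof.
move=> ND NE; rewrite /svect_cocycle /=.
transitivity (\sum_(s : 'S_3)
    vmul N (grad2 D E (s 0) (s 1)) (vpartial K (iu (s 2%:R)))).
  apply: eq_bigr => s _; move: (s 0) (s 1) (s 2%:R) => i j k.
  rewrite !dpartial_wide.
  by rewrite !(dpmul_wide char2 (N := N)) //; apply: divpow_pd.
rewrite (sum_perm3 (fun a b c => vmul N (grad2 D E a b) (vpartial K (iu c)))).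
apply/ffunP => v; rewrite sum_ffunE [RHS]ffunE; apply: eq_bigr => k _.
rewrite vfieldD; move: (k + 1) (k + 2%:R) => i j.
rewrite (vmul_vpartial _ _ (@divpow_grad2 N D E i j ND NE)).
rewrite (vmul_vpartial _ _ (@divpow_grad2 N D E j i ND NE)).
by case: ifP; rewrite ?addr0.
Qed.

Lemma wcoc_chi D E s : wcoc D E (ichi s) = 0.
Proof. by rewrite ffunE big1 // => k _; rewrite ichi_iu. Qed.

Lemma wcoc_u D E k : wcoc D E (iu k) =
  grad2 D E (k + 1) (k + 2%:R) + grad2 D E (k + 2%:R) (k + 1).
Proof.
rewrite ffunE (bigD1 k) //= eqxx big1 ?addr0 // => l lk.
by rewrite (inj_eq iu_inj) eq_sym (negbTE lk).
Qed.

Lemma comps_cocycle k D E : comps k (wcoc D E) =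
  coc (0 : dp K 'I_5) +%R (@wmul K 'I_5) d5 (iu k) (iu (k + 1)) (iu (k + 2%:R))
    (comps k D) (comps k E).
Proof.
rewrite /comps !wcoc_u !wcoc_chi /coc.
have -> : k + 1 + 1 = k + 2%:R by rewrite -addrA.
have -> : k + 1 + 2%:R = k by elim/ord3P: k; apply: val_inj.
have -> : k + 2%:R + 1 = k by elim/ord3P: k; apply: val_inj.
have -> : k + 2%:R + 2%:R = k + 1 by elim/ord3P: k; apply: val_inj.
by [].
Qed.

Lemma divpow_wcoc N D E : (forall v, divpow N (D v)) ->
  (forall v, divpow N (E v)) -> forall v, divpow N (wcoc D E v).
Proof.
move=> ND NE v; rewrite ffunE; apply: (subspace_sumT (divpow_subspace K N)) => k.
case: ifP => _; last exact: subspace0 (divpow_subspace K N).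
by apply: (subspaceD (divpow_subspace K N)); apply: divpow_grad2.
Qed.

End SvectCocycle.

(** * The deform is a Lie algebra *)

Lemma lie_algebra_ext (K : fieldType) (V : lmodType K) (A : set V)
    (b b' : V -> V -> V) : (forall x y, A x -> A y -> b x y = b' x y) ->
  is_lie_algebra (Lie A b') -> is_lie_algebra (Lie A b).
Proof.
move=> bb' [] /= sA clA biA altA jacA; split=> //=.
- by move=> x y Ax Ay; rewrite bb' //; apply: clA.
- move=> a x y z Ax Ay Az; have Axy : A (a *: x + y) by apply: (proj2 sA).
  by rewrite !bb' //; apply: biA.
- by move=> x Ax; rewrite bb' //; apply: altA.
move=> x y z Ax Ay Az; rewrite (bb' _ _ Ax Ay) (bb' _ _ Ay Az) (bb' _ _ Az Ax).
by rewrite !bb' //; [apply: jacA | apply: clA | apply: clA | apply: clA].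
Qed.

Section WideBracket.
Variables (K : fieldType) (I : finType).
Hypothesis char2 : 2%N \in [pchar K].
Implicit Types (D E F : vfield K I) (a : K).

Lemma wbr_linear_l E : linear (fun D => wbr D E).
Proof.
move=> a D D'; rewrite wbr.unlock.
exact: (proj1 (@vbracket_bilinear K I (@unconstrained I) setT a D D' E
  Logic.I Logic.I Logic.I)).
Qed.
Lemma wbr_linear D : linear (wbr D).
Proof.
move=> a E E'; rewrite wbr.unlock.
exact: (proj2 (@vbracket_bilinear K I (@unconstrained I) setT a E E' D
  Logic.I Logic.I Logic.I)).
Qed.
HB.instance Definition _ D :=
  GRing.isLinear.Build K (vfield K I) (vfield K I) *:%R (wbr D) (wbr_linear D).
Definition wbrl E D := wbr D E.
HB.instance Definition _ E :=
  GRing.isLinear.Build K (vfield K I) (vfield K I) *:%R (wbrl E) (wbr_linear_l E).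
Lemma wbrDl D D' E : wbr (D + D') E = wbr D E + wbr D' E.
Proof. exact: (linearD (wbrl E)). Qed.
Lemma wbrDr D E E' : wbr D (E + E') = wbr D E + wbr D E'.
Proof. exact: linearD. Qed.
Lemma wbrZr a D E : wbr D (a *: E) = a *: wbr D E.
Proof. exact: linearZ_LR. Qed.
Lemma wbr_self D : wbr D D = 0.
Proof. by apply/ffunP => v; rewrite (wbrE char2) addrr_lmod2 // vfield0. Qed.
Lemma wbr_jacobi D E F : wbr D (wbr E F) + wbr E (wbr F D) + wbr F (wbr D E) = 0.
Proof.
have U (P : vfield K I) : car (vect K (@unconstrained I)) P.
  by move=> v; apply: divpow_unconstrained.
by have := vbracket_jacobi char2 (U D) (U E) (U F); rewrite wbr.unlock.
Qed.
Lemma wbrC D E : wbr D E = wbr E D.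
Proof. by apply/ffunP => v; rewrite !(wbrE char2) addrC. Qed.
End WideBracket.

HB.lock Definition svs (K : fieldType) (N : 'I_5 -> height) : set (vfield K 'I_5) :=
  car (svect K N).

Lemma svectE (K : fieldType) (N : 'I_5 -> height) :
  svect K N = Lie (@svs K N) (vbracket N).
Proof. by rewrite svs.unlock. Qed.

Section WideCocycle.
Variable K : fieldType.
Hypothesis char2 : 2%N \in [pchar K].
Implicit Types (D E F : vfield K 'I_5) (a : K).

Lemma grad2_linear_l a D D' E i j :
  grad2 (a *: D + D') E i j = a *: grad2 D E i j + grad2 D' E i j.
Proof.
by rewrite /grad2 !vfield_lin !pd_linear !wmul_linear_l scalerDr addrACA.
Qed.
Lemma grad2_linear a D E E' i j :
  grad2 D (a *: E + E') i j = a *: grad2 D E i j + grad2 D E' i j.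
Proof.
by rewrite /grad2 !vfield_lin !pd_linear !wmul_linear scalerDr addrACA.
Qed.
Let lin_shuffle a (x y z w : dp K 'I_5) :
  a *: x + y + (a *: z + w) = a *: (x + z) + (y + w).
Proof. by rewrite scalerDr addrACA. Qed.

Lemma wcoc_linear_l E : linear (fun D => wcoc D E).
Proof.
move=> a D D'; apply/ffunP => v; rewrite vfield_lin; elim/ord5P: v => [k||].
- rewrite !wcoc_u !grad2_linear_l; exact: lin_shuffle.
- by rewrite !wcoc_chi scaler0 addr0.
by rewrite !wcoc_chi scaler0 addr0.
Qed.
Lemma wcoc_linear D : linear (wcoc D).
Proof.
move=> a E E'; apply/ffunP => v; rewrite vfield_lin; elim/ord5P: v => [k||].
- rewrite !wcoc_u !grad2_linear; exact: lin_shuffle.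
- by rewrite !wcoc_chi scaler0 addr0.
by rewrite !wcoc_chi scaler0 addr0.
Qed.
HB.instance Definition _ D :=
  GRing.isLinear.Build K (vfield K 'I_5) (vfield K 'I_5) *:%R (wcoc D) (wcoc_linear D).
Definition wcocl E D := wcoc D E.
HB.instance Definition _ E :=
  GRing.isLinear.Build K (vfield K 'I_5) (vfield K 'I_5) *:%R (wcocl E)
    (wcoc_linear_l E).
Lemma wcocDl D D' E : wcoc (D + D') E = wcoc D E + wcoc D' E.
Proof. exact: (linearD (wcocl E)). Qed.
Lemma wcocDr D E E' : wcoc D (E + E') = wcoc D E + wcoc D E'.
Proof. exact: linearD. Qed.
Lemma wcocZr a D E : wcoc D (a *: E) = a *: wcoc D E.
Proof. exact: linearZ_LR. Qed.

Lemma grad2_swap D E i j : grad2 D E i j = grad2 E D j i.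
Proof. by rewrite /grad2 addrC ![pd (iu i) _ ** _]wmulC. Qed.

Lemma wcocC D E : wcoc D E = wcoc E D.
Proof.
apply/ffunP => v; elim/ord5P: v => [k||]; rewrite ?wcoc_chi // !wcoc_u.
by rewrite addrC; congr (_ + _); apply: grad2_swap.
Qed.

Lemma wcoc_self D : wcoc D D = 0.
Proof.
apply/ffunP => v; rewrite vfield0; elim/ord5P: v => [k||]; rewrite ?wcoc_chi //.
by rewrite wcoc_u [X in _ + X]grad2_swap addrr_lmod2.
Qed.

Lemma wcoc_chi0 D E : (forall s, E (ichi s) = 0) -> wcoc D E = 0.
Proof.
move=> E0; apply/ffunP => v; rewrite vfield0.
elim/ord5P: v => [k||]; rewrite ?wcoc_chi //.
by rewrite wcoc_u /grad2 !E0 !pd0 !wmul0r !addr0.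
Qed.

(** The cocycle reads only the chi-components of its arguments, and its values have none. Hence the
    Jacobi identity of the deformed bracket has no term in the square of t, and every t gives a Lie
    algebra. *)
Lemma wcoc_wcoc D E F : wcoc D (wcoc E F) = 0.
Proof. by apply: wcoc_chi0 => s; rewrite wcoc_chi. Qed.

Definition wdiv D : dp K 'I_5 := \sum_v pd v (D v).

Lemma wdiv_comps k D : wdiv D =
  div +%R (@pd K 'I_5) (iu k) (iu (k + 1)) (iu (k + 2%:R)) (ichi 0) (ichi 1) (comps k D).
Proof. exact: (sum_ord5 _ k). Qed.

Lemma wdivE D : \sum_v dpartial v (D v) = wdiv D.
Proof. by apply: eq_bigr => v _; rewrite dpartial_wide. Qed.

Lemma wdiv_linear : linear wdiv.
Proof.
move=> a D E; rewrite /wdiv scaler_sumr -big_split; apply: eq_bigr => v _ /=.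
by rewrite vfield_lin pd_linear.
Qed.

Let rt := wide_ring_theory 'I_5 char2.
Let dD := @pdD K 'I_5.
Let dM := @pdM K 'I_5.
Let dC := @pdC K 'I_5.

Lemma wdiv_wbr D E : wdiv D = 0 -> wdiv E = 0 -> wdiv (wbr D E) = 0.
Proof.
rewrite !(wdiv_comps 0) (comps_bracket char2 0) => D0 E0.
exact: (div_lbr rt dD dM dC).
Qed.

Lemma wdiv_wcoc D E : wdiv (wcoc D E) = 0.
Proof. by rewrite (wdiv_comps 0) comps_cocycle; apply: (div_coc rt dD dM dC). Qed.

Lemma wcoc_cocycle D E F : wdiv D = 0 -> wdiv E = 0 -> wdiv F = 0 ->
  wbr D (wcoc E F) + wbr E (wcoc F D) + wbr F (wcoc D E) +
  wcoc D (wbr E F) + wcoc E (wbr F D) + wcoc F (wbr D E) = 0.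
Proof.
have br_comp k P Q : wbr P Q (iu k) = (comps k (wbr P Q)).1.1.1.1 by [].
have co_comp k P Q : wcoc P Q (iu k) = (comps k (wcoc P Q)).1.1.1.1 by [].
move=> D0 E0 F0; apply/ffunP => v; rewrite vfield0 !vfieldD.
elim/ord5P: v => [k||].
- rewrite !br_comp !co_comp !(comps_bracket char2) !comps_cocycle.
  rewrite !(comps_bracket char2).
  apply: (coc_jacobi1 rt dD dM dC); rewrite -wdiv_comps //.
- rewrite !wcoc_chi !(wbrE char2) !wcoc_chi !vapp0 !addr0 !add0r !(vapp_comps 0).
  rewrite !comps_cocycle.
  exact: (coc_jacobi4 rt (@pd K 'I_5) (iu 0) (iu (0 + 1)) (iu (0 + 2%:R)) (ichi 0)
    (ichi 1) (comps 0 D) (comps 0 E) (comps 0 F)).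
rewrite !wcoc_chi !(wbrE char2) !wcoc_chi !vapp0 !addr0 !add0r !(vapp_comps 0).
rewrite !comps_cocycle.
exact: (coc_jacobi5 rt (@pd K 'I_5) (iu 0) (iu (0 + 1)) (iu (0 + 2%:R)) (ichi 0)
  (ichi 1) (comps 0 D) (comps 0 E) (comps 0 F)).
Qed.

Variable N : 'I_5 -> height.
Local Notation S := (@svs K N).

Lemma svsP D : S D <-> (forall v, divpow N (D v)) /\ wdiv D = 0.
Proof. by rewrite svs.unlock -wdivE; split=> -[]. Qed.

Lemma svs_vect D : S D -> forall v, divpow N (D v).
Proof. by move=> /svsP[]. Qed.

Lemma svs_div D : S D -> wdiv D = 0.
Proof. by move=> /svsP[]. Qed.

Lemma svect_brE D E : S D -> S E -> vbracket N D E = wbr D E.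
Proof. by move=> SD SE; apply: (vbracket_wide char2); apply: svs_vect. Qed.

Lemma svect_cocE D E : S D -> S E -> svect_cocycle N D E = wcoc D E.
Proof. by move=> SD SE; apply: (svect_cocycle_wide char2); apply: svs_vect. Qed.

Lemma svs_subspace : subspace S.
Proof.
have [V0 VD] := vect_subspace K N; split=> [|a D E SD SE].
  apply/svsP; split=> //; rewrite /wdiv big1 // => v _.
  by rewrite vfield0 pd0.
apply/svsP; split; first exact: VD (svs_vect SD) (svs_vect SE).
by rewrite wdiv_linear (svs_div SD) (svs_div SE) scaler0 addr0.
Qed.

Lemma svs_lin a D E : S D -> S E -> S (a *: D + E).
Proof. exact: (proj2 svs_subspace). Qed.

Lemma svs_wbr D E : S D -> S E -> S (wbr D E).
Proof.
move=> SD SE; apply/svsP; split.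
  move=> v; rewrite -(svect_brE SD SE).
  exact: (vect_closed (svs_vect SD) (svs_vect SE)).
exact: wdiv_wbr (svs_div SD) (svs_div SE).
Qed.

Lemma svs_wcoc D E : S D -> S E -> S (wcoc D E).
Proof.
move=> SD SE; apply/svsP; split; last exact: wdiv_wcoc.
exact: (divpow_wcoc char2 (svs_vect SD) (svs_vect SE)).
Qed.

Lemma svect_lie : is_lie_algebra (svect K N).
Proof.
rewrite svectE; apply: (sub_vect_lie char2 svs_subspace); first exact: svs_vect.
by move=> D E SD SE; rewrite (svect_brE SD SE); apply: svs_wbr SD SE.
Qed.

Lemma svect_cocycle_cocycle : cocycle (svect K N) (svect_cocycle N).
Proof.
rewrite svectE; split=> /=.
- by move=> D E SD SE; rewrite (svect_cocE SD SE); apply: svs_wcoc SD SE.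
- move=> a D E F SD SE SF; have SDE := svs_lin a SD SE.
  rewrite (svect_cocE SDE SF) (svect_cocE SF SDE) (svect_cocE SD SF).
  rewrite (svect_cocE SE SF) (svect_cocE SF SD) (svect_cocE SF SE).
  by rewrite wcoc_linear wcoc_linear_l.
- by move=> D SD; rewrite (svect_cocE SD SD) wcoc_self.
move=> D E F SD SE SF.
rewrite (svect_brE SD SE) (svect_brE SE SF) (svect_brE SF SD).
rewrite (svect_cocE SD SE) (svect_cocE SE SF) (svect_cocE SF SD).
rewrite (svect_brE SD (svs_wcoc SE SF)) (svect_brE SE (svs_wcoc SF SD)).
rewrite (svect_brE SF (svs_wcoc SD SE)) (svect_cocE SD (svs_wbr SE SF)).
rewrite (svect_cocE SE (svs_wbr SF SD)) (svect_cocE SF (svs_wbr SD SE)).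
exact: wcoc_cocycle (svs_div SD) (svs_div SE) (svs_div SF).
Qed.

Definition dbr (t : K) D E := wbr D E + t *: wcoc D E.

Lemma deform_brE t D E : S D -> S E ->
  vbracket N D E + t *: svect_cocycle N D E = dbr t D E.
Proof. by move=> SD SE; rewrite (svect_brE SD SE) (svect_cocE SD SE). Qed.

Lemma svs_dbr t D E : S D -> S E -> S (dbr t D E).
Proof.
move=> SD SE; apply: (subspaceD svs_subspace); first exact: svs_wbr.
by apply: (subspaceZ svs_subspace); apply: svs_wcoc.
Qed.

Lemma dbr_jacobi t D E F : S D -> S E -> S F ->
  dbr t D (dbr t E F) + dbr t E (dbr t F D) + dbr t F (dbr t D E) = 0.
Proof.
move=> SD SE SF.
rewrite /dbr !wbrDr !wbrZr !wcocDr !wcocZr !wcoc_wcoc !scaler0 !addr0.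
have C := wcoc_cocycle (svs_div SD) (svs_div SE) (svs_div SF).
have J := wbr_jacobi char2 D E F.
transitivity ((wbr D (wbr E F) + wbr E (wbr F D) + wbr F (wbr D E)) + t *:
  (wbr D (wcoc E F) + wbr E (wcoc F D) + wbr F (wcoc D E) +
  wcoc D (wbr E F) + wcoc E (wbr F D) + wcoc F (wbr D E))); last first.
  by rewrite J C scaler0 addr0.
have shuffle (a1 b1 c1 a2 b2 c2 a3 b3 c3 : vfield K 'I_5) :
    a1 + b1 + c1 + (a2 + b2 + c2) + (a3 + b3 + c3) =
    a1 + a2 + a3 + (b1 + b2 + b3 + c1 + c2 + c3).
  rewrite (addrACA (a1 + b1)) (addrACA a1) (addrACA (a1 + a2 + _)).
  by rewrite (addrACA (a1 + a2)) !addrA.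
rewrite !scalerDr; exact: shuffle.
Qed.

Lemma dbr_linear t D : linear (dbr t D).
Proof.
move=> a E E'; rewrite /dbr wcoc_linear wbr_linear !scalerDr !scalerA [t * a]mulrC.
exact: addrACA.
Qed.

Lemma dbr_linear_l t E : linear (fun D => dbr t D E).
Proof.
move=> a D D'; rewrite /dbr wcoc_linear_l wbr_linear_l !scalerDr !scalerA.
by rewrite [t * a]mulrC; apply: addrACA.
Qed.

Lemma dbr_self t D : dbr t D D = 0.
Proof. by rewrite /dbr wbr_self // wcoc_self scaler0 addr0. Qed.

Lemma deform_lie t : is_lie_algebra (deform (svect K N) (svect_cocycle N) t).
Proof.
rewrite svectE; apply: (lie_algebra_ext (b' := dbr t)).
  by move=> D E SD SE; apply: deform_brE.
split=> /=.
- exact: svs_subspace.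
- by move=> D E SD SE; apply: svs_dbr.
- by move=> a D E F _ _ _; rewrite dbr_linear dbr_linear_l.
- by move=> D _; apply: dbr_self.
by move=> D E F SD SE SF; apply: dbr_jacobi.
Qed.

End WideCocycle.

(** * The cocycle is not a coboundary *)

Section Filtrations.
Variables (K : fieldType) (I : finType) (w : I -> int).
Hypothesis char2 : 2%N \in [pchar K].
Implicit Types (r s : mindex I) (f g : dp K I) (D E : vfield K I) (d e : int).

Definition wt r : int := \sum_v w v *+ r v.

(** Two kinds of weights are used: with all weights -1 the condition bounds the order at the origin
    from below, with positive weights it bounds a weighted degree from above. *)
Definition fil d : set (dp K I) := supp_in (fun r => wt r <= d).

Definition vfil d : set (vfield K I) := [set D | forall v, fil (d + w v) (D v)].

Lemma fil_subspace d : subspace (fil d).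
Proof. exact: supp_in_subspace. Qed.

Lemma fil_le d e : d <= e -> fil d `<=` fil e.
Proof. by move=> de; apply: supp_in_sub => r rd; apply: le_trans de. Qed.

Lemma wt_madd r s : wt (madd r s) = wt r + wt s.
Proof.
by rewrite /wt -big_split; apply: eq_bigr => v _; rewrite ffunE mulrnDr.
Qed.

Lemma wt_mdec v r : r v != 0%N -> wt (mdec v r) = wt r - w v.
Proof.
move=> rv; rewrite /wt (bigD1 v) //= [in RHS](bigD1 v) //= addrAC; congr (_ + _).
  rewrite ffunE eqxx; case: (r v) rv => // n _.
  by rewrite subn1 /= mulrS addrAC subrr add0r.
by apply: eq_bigr => i /negbTE iv; rewrite ffunE iv subn0.
Qed.

Lemma fil_wmul d e f g : fil d f -> fil e g -> fil (d + e) (f ** g).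
Proof.
move=> df eg; rewrite wmul.unlock dpmulE.
apply: (lext_in (fil_subspace _)) => r /df rd.
apply: (lext_in (fil_subspace _)) => s /eg se.
rewrite mmul_unconstrained; apply: (subspaceZ (fil_subspace _)).
by apply: supp_in1; rewrite wt_madd lerD.
Qed.

Lemma fil_pd d v f : fil d f -> fil (d - w v) (pd v f).
Proof.
move=> df; rewrite pd.unlock dpartialE.
apply: (lext_in (fil_subspace _)) => r /df rd; case: ifPn => rv.
  exact: subspace0 (fil_subspace _).
by apply: supp_in1; rewrite wt_mdec // lerD2r.
Qed.

Lemma fil_vapp d e D f : vfil d D -> fil e f -> fil (d + e) (D @@ f).
Proof.
move=> dD ef; rewrite vappE; apply: (subspace_sumT (fil_subspace _)) => v.
have -> : d + e = (d + w v) + (e - w v) by rewrite addrACA subrr addr0.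
by apply: fil_wmul; [apply: dD | apply: fil_pd].
Qed.

Lemma vfil_subspace d : subspace (vfil d).
Proof.
split=> [v|a D E dD dE v]; first by rewrite vfield0; apply: subspace0 (fil_subspace _).
by rewrite vfield_lin; apply: (proj2 (fil_subspace _)).
Qed.

Lemma vfil_le d e : d <= e -> vfil d `<=` vfil e.
Proof. by move=> de D dD v; apply: fil_le (dD v); rewrite lerD2r. Qed.

Lemma vfil_wbr d e D E : vfil d D -> vfil e E -> vfil (d + e) (wbr D E).
Proof.
move=> dD eE v; rewrite (wbrE char2); apply: (subspaceD (fil_subspace _)).
  by rewrite -addrA; apply: fil_vapp.
by rewrite [d + e]addrC -addrA; apply: fil_vapp.
Qed.

End Filtrations.

Section SvectFiltrations.
Variables (K : fieldType) (w : 'I_5 -> int).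
Hypothesis char2 : 2%N \in [pchar K].
Hypothesis w_balanced : w (iu 0) + w (iu 1) + w (iu 2%:R) = w (ichi 0) + w (ichi 1).
Implicit Types (D E : vfield K 'I_5) (d e : int).

Lemma fil_grad2 d e D E i j : vfil w d D -> vfil w e E ->
  fil w (d + e + (w (ichi 0) + w (ichi 1) - w (iu i) - w (iu j))) (grad2 D E i j).
Proof.
move=> dD eE; apply: (subspaceD (fil_subspace _ _ _)).
  have -> : d + e + (w (ichi 0) + w (ichi 1) - w (iu i) - w (iu j)) =
    (d + w (ichi 0) - w (iu i)) + (e + w (ichi 1) - w (iu j)) by lia.
  by apply: fil_wmul; apply: fil_pd; [apply: dD | apply: eE].
have -> : d + e + (w (ichi 0) + w (ichi 1) - w (iu i) - w (iu j)) =
  (d + w (ichi 1) - w (iu i)) + (e + w (ichi 0) - w (iu j)) by lia.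
by apply: fil_wmul; apply: fil_pd; [apply: dD | apply: eE].
Qed.

(** The two factors carry the weights of chi_1 and chi_2, and the two derivatives remove those of
    u_i and u_j. By the balance condition the weight of u_k is left over, which is what a
    coefficient of d_k needs. *)
Lemma vfil_wcoc d e D E : vfil w d D -> vfil w e E -> vfil w (d + e) (wcoc D E).
Proof.
move=> dD eE; elim/ord5P => [k||]; last first.
- by rewrite wcoc_chi; apply: subspace0 (fil_subspace _ _ _).
- by rewrite wcoc_chi; apply: subspace0 (fil_subspace _ _ _).
have wk : w (ichi 0) + w (ichi 1) - w (iu (k + 1)) - w (iu (k + 2%:R)) = w (iu k).
  have := sum_ord3 (fun i => w (iu i)) 0; rewrite (sum_ord3 _ k) !add0r w_balanced.
  by move: (k + 1) (k + 2%:R) => i j; lia.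
rewrite wcoc_u -wk; apply: (subspaceD (fil_subspace _ _ _)); first exact: fil_grad2.
by rewrite [_ - w _ - w _]addrAC; apply: fil_grad2.
Qed.

Lemma vfil_dbr d e D E : vfil w d D -> vfil w e E -> vfil w (d + e) (dbr 1 D E).
Proof.
move=> dD eE; apply: (subspaceD (vfil_subspace _ _ _)); first exact: vfil_wbr.
by rewrite scale1r; apply: vfil_wcoc.
Qed.

End SvectFiltrations.

(** * Squarefree monomial fields *)

Section MonomialFields.
Variable K : fieldType.
Hypothesis char2 : 2%N \in [pchar K].
Implicit Types (S T : seq 'I_5) (i j v : 'I_5).

Definition ind S : mindex 'I_5 := [ffun v => (v \in S : nat)].
Local Notation u S := (<< ind S >> : dp K 'I_5).

(* [mf (S, i)] is the field u_S d_i, with u_S the product of the u_j, j in S. *)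
Definition mf (c : seq 'I_5 * 'I_5) : vfield K 'I_5 :=
  [ffun v => if v == c.2 then u c.1 else 0].

Lemma u_nil : u [::] = wone K 'I_5.
Proof. by rewrite woneE; congr << _ >>; apply/ffunP => v; rewrite !ffunE. Qed.

Lemma pd_u0 v S : v \notin S -> pd v (u S) = 0.
Proof. by rewrite pd.unlock dpartialU ffunE => /negbTE ->. Qed.

Lemma pd_u v S : v \notin S -> pd v (u (v :: S)) = u S.
Proof.
move=> vS; rewrite pd.unlock dpartialU ffunE mem_head; congr << _ >>.
apply/ffunP => i; rewrite !ffunE inE; case: (eqVneq i v) => [->|_].
  by rewrite (negbTE vS).
by rewrite subn0.
Qed.

Lemma mfE S i v : mf (S, i) v = if v == i then u S else 0.
Proof. by rewrite ffunE. Qed.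

Lemma mf_app S i f : mf (S, i) @@ f = u S ** pd i f.
Proof.
rewrite vappE (bigD1 i) //= mfE eqxx big1 ?addr0 // => v /negbTE vi.
by rewrite mfE vi wmul0l.
Qed.

Lemma wbr_mf S i T j v : wbr (mf (S, i)) (mf (T, j)) v =
  (if v == j then u S ** pd i (u T) else 0) +
  (if v == i then u T ** pd j (u S) else 0).
Proof.
rewrite (wbrE char2) !mf_app !mfE.
by congr (_ + _); case: ifP => _; rewrite ?pd0 ?wmul0r.
Qed.

Lemma wbr_mf_const S i j : j \notin S ->
  wbr (mf ([::], j)) (mf (j :: S, i)) = mf (S, i).
Proof.
move=> jS; apply/ffunP => v.
by rewrite wbr_mf u_nil wmul1 pd_u // pd_one wmul0r if_same addr0 mfE.
Qed.

Lemma wbr_mf_lin S i j : j \notin S -> i \notin S ->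
  wbr (mf (S, j)) (mf ([:: j], i)) = mf (S, i).
Proof.
move=> jS iS; apply/ffunP => v.
by rewrite wbr_mf (pd_u (S := [::])) // u_nil wmulr1 (pd_u0 iS) wmul0r if_same addr0 mfE.
Qed.

Lemma wcoc_mf_const j E : wcoc (mf ([::], j)) E = 0.
Proof.
have z a s : pd (iu a) (mf ([::], j) (ichi s)) = 0.
  by rewrite mfE u_nil; case: ifP => _; rewrite ?pd0 ?pd_one.
apply/ffunP => v; rewrite vfield0; elim/ord5P: v => [k||]; rewrite ?wcoc_chi //.
by rewrite wcoc_u /grad2 !z !wmul0l !addr0.
Qed.

Lemma iu_ichi a s : (iu a == ichi s) = false.
Proof. by rewrite eq_sym ichi_iu. Qed.

Lemma wcoc_mf_lin S i j : wcoc (mf (S, j)) (mf ([:: j], i)) = 0.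
Proof.
have z a b s t : pd (iu a) (mf (S, j) (ichi s)) ** pd (iu b) (mf ([:: j], i) (ichi t)) = 0.
  rewrite !mfE; have [<-|bj] := eqVneq (iu b) j.
    by rewrite ichi_iu pd0 wmul0l.
  rewrite [X in _ ** X](_ : _ = 0) ?wmul0r //; case: ifP => _; last exact: pd0.
  by rewrite pd_u0 // inE.
apply/ffunP => v; rewrite vfield0; elim/ord5P: v => [k||]; rewrite ?wcoc_chi //.
by rewrite wcoc_u /grad2 !z !addr0.
Qed.

Lemma pd_u1 a b : pd (iu a) (u [:: iu b]) = if a == b then wone K 'I_5 else 0.
Proof.
have [<-|ab] := eqVneq a b; first by rewrite (pd_u (S := [::])) // u_nil.
by rewrite pd_u0 // inE (inj_eq iu_inj).
Qed.

(* The new bracket of two fields that commute in svect. *)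
Lemma dbr_mf_chi k a b :
  ((a == k + 1) && (b == k + 2%:R)) || ((a == k + 2%:R) && (b == k + 1)) ->
  dbr 1 (mf ([:: iu a], ichi 0)) (mf ([:: iu b], ichi 1)) = mf ([::], iu k).
Proof.
have g x y : grad2 (mf ([:: iu a], ichi 0)) (mf ([:: iu b], ichi 1)) x y =
    if (x == a) && (y == b) then wone K 'I_5 else 0.
  have c01 : (ichi 0 == ichi 1) = false by [].
  have c10 : (ichi 1 == ichi 0) = false by [].
  rewrite /grad2 !mfE !eqxx c01 c10.
  rewrite !pd_u1 !pd0 wmul0r addr0; case: (x == a); case: (y == b);
  by rewrite ?wmul1 ?wmul0l ?wmul0r.
move=> abk; apply/ffunP => v; rewrite /dbr scale1r vfieldD wbr_mf.
rewrite !pd_u0 ?inE ?ichi_iu // !wmul0r !if_same add0r add0r mfE.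
elim/ord5P: v => [l||]; rewrite ?wcoc_chi ?ichi_iu //.
rewrite wcoc_u !g (inj_eq iu_inj) u_nil.
by case/orP: abk => /andP[/eqP-> /eqP->]; elim/ord3P: k; elim/ord3P: l;
  rewrite /= ?addr0 ?add0r.
Qed.

Lemma mf_svs N S i : shearing_vector N -> i \notin S -> svs N (mf (S, i)).
Proof.
move=> sN iS; apply/svsP; split=> [v|].
  rewrite mfE; case: ifP => _; last exact: subspace0 (divpow_subspace K N).
  apply: supp_in1; apply/forallP => l; rewrite ffunE.
  case: (l \in S) => /=; move: (sN l); rewrite /below_height;
    case: (N l) => // n; rewrite ?expn_gt0 //.
  by case: n => // n _; rewrite -{1}(expn0 2) ltn_exp2l.
rewrite /wdiv (bigD1 i) //= mfE eqxx pd_u0 // add0r big1 // => v /negbTE vi.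
by rewrite mfE vi pd0.
Qed.

Lemma mf_vfil (w : 'I_5 -> int) S i : uniq S ->
  vfil w (\sum_(j <- S) w j - w i) (mf (S, i)).
Proof.
move=> uS v; rewrite mfE; case: eqP => [->|_]; last exact: subspace0 (fil_subspace _ _ _).
have wtS : wt w (ind S) = \sum_(j <- S) w j.
  rewrite [RHS]big_uniq // [RHS]big_mkcond; apply: eq_bigr => j _.
  by rewrite ffunE; case: (j \in S).
by apply: supp_in1; rewrite subrK wtS.
Qed.

End MonomialFields.

(** * Leading parts and a dimension count *)

Section Present.
Variables (K : fieldType) (N : 'I_5 -> height) (w : 'I_5 -> int).
Hypothesis char2 : 2%N \in [pchar K].
Hypothesis w_balanced : w (iu 0) + w (iu 1) + w (iu 2%:R) = w (ichi 0) + w (ichi 1).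
Local Notation L := (@svs K N).
Implicit Types (B : set (vfield K 'I_5)) (x y : vfield K 'I_5) (d e : int).

(* [x], of degree at most [d], is the leading part of an element of [B]. *)
Definition present B d x := exists y, [/\ L y, vfil w (d - 1) y & B (x + y)].

Let addr_shuffle (V : zmodType) (a b c d a' b' c' d' : V) :
  a + b + (c + d) + (a' + b' + (c' + d')) = a + a' + (b + b' + (c + c' + (d + d'))).
Proof. by rewrite addrACA (addrACA a) (addrACA c) -addrA. Qed.

(** In the bracket of two elements, the three products other than that of the leading parts have
    degree at most [d + e - 1]. *)
Lemma present_dbr B B' B'' d e x y :
  (forall x y, L x -> L y -> B x -> B' y -> B'' (dbr 1 x y)) ->
  L x -> L y -> vfil w d x -> vfil w e y ->
  present B d x -> present B' e y -> present B'' (d + e) (dbr 1 x y).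
Proof.
move=> BB Lx Ly dx ey [x' [Lx' dx' Bx]] [y' [Ly' ey' By]].
have LD := subspaceD (@svs_subspace K N).
exists (dbr 1 x y' + (dbr 1 x' y + dbr 1 x' y')); split.
- by apply: (LD); [|apply: (LD)]; apply: svs_dbr.
- have F := vfil_dbr char2 w_balanced.
  have FD := subspaceD (@vfil_subspace K 'I_5 w (d + e - 1)).
  apply: (FD); first by rewrite -addrA; apply: (F).
  apply: (FD); first by rewrite addrAC; apply: (F).
  apply: vfil_le (F _ _ _ _ dx' ey'); lia.
have := BB _ _ (LD _ _ Lx Lx') (LD _ _ Ly Ly') Bx By.
suff -> : dbr 1 (x + x') (y + y') =
    dbr 1 x y + (dbr 1 x y' + (dbr 1 x' y + dbr 1 x' y')) by [].
by rewrite /dbr !wbrDl !wbrDr !wcocDl !wcocDr !scale1r; apply: addr_shuffle.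
Qed.

Lemma linear_on_sum (J : Type) (l : vfield K 'I_5 -> K) (s : seq J) (a : J -> K)
    (x : J -> vfield K 'I_5) :
  (forall b y z, L y -> L z -> l (b *: y + z) = b * l y + l z) ->
  (forall j, L (x j)) ->
  L (\sum_(j <- s) a j *: x j) /\ l (\sum_(j <- s) a j *: x j) = \sum_(j <- s) a j * l (x j).
Proof.
move=> lin Lx; have L0 := subspace0 (@svs_subspace K N).
have l0 : l 0 = 0.
  have := lin (- 1) 0 0 L0 L0; rewrite scaler0 addr0 mulN1r addNr; exact.
elim: s => [|j s [IHL IHl]]; first by rewrite !big_nil.
by rewrite !big_cons lin // IHl; split=> //; apply: svs_lin.
Qed.

(** With more fields than functionals, a nontrivial combination of the [x i] is killed by all [l j]
    and so lies in [B]. Its term of highest degree, unique because the degrees are distinct, becomes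
    after normalization the leading part of an element of [B], against its absence. *)
Lemma absent_bound (J : finType) (l : J -> vfield K 'I_5 -> K) B n
    (x : 'I_n -> vfield K 'I_5) (d : 'I_n -> int) :
  (forall j b y z, L y -> L z -> l j (b *: y + z) = b * l j y + l j z) ->
  (forall z, L z -> (forall j, l j z = 0) -> B z) ->
  injective d -> (forall i, L (x i)) -> (forall i, vfil w (d i) (x i)) ->
  (forall i, ~ present B (d i) (x i)) -> (n <= #|J|)%N.
Proof.
move=> lin kerB d_inj Lx dx absx; rewrite leqNgt; apply/negP => Jn.
pose M : 'M[K]_(n, #|J|) := \matrix_(i, j) l (enum_val j) (x i).
have : kermx M != 0.
  rewrite kermx_eq0; apply: contraL Jn => /eqP rM.
  by rewrite -leqNgt -{1}rM rank_leq_col.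
case/rowV0Pn => v /sub_kermxP vM /rV0Pn[i vi].
case: (@arg_maxP _ _ _ i (fun i => v 0 i != 0) d vi) => i0 vi0 max_i0; apply: (absx i0).
pose a i := v 0 i / v 0 i0; pose z := \sum_i a i *: x i.
have a1 : a i0 = 1 by rewrite /a divff.
exists (\sum_(i | i != i0) a i *: x i); split.
- rewrite big_mkcond; apply: (subspace_sumT (@svs_subspace K N)) => i'.
  case: ifP => _; last exact: subspace0 (@svs_subspace K N).
  by apply: (subspaceZ (@svs_subspace K N)).
- rewrite big_mkcond; apply: (subspace_sumT (@vfil_subspace K _ w _)) => i'.
  case: ifPn => ii0; last exact: subspace0 (@vfil_subspace K _ w _).
  have [v0|vi'] := eqVneq (v 0 i') 0.
    rewrite /a v0 mul0r scale0r; exact: subspace0 (@vfil_subspace K _ w _).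
  apply: (subspaceZ (@vfil_subspace K _ w _)); apply: vfil_le (dx i').
  have := max_i0 _ vi'; have : d i' != d i0 by rewrite (inj_eq d_inj).
  lia.
have -> : x i0 + \sum_(i | i != i0) a i *: x i = z.
  by rewrite /z [in RHS](bigD1 i0) //= a1 scale1r.
have lz j := linear_on_sum (index_enum _) a (lin j) Lx.
apply: kerB => [|j]; first exact: (subspace_sumT (@svs_subspace K N)) (fun i =>
  subspaceZ (@svs_subspace K N) (a i) (Lx i)).
rewrite (proj2 (lz j)).
have := congr1 (fun A : 'rV_ _ => A 0 (enum_rank j)) vM; rewrite !mxE => vMj.
transitivity ((v 0 i0)^-1 * \sum_i v 0 i * M i (enum_rank j)); last first.
  by rewrite vMj mulr0.
rewrite mulr_sumr; apply: eq_bigr => i' _.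
by rewrite mxE enum_rankK /a mulrA [_^-1 * _]mulrC.
Qed.

End Present.

(** * Constant terms of coboundaries *)

Section NotCoboundary.
Variables (K : fieldType) (N : 'I_5 -> height).
Hypothesis char2 : 2%N \in [pchar K].
Hypothesis shearN : shearing_vector N.

Local Notation order1 := (fun=> -1 : int).

Lemma order_ge0 (f : dp K 'I_5) : fil order1 0 f.
Proof.
apply: (supp_in_sub (P := fun=> True)) => // r _; rewrite /wt.
by apply: sumr_le0 => v _; rewrite mulrn_wle0.
Qed.

Lemma fil_coeff0 (f : dp K 'I_5) : fil order1 (-1) f -> f@_(ind [::]) = 0.
Proof.
move=> f1; apply/eqP/negPn/negP; rewrite mcoeff_neq0 => /f1.
by rewrite /wt big1 // => v _; rewrite ffunE.
Qed.

Lemma order1_vapp D (f : dp K 'I_5) : vfil order1 0 D -> fil order1 (-1) (D @@ f).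
Proof.
move=> vD; rewrite vappE; apply: (subspace_sumT (fil_subspace _ _ _)) => v.
have Dv : fil order1 (-1) (D v) by have := vD v; rewrite add0r.
exact: (fil_wmul Dv (@order_ge0 (pd v f))).
Qed.

Lemma svect_cocycle_not_coboundary : ~ coboundary (svect K N) (svect_cocycle N).
Proof.
rewrite svectE => -[al [/= al_L al_lin al_co]].
pose x := mf K ([:: iu 0], ichi 0); pose y := mf K ([:: iu 1], ichi 1).
have Lx : svs N x by apply: mf_svs.
have Ly : svs N y by apply: mf_svs.
have Lax := al_L _ Lx; have Lay := al_L _ Ly.
have := al_co _ _ Lx Ly.
rewrite (svect_brE char2 Lx Lay) (svect_brE char2 Lax Ly) (svect_brE char2 Lx Ly).
rewrite (svect_cocE char2 Lx Ly).
have xy0 : wbr x y = 0.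
  apply/ffunP => v; rewrite (wbr_mf char2) vfield0 !pd_u0 ?inE //.
  by rewrite !wmul0r !if_same addr0.
have al0 : al 0 = 0.
  have L0 := subspace0 (@svs_subspace K N).
  have := al_lin 1 0 0 L0 L0; rewrite !scale1r addr0 => /eqP.
  by rewrite addrC -subr_eq subrr => /eqP.
have cxy : wcoc x y = mf K ([::], iu 2%:R).
  by rewrite -(@dbr_mf_chi K char2 2%:R 0 1) // /dbr xy0 scale1r add0r.
have vx : vfil order1 0 x.
  by have := @mf_vfil K order1 [:: iu 0] (ichi 0) isT; rewrite big_seq1 subrr.
have vy : vfil order1 0 y.
  by have := @mf_vfil K order1 [:: iu 1] (ichi 1) isT; rewrite big_seq1 subrr.
(* Constant terms along [iu 2%:R] are compared. As [x] and [y] have no component there, only their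
   action on the components of [al y] and [al x] is left, and it kills constant terms since [x] and
   [y] vanish at the origin. *)
rewrite cxy xy0 al0 subr0 => /(congr1 (fun D : vfield K 'I_5 => (D (iu 2%:R))@_(ind [::]))).
have x2 : x (iu 2%:R) = 0 by rewrite mfE iu_ichi.
have y2 : y (iu 2%:R) = 0 by rewrite mfE iu_ichi.
rewrite vfieldD !(wbrE char2) x2 y2 !vapp0 addr0 add0r mfE eqxx mcoeffUU mcoeffD.
rewrite !fil_coeff0 ?addr0; [|exact: order1_vapp..].
by move/eqP; rewrite oner_eq0.
Qed.

End NotCoboundary.

(** * The deform is not isomorphic to svect *)

Lemma dbrDl (K : fieldType) t (D D' E : vfield K 'I_5) :
  dbr t (D + D') E = dbr t D E + dbr t D' E.
Proof. by rewrite /dbr wbrDl wcocDl scalerDr addrACA. Qed.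

Section NotIsomorphic.
Variables (K : fieldType) (N : 'I_5 -> height).
Hypothesis char2 : 2%N \in [pchar K].
Hypothesis shearN : shearing_vector N.
Local Notation vf := (vfield K 'I_5).
Local Notation L := (@svs K N).
Local Notation order1 := (fun=> -1 : int).

Variable phi : vf -> vf.
Hypothesis phi_L : forall x, L x -> L (phi x).
Hypothesis phi_inj : forall x, L x -> phi x = 0 -> x = 0.
Hypothesis phi_lin : forall a x y, L x -> L y -> phi (a *: x + y) = a *: phi x + phi y.
Hypothesis phi_hom : forall x y, L x -> L y -> phi (dbr 1 x y) = wbr (phi x) (phi y).

(* The transported standard filtration of svect: its member of index [-k] is
   made of the [x] all the components of [phi x] of which have order > k. *)
Definition Bk (k : int) : set vf := [set x | L x /\ vfil order1 k (phi x)].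

Lemma Bk_dbr k l x y : L x -> L y -> Bk k x -> Bk l y -> Bk (k + l) (dbr 1 x y).
Proof.
move=> Lx Ly [_ kx] [_ ly]; split; first exact: svs_dbr.
by rewrite phi_hom //; apply: vfil_wbr.
Qed.

(* The balance w1 + w2 + w3 = w4 + w5 makes the cocycle homogeneous; the values are
   such that all the monomial fields counted below have distinct degrees. *)
Definition wht (v : 'I_5) : int := nth 0 [:: 6; 8; 10; 23; 1] (val v).

Lemma wht_balanced : wht (iu 0) + wht (iu 1) + wht (iu 2%:R) = wht (ichi 0) + wht (ichi 1).
Proof. by []. Qed.

Implicit Types (S T : seq 'I_5) (i j v : 'I_5) (c : seq 'I_5 * 'I_5).

Definition degc c : int := foldr (fun j a => wht j + a) (- wht c.2) c.1.
Definition valid c := uniq c.1 && (c.2 \notin c.1).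

Lemma degc_cons j S i : degc (j :: S, i) = wht j + degc (S, i).
Proof. by []. Qed.

Lemma degc_nil i : degc ([::], i) = - wht i.
Proof. by []. Qed.

Lemma degcE c : degc c = \sum_(j <- c.1) wht j - wht c.2.
Proof.
case: c => S i /=; elim: S => [|j S IH]; first by rewrite big_nil sub0r.
by rewrite degc_cons IH big_cons addrA.
Qed.

Lemma valid_L c : valid c -> L (mf K c).
Proof. by case: c => S i /andP[_ iS]; apply: mf_svs. Qed.

Lemma valid_vfil c : uniq c.1 -> vfil wht (degc c) (mf K c).
Proof. by case: c => S i uS; rewrite degcE; apply: mf_vfil. Qed.

Definition pres k c := present N wht (Bk k) (degc c) (mf K c).

Lemma pres_const_add k l j S i : valid (j :: S, i) ->
  pres k ([::], j) -> pres l (j :: S, i) -> pres (k + l) (S, i).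
Proof.
move=> v P0 P; have /andP[/= ujS iS] := v; have /andP[jS uS] := ujS.
have E1 : dbr 1 (mf K ([::], j)) (mf K (j :: S, i)) = mf K (S, i).
  by rewrite /dbr wcoc_mf_const scaler0 addr0 (wbr_mf_const char2).
have E2 : degc ([::], j) + degc (j :: S, i) = degc (S, i).
  by rewrite degc_cons degc_nil addKr.
have := present_dbr char2 wht_balanced (@Bk_dbr k l) (valid_L (c := ([::], j)) isT)
  (valid_L v) (valid_vfil (c := ([::], j)) isT) (valid_vfil (c := (j :: S, i)) ujS) P0 P.
by rewrite E1 E2.
Qed.

Lemma pres_const k j S i : valid (j :: S, i) ->
  pres 0 ([::], j) -> pres k (j :: S, i) -> pres k (S, i).
Proof. by move=> v P Q; rewrite -[k]add0r; apply: pres_const_add v P Q. Qed.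

Lemma pres_lin k S i j : j != i -> j \notin S -> valid (S, i) ->
  pres 0 ([:: j], i) -> pres k (S, j) -> pres k (S, i).
Proof.
move=> ji jS v P0 P; have /andP[/= uS iS] := v.
have vj : valid (S, j) by rewrite /valid /= uS.
have vl : valid ([:: j], i) by rewrite /valid /= inE eq_sym.
have := present_dbr char2 wht_balanced (@Bk_dbr 0 k) (valid_L vl) (valid_L vj)
  (valid_vfil (c := ([:: j], i)) isT) (valid_vfil (c := (S, j)) uS) P0 P.
have E2 : degc ([:: j], i) + degc (S, j) = degc (S, i).
  by rewrite !degcE /= big_seq1; lia.
have E1 : dbr 1 (mf K ([:: j], i)) (mf K (S, j)) = mf K (S, i).
  rewrite /dbr scale1r (wbrC char2) (wbr_mf_lin char2 jS iS).
  by rewrite wcocC wcoc_mf_lin addr0.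
by rewrite add0r E1 E2.
Qed.

(** The rule that svect lacks: the two fields commute under the ordinary bracket. *)
Lemma pres_chi (k a b : 'I_3) :
  ((a == k + 1) && (b == k + 2%:R)) || ((a == k + 2%:R) && (b == k + 1)) ->
  pres 0 ([:: iu a], ichi 0) -> pres 0 ([:: iu b], ichi 1) -> pres 0 ([::], iu k).
Proof.
move=> abk P Q.
have va (s : 'I_2) (l : 'I_3) : valid ([:: iu l], ichi s) by rewrite /valid /= inE ichi_iu.
have := present_dbr char2 wht_balanced (@Bk_dbr 0 0) (valid_L (va _ _)) (valid_L (va _ _))
  (valid_vfil (c := ([:: iu a], ichi 0)) isT) (valid_vfil (c := ([:: iu b], ichi 1)) isT) P Q.
rewrite (dbr_mf_chi char2 abk) addr0.
suff -> : degc ([:: iu a], ichi 0) + degc ([:: iu b], ichi 1) = degc ([::], iu k) by [].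
by case/orP: abk => /andP[/eqP-> /eqP->]; elim/ord3P: k.
Qed.

(** Subsets are enumerated as lists so that the distinctness of degrees, the validity and the size
    of a concrete family are settled by evaluation. *)
Fixpoint subs (l : seq 'I_5) : seq (seq 'I_5) :=
  if l is j :: l' then subs l' ++ map (cons j) (subs l') else [:: [::]].

Lemma subs_subseq l T : T \in subs l -> subseq T l.
Proof.
elim: l T => [|j l IH] T; first by rewrite inE => /eqP->.
rewrite mem_cat => /orP[/IH sT | /mapP[T' /IH sT' ->]].
  exact: subseq_trans sT (subseq_cons _ _).
by rewrite /= eqxx.
Qed.

Definition over S i l := [seq (T ++ S, i) | T <- subs l].

(** Read backwards, [pres_const] makes all multiples of an absent field by variables of [l] absent,
    so one absence turns into 2 ^ [size l] of them. *)
Lemma supersets k l S i : (forall j, j \in l -> pres 0 ([::], j)) ->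
  ~ pres k (S, i) -> forall T, subseq T l -> valid (T ++ S, i) -> ~ pres k (T ++ S, i).
Proof.
move=> Pl A; elim=> [//|j T IH] sT v P.
have jl : j \in l by apply: (mem_subseq sT); rewrite mem_head.
have vT : valid (T ++ S, i).
  by move: v; rewrite /valid /= inE negb_or => /andP[/andP[_ ->] /andP[_ ->]].
apply: (IH _ vT); first exact: subseq_trans (subseq_cons _ _) sT.
exact: pres_const (Pl _ jl) P.
Qed.

Lemma absent_over k l S i : (forall j, j \in l -> pres 0 ([::], j)) ->
  ~ pres k (S, i) -> all valid (over S i l) ->
  forall c, c \in over S i l -> ~ pres k c.
Proof.
move=> Pl A v c cS; have vc := allP v _ cS.
by case/mapP: cS vc => T /subs_subseq sT -> vT; apply: (supersets Pl A sT vT).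
Qed.

Definition coef1 (p : 'I_5 * option 'I_5) (x : vf) : K :=
  (phi x p.1)@_(ind (if p.2 is Some v then [:: v] else [::])).

Definition coef0 (p : 'I_5) (x : vf) : K := (phi x p)@_(ind [::]).

Lemma wt_order (r : mindex 'I_5) : wt order1 r = - (\sum_v r v)%N%:Z.
Proof.
rewrite /wt (big_morph _ PoszD (erefl 0%:Z)) -sumrN; apply: eq_bigr => v _.
by rewrite mulNrn natz.
Qed.

Lemma deg_small (r : mindex 'I_5) : (\sum_v r v <= 1)%N ->
  r = ind [::] \/ exists v, r = ind [:: v].
Proof.
have [/existsP[v rv] | /existsPn r0] := boolP [exists v, r v != 0%N]; last first.
  move=> _; left; apply/ffunP => v; rewrite ffunE /=.
  by apply/eqP; rewrite -[_ == _]negbK r0.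
rewrite (bigD1 v) //= => r1; right; exists v; apply/ffunP => i; rewrite ffunE inE.
have [->|iv] := eqVneq i v; last first.
  move: rv r1; rewrite (bigD1 i) //=; case: (r v) => [//|n]; case: (r i) => [//|m].
  by rewrite !addSn addnS.
by move: rv r1; case: (r v) => [|[|n]].
Qed.

Lemma coef0_ker x : L x -> (forall p, coef0 p x = 0) -> Bk 0 x.
Proof.
move=> Lx c0; split=> // v; rewrite add0r; apply/supp_inP => r.
rewrite wt_order; apply: contraNT => r1; apply/eqP.
have : (\sum_v r v <= 1)%N by move: r1 => /=; lia.
case/deg_small => [->|[u ru]]; first exact: (c0 v).
by move: r1; rewrite ru (bigD1 u) //= ffunE mem_head.
Qed.

Lemma coef1_ker x : L x -> (forall p, coef1 p x = 0) -> Bk (-1) x.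
Proof.
move=> Lx c1; split=> // v; apply/supp_inP => r.
rewrite wt_order; apply: contraNT => r1; apply/eqP.
have : (\sum_v r v <= 1)%N by move: r1 => /=; lia.
by case/deg_small => [->|[u ->]]; [exact: (c1 (v, None)) | exact: (c1 (v, Some u))].
Qed.

Lemma absent_count (J : finType) (l : J -> vf -> K) k (s : seq (seq 'I_5 * 'I_5)) :
  (forall p b y z, L y -> L z -> l p (b *: y + z) = b * l p y + l p z) ->
  (forall z, L z -> (forall p, l p z = 0) -> Bk k z) ->
  uniq (map degc s) -> all valid s -> (forall c, c \in s -> ~ pres k c) ->
  (size s <= #|J|)%N.
Proof.
move=> lin ker us vs As.
pose x (i : 'I_(size s)) := mf K (tnth (in_tuple s) i).
pose d (i : 'I_(size s)) := degc (tnth (in_tuple s) i).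
have vi q : valid (tnth (in_tuple s) q) by apply: (allP vs); apply: mem_tnth.
apply: (absent_bound char2 wht_balanced (x := x) (d := d) lin ker).
- move=> i i'; rewrite /d !(tnth_nth ([::], iu 0)) /= => /eqP dij; apply: val_inj.
  apply/eqP; move: dij; rewrite -(nth_map _ 0 degc (ltn_ord i)).
  by rewrite -(nth_map _ 0 degc (ltn_ord i')) nth_uniq ?size_map.
- by move=> i; apply: valid_L.
- by move=> q; apply: valid_vfil; case/andP: (vi q).
by move=> i; apply: As; apply: mem_tnth.
Qed.

Lemma absent0 s : uniq (map degc s) -> all valid s ->
  (forall c, c \in s -> ~ pres 0 c) -> (size s <= 5)%N.
Proof.
move=> us vs As; suff : (size s <= #|'I_5|)%N by rewrite card_ord.
apply: (absent_count _ coef0_ker us vs As) => p b y z Ly Lz.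
by rewrite /coef0 phi_lin // vfield_lin mcoeffD mcoeffZ.
Qed.

(** 30 = 5 * (1 + 5): in each of the five components, one constant and five linear coefficients have
    to vanish. *)
Lemma absent1 s : uniq (map degc s) -> all valid s ->
  (forall c, c \in s -> ~ pres (-1) c) -> (size s <= 30)%N.
Proof.
move=> us vs As.
suff : (size s <= #|{: 'I_5 * option 'I_5}|)%N.
  by rewrite card_prod card_option card_ord.
apply: (absent_count _ coef1_ker us vs As) => p b y z Ly Lz.
by rewrite /coef1 phi_lin // vfield_lin mcoeffD mcoeffZ.
Qed.

(** If d_k is absent, each pair of fields with bracket d_k contains an absent one. The ordinary
    bracket provides four such pairs, d_m with u_m d_k, and the cocycle provides two. The six pairs
    are disjoint, so together with d_k at least seven fields are absent, against the bound five. *)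
Lemma pres_iu (k : 'I_3) : pres 0 ([::], iu k).
Proof.
apply: contrapT => nk; pose a := k + 1; pose b := k + 2%:R.
pose absent c := `[< ~ pres 0 c >].
have pair c c' : (pres 0 c -> pres 0 c' -> pres 0 ([::], iu k)) ->
    absent c || absent c'.
  move=> h; rewrite /absent -asbool_or; apply/asboolP.
  by apply: contrapT => /not_orP[/contrapT P /contrapT P']; apply: nk; apply: h.
have vl m : m != iu k -> valid ([:: m], iu k) by rewrite /valid /= inE eq_sym.
have lin m : m != iu k -> absent ([::], m) || absent ([:: m], iu k).
  by move=> mk; apply: pair => P Q; apply: pres_const (vl _ mk) P Q.
pose s := [:: ([::], iu k); ([:: iu a], ichi 0); ([:: iu b], ichi 1);
  ([:: iu b], ichi 0); ([:: iu a], ichi 1); ([::], iu a); ([:: iu a], iu k);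
  ([::], iu b); ([:: iu b], iu k); ([::], ichi 0); ([:: ichi 0], iu k);
  ([::], ichi 1); ([:: ichi 1], iu k)].
have us : uniq (map degc s) by rewrite /s /a /b; elim/ord3P: (k).
have vs : all valid s by rewrite /s /a /b; elim/ord3P: (k).
have : (size (filter absent s) <= 5)%N.
  apply: absent0.
  - by apply: subseq_uniq us; apply: map_subseq; apply: filter_subseq.
  - by apply/allP => c; rewrite mem_filter => /andP[_]; apply/allP.
  by move=> c; rewrite mem_filter => /andP[/asboolP].
rewrite size_filter /=.
have -> : absent ([::], iu k) by apply/asboolP.
have p1 : absent ([:: iu a], ichi 0) || absent ([:: iu b], ichi 1).
  by apply: pair; apply: pres_chi; rewrite !eqxx.
have p2 : absent ([:: iu b], ichi 0) || absent ([:: iu a], ichi 1).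
  by apply: pair; apply: pres_chi; rewrite !eqxx orbT.
have ka : iu a != iu k by rewrite (inj_eq iu_inj) /a; elim/ord3P: (k).
have kb : iu b != iu k by rewrite (inj_eq iu_inj) /b; elim/ord3P: (k).
have kc t : ichi t != iu k by rewrite ichi_iu.
move: p1 p2 (lin _ ka) (lin _ kb) (lin _ (kc 0)) (lin _ (kc 1)).
by do 6![case: (absent _) => /=]; do ?[case: (absent _) => //=].
Qed.

Lemma pres_over S i l : (forall j, j \in l -> pres 0 ([::], j)) ->
  uniq (map degc (over S i l)) -> all valid (over S i l) -> (5 < size (over S i l))%N ->
  pres 0 (S, i).
Proof.
move=> Pl u v sz; apply: contrapT => A; move: sz; rewrite ltnNge => /negP; apply.
exact: absent0 u v (absent_over Pl A v).
Qed.

(** An absence would spread to the eight products of d_chi with subsets of the three u's. Once all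
    constant fields are available, the same count of eight gives the linear fields below. *)
Lemma pres_ichi t : pres 0 ([::], ichi t).
Proof.
apply: (@pres_over _ _ [:: iu 0; iu 1; iu 2%:R]) => [j||//|//].
- by rewrite !inE => /or3P[/eqP->|/eqP->|/eqP->]; apply: pres_iu.
- by elim/ord2P: t.
Qed.

Lemma pres_d j : pres 0 ([::], j).
Proof. by elim/ord5P: j => [k||]; [apply: pres_iu|apply: pres_ichi|apply: pres_ichi]. Qed.

Let o0 := iu 0. Let o1 := iu 1. Let o2 := iu 2%:R. Let o3 := ichi 0. Let o4 := ichi 1.

Let pres_lin1 S i l : uniq (map degc (over S i l)) -> all valid (over S i l) ->
  (5 < size (over S i l))%N -> pres 0 (S, i).
Proof. by apply: pres_over => j _; apply: pres_d. Qed.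

Lemma pres_01 : pres 0 ([:: o0], o1).
Proof. exact: (@pres_lin1 _ _ [:: o2; o3; o4]). Qed.
Lemma pres_21 : pres 0 ([:: o2], o1).
Proof. exact: (@pres_lin1 _ _ [:: o0; o3; o4]). Qed.
Lemma pres_23 : pres 0 ([:: o2], o3).
Proof. exact: (@pres_lin1 _ _ [:: o0; o1; o4]). Qed.
Lemma pres_43 : pres 0 ([:: o4], o3).
Proof. exact: (@pres_lin1 _ _ [:: o0; o1; o2]). Qed.
Lemma pres_30 : pres 0 ([:: o3], o0).
Proof. exact: (@pres_lin1 _ _ [:: o1; o2; o4]). Qed.

(** Only the two variables [o2] and [o4] are left to multiply with, which makes four absences. Two
    more come from changing the direction [o3] to [o2] or [o4], because u_o2 d_o3 and u_o4 d_o3 are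
    present and would turn these fields back into the given one. *)
Lemma pres_10_3 : pres 0 ([:: o1; o0], o3).
Proof.
apply: contrapT => A.
have A2 : ~ pres 0 ([:: o1; o0], o2).
  by move=> P; apply: A; apply: (@pres_lin _ _ _ o2) pres_23 P.
have A4 : ~ pres 0 ([:: o1; o0], o4).
  by move=> P; apply: A; apply: (@pres_lin _ _ _ o4) pres_43 P.
pose s := ([:: o1; o0], o2) :: ([:: o1; o0], o4) :: over [:: o1; o0] o3 [:: o2; o4].
suff : (size s <= 5)%N by [].
apply: absent0; [by []|by []|move=> c].
rewrite in_cons => /predU1P[->|]; first exact: A2.
rewrite in_cons => /predU1P[->|]; first exact: A4.
by move: c; apply: absent_over A _ => [j _|//]; apply: pres_d.
Qed.

(** 16 + 8 + 8 = 32 exceeds 30. If d_o1 is absent, so are its sixteen multiples; and since brackets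
    with u_o0 d_o1 and u_o2 d_o1 change the directions [o0] and [o2] into [o1], eight more fields
    are absent in each of these two directions. *)
Lemma pres1_d1 : pres (-1) ([::], o1).
Proof.
apply: contrapT => A.
have Ad : forall c, c \in over [::] o1 [:: o0; o2; o3; o4] -> ~ pres (-1) c.
  by apply: absent_over A _ => [j _|//]; apply: pres_d.
have step j l : j != o1 -> j \notin l -> o1 \notin l -> pres 0 ([:: j], o1) ->
    all valid (over [::] o1 l) -> forall c, c \in over [::] j l -> ~ pres (-1) c.
  move=> j1 jl l1 Pj vl c /mapP[T Tl ->]; rewrite cats0 => P.
  have Tl' : (T, o1) \in over [::] o1 l by apply/mapP; exists T; rewrite ?cats0.
  have v1 := allP vl _ Tl'; have sT := subs_subseq Tl.
  apply: (absent_over _ A vl Tl'); first by move=> i _; apply: pres_d.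
  by apply: (pres_lin j1) Pj P => //; apply: contra jl; apply: (mem_subseq sT).
have A0 := @step o0 [:: o2; o3; o4] isT isT isT pres_01 isT.
have A2 := @step o2 [:: o0; o3; o4] isT isT isT pres_21 isT.
pose s := over [::] o1 [:: o0; o2; o3; o4] ++ over [::] o0 [:: o2; o3; o4] ++
  over [::] o2 [:: o0; o3; o4].
suff : (size s <= 30)%N by [].
apply: absent1; [by []|by []|move=> c].
by rewrite !mem_cat => /or3P[/Ad|/A0|/A2].
Qed.

Lemma pres1_03 : pres (-1) ([:: o0], o3).
Proof. by apply: (@pres_const_add (-1) 0 o1) pres1_d1 pres_10_3. Qed.

Let h := dbr 1 (mf K ([:: o0], o3)) (mf K ([:: o3], o0)).

Lemma pres1_h : present N wht (Bk (-1)) 0 h.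
Proof.
exact: (present_dbr char2 wht_balanced (@Bk_dbr (-1) 0) (valid_L (c := ([:: o0], o3)) isT)
  (valid_L (c := ([:: o3], o0)) isT) (valid_vfil (c := ([:: o0], o3)) isT)
  (valid_vfil (c := ([:: o3], o0)) isT) pres1_03 pres_30).
Qed.

Lemma dbr_h : dbr 1 h (mf K ([::], o3)) = mf K ([::], o3).
Proof.
have hE : h = wbr (mf K ([:: o0], o3)) (mf K ([:: o3], o0)).
  by rewrite /h /dbr wcoc_mf_lin scaler0 addr0.
rewrite {1}/dbr wcocC wcoc_mf_const scaler0 addr0 (wbrC char2) hE.
apply/ffunP => v; rewrite (wbrE char2) mf_app u_nil wmul1 mfE.
rewrite [X in _ + X](_ : _ = 0); last first.
  by rewrite u_nil; case: ifP => _; rewrite ?vapp0 // vappE big1 // => i _;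
    rewrite pd_one wmul0r.
rewrite addr0 (wbr_mf char2) !(@pd_u K _ [::]) // u_nil !wmulr1.
elim/ord5P: v => [k||]; rewrite ?iu_ichi ?(inj_eq iu_inj) ?addr0 ?add0r.
- by case: ifP => _; rewrite ?pd0 ?pd_u0.
- by rewrite eqxx pd_u // u_nil.
by rewrite pd0.
Qed.

Lemma wht_ge0 v : 0 <= wht v.
Proof. by rewrite /wht; case: v => [[|[|[|[|[|//]]]]] lv]. Qed.

Lemma vfil_wht_eq0 (D : vf) : vfil wht (-24) D -> D = 0.
Proof.
move=> vD; apply/ffunP => v; rewrite vfield0; apply/malgP => r; rewrite mcoeff0.
apply/eqP; rewrite -[_ == _]negbK; apply/negP => /(proj1 (supp_inP _ _) (vD v)).
have : 0 <= wt wht r by apply: sumr_ge0 => i _; rewrite mulrn_wge0 // wht_ge0.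
have : wht v <= 23 by rewrite /wht; case: v {vD} => [[|[|[|[|[|//]]]]] lv].
by lia.
Qed.

Lemma phi_contra : False.
Proof.
pose e := mf K ([::], o3); have Le : L e by apply: mf_svs.
have [y [Ly vy [LH vH]]] := pres1_h.
(* The unknown lower part [y] does no harm: its bracket with [e] has degree at most -1 - 23, below
   that of every nonzero field. *)
have He : dbr 1 (h + y) e = e.
  rewrite dbrDl dbr_h (_ : dbr 1 y e = 0) ?addr0 //; apply: vfil_wht_eq0.
  exact: (vfil_dbr char2 wht_balanced vy (valid_vfil (c := ([::], o3)) isT)).
(* Index 1 imposes no condition; each bracket with [phi (h + y)], which has index -1, lowers the
   index of [phi e] by one. *)
have vphi n : vfil order1 (1 - n%:Z) (phi e).
  elim: n => [|n IH]; first by move=> v; apply: order_ge0.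
  rewrite -He phi_hom //.
  have -> : 1 - n.+1%:Z = -1 + (1 - n%:Z) by lia.
  exact: vfil_wbr.
have phi0 : phi e = 0.
  apply/ffunP => v; rewrite vfield0; apply/malgP => r; rewrite mcoeff0.
  apply/eqP; rewrite -[_ == _]negbK; apply/negP.
  move=> /(proj1 (supp_inP _ _) (vphi (\sum_v r v).+1 v)).
  by rewrite wt_order /=; move: (\sum_v r v)%N => n; lia.
have := phi_inj Le phi0 => /(congr1 (fun D : vf => (D o3)@_(ind [::]))).
rewrite mfE eqxx mcoeffUU vfield0 mcoeff0 => /eqP.
by rewrite oner_eq0.
Qed.

End NotIsomorphic.

Theorem deform_not_isomorphic (K : fieldType) (N : 'I_5 -> height) :
  2%N \in [pchar K] -> shearing_vector N ->
  ~ isomorphic (deform (svect K N) (svect_cocycle N) 1) (svect K N).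
Proof.
move=> char2 shearN; rewrite svectE => -[phi [/= _ _ lin [fun_phi inj_phi _] hom]].
have L0 := subspace0 (@svs_subspace K N).
have phi_L x : svs N x -> svs N (phi x) by apply: fun_phi.
have phi0 : phi 0 = 0.
  have := lin 1 0 0 L0 L0; rewrite !scale1r addr0 => /eqP.
  by rewrite addrC -subr_eq subrr => /eqP.
have inj x : svs N x -> phi x = 0 -> x = 0.
  by move=> Lx phix; apply: (inj_phi x 0); [exact: mem_set|exact: mem_set|rewrite phix phi0].
have hom' x y : svs N x -> svs N y -> phi (dbr 1 x y) = wbr (phi x) (phi y).
  move=> Lx Ly; rewrite -(deform_brE char2 _ Lx Ly) (hom _ _ Lx Ly).
  exact: (svect_brE char2 (phi_L _ Lx) (phi_L _ Ly)).
exact: (phi_contra char2 shearN inj lin hom').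
Qed.

(** * The frame of mb_3 *)

Section Frame.
Variables (A : Type) (zero one : A) (add mul : A -> A -> A).
Hypothesis A_ring : ring_theory zero one add mul add id eq.
Add Ring frame_ring : A_ring (morphism (of_bool_morph A_ring)).

Local Notation "x + y" := (add x y).
Local Notation "x * y" := (mul x y).

Definition is_der (d : A -> A) :=
  (forall f g, d (f + g) = d f + d g) /\ (forall f g, d (f * g) = d f * g + f * d g).

Variables (T : Type) (a b : A -> A) (u z e : T -> A -> A).
Hypothesis a_der : is_der a.
Hypothesis b_der : is_der b.
Hypothesis u_der : forall i, is_der (u i).
Hypothesis z_der : forall i, is_der (z i).
Hypothesis e_der : forall i, is_der (e i).

Variable distinct3 : T -> T -> T -> Prop.
Hypothesis baC : forall f, b (a f) = a (b f).
Hypothesis uaC : forall i f, u i (a f) = a (u i f).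
Hypothesis ubC : forall i f, u i (b f) = b (u i f).
Hypothesis zaC : forall i f, z i (a f) = a (z i f).
Hypothesis zbC : forall i f, z i (b f) = b (z i f).
Hypothesis eaC : forall i f, e i (a f) = a (e i f).
Hypothesis ebC : forall i f, e i (b f) = b (e i f).
Hypothesis uC : forall i j f, u i (u j f) = u j (u i f).
Hypothesis zC : forall i j f, z i (z j f) = z j (z i f).
Hypothesis eC : forall i j f, e i (e j f) = e j (e i f).
Hypothesis ezC : forall i f, e i (z i f) = z i (e i f).
Hypothesis zu_eq : forall i f, z i (u i f) = u i (z i f) + b f.
Hypothesis eu_eq : forall i f, e i (u i f) = u i (e i f) + a f.
Hypothesis zu_neq : forall i j k f, distinct3 i j k -> z i (u j f) = u j (z i f).
Hypothesis eu_neq : forall i j k f, distinct3 i j k -> e i (u j f) = u j (e i f).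
Hypothesis ez_neq : forall i j k f, distinct3 i j k -> e i (z k f) = z k (e i f) + u j f.

Variables i1 i2 i3 : T.
Hypothesis t123 : distinct3 i1 i2 i3.
Hypothesis t132 : distinct3 i1 i3 i2.
Hypothesis t213 : distinct3 i2 i1 i3.
Hypothesis t231 : distinct3 i2 i3 i1.
Hypothesis t312 : distinct3 i3 i1 i2.
Hypothesis t321 : distinct3 i3 i2 i1.

Let aD := proj1 a_der. Let aM := proj2 a_der.
Let bD := proj1 b_der. Let bM := proj2 b_der.
Let uD i := proj1 (u_der i). Let uM i := proj2 (u_der i).
Let zD i := proj1 (z_der i). Let zM i := proj2 (z_der i).
Let eD i := proj1 (e_der i). Let eM i := proj2 (e_der i).

Let zu f := (zu_eq i1 f, zu_eq i2 f, zu_eq i3 f, zu_neq f t123, zu_neq f t132,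
  zu_neq f t213, zu_neq f t231, zu_neq f t312, zu_neq f t321).
Let eu f := (eu_eq i1 f, eu_eq i2 f, eu_eq i3 f, eu_neq f t123, eu_neq f t132,
  eu_neq f t213, eu_neq f t231, eu_neq f t312, eu_neq f t321).
Let ez f := (ezC i1 f, ezC i2 f, ezC i3 f, ez_neq f t123, ez_neq f t132,
  ez_neq f t213, ez_neq f t231, ez_neq f t312, ez_neq f t321).
Let abC f := (baC f, (uaC i1 f, uaC i2 f, uaC i3 f), (ubC i1 f, ubC i2 f, ubC i3 f),
  (zaC i1 f, zaC i2 f, zaC i3 f), (zbC i1 f, zbC i2 f, zbC i3 f),
  (eaC i1 f, eaC i2 f, eaC i3 f), (ebC i1 f, ebC i2 f, ebC i3 f)).
Let sameC f := ((uC i2 i1 f, uC i3 i1 f, uC i3 i2 f), (zC i2 i1 f, zC i3 i1 f, zC i3 i2 f),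
  (eC i2 i1 f, eC i3 i1 f, eC i3 i2 f)).

(* Frame coefficients of a field: a, b, then (u, z, e) for each index. *)
Definition coefs : Type := (A * A * (A * A * A) * (A * A * A) * (A * A * A))%type.

Definition framed (x : coefs) (f : A) : A :=
  let: (xa, xb, (xu1, xz1, xe1), (xu2, xz2, xe2), (xu3, xz3, xe3)) := x in
  xa * a f + xb * b f + (xz1 * z i1 f + xe1 * e i1 f + xu1 * u i1 f) +
  (xz2 * z i2 f + xe2 * e i2 f + xu2 * u i2 f) + (xz3 * z i3 f + xe3 * e i3 f + xu3 * u i3 f).

(** Besides the derivatives of coefficients, the structure constants of the frame enter: [e_i, u_i]
    = a, [z_i, u_i] = b, and [e_i, z_k] = u_j for distinct i, j, k. *)
Definition bracket_coefs (x y : coefs) : coefs :=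
  let: (xa, xb, (xu1, xz1, xe1), (xu2, xz2, xe2), (xu3, xz3, xe3)) := x in
  let: (ya, yb, (yu1, yz1, ye1), (yu2, yz2, ye2), (yu3, yz3, ye3)) := y in
  (framed x ya + framed y xa +
     (xe1 * yu1 + ye1 * xu1 + (xe2 * yu2 + ye2 * xu2) + (xe3 * yu3 + ye3 * xu3)),
   framed x yb + framed y xb +
     (xz1 * yu1 + yz1 * xu1 + (xz2 * yu2 + yz2 * xu2) + (xz3 * yu3 + yz3 * xu3)),
   (framed x yu1 + framed y xu1 + (xe2 * yz3 + ye2 * xz3 + (xe3 * yz2 + ye3 * xz2)),
    framed x yz1 + framed y xz1, framed x ye1 + framed y xe1),
   (framed x yu2 + framed y xu2 + (xe3 * yz1 + ye3 * xz1 + (xe1 * yz3 + ye1 * xz3)),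
    framed x yz2 + framed y xz2, framed x ye2 + framed y xe2),
   (framed x yu3 + framed y xu3 + (xe1 * yz2 + ye1 * xz2 + (xe2 * yz1 + ye2 * xz1)),
    framed x yz3 + framed y xz3, framed x ye3 + framed y xe3)).

Lemma framed_bracket x y f :
  framed x (framed y f) + framed y (framed x f) = framed (bracket_coefs x y) f.
Proof.
case: x => [[[[xa xb] [[xu1 xz1] xe1]] [[xu2 xz2] xe2]] [[xu3 xz3] xe3]].
case: y => [[[[ya yb] [[yu1 yz1] ye1]] [[yu2 yz2] ye2]] [[yu3 yz3] ye3]].
have FD c g h : framed c (g + h) = framed c g + framed c h.
  case: c => [[[[ca cb] [[cu1 cz1] ce1]] [[cu2 cz2] ce2]] [[cu3 cz3] ce3]] /=.
  by rewrite aD bD !uD !zD !eD; ring.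
have FM c g h : framed c (g * h) = framed c g * h + g * framed c h.
  case: c => [[[[ca cb] [[cu1 cz1] ce1]] [[cu2 cz2] ce2]] [[cu3 cz3] ce3]] /=.
  by rewrite aM bM !uM !zM !eM; ring.
set X := framed (xa, _, _, _, _); set Y := framed (ya, _, _, _, _).
have EX g : X g = xa * a g + xb * b g + (xz1 * z i1 g + xe1 * e i1 g + xu1 * u i1 g) +
  (xz2 * z i2 g + xe2 * e i2 g + xu2 * u i2 g) + (xz3 * z i3 g + xe3 * e i3 g + xu3 * u i3 g).
  by [].
have EY g : Y g = ya * a g + yb * b g + (yz1 * z i1 g + ye1 * e i1 g + yu1 * u i1 g) +
  (yz2 * z i2 g + ye2 * e i2 g + yu2 * u i2 g) + (yz3 * z i3 g + ye3 * e i3 g + yu3 * u i3 g).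
  by [].
rewrite /bracket_coefs -/X -/Y /framed (EX f) (EY f).
have XD := FD (xa, xb, (xu1, xz1, xe1), (xu2, xz2, xe2), (xu3, xz3, xe3)).
have XM := FM (xa, xb, (xu1, xz1, xe1), (xu2, xz2, xe2), (xu3, xz3, xe3)).
have YD := FD (ya, yb, (yu1, yz1, ye1), (yu2, yz2, ye2), (yu3, yz3, ye3)).
have YM := FM (ya, yb, (yu1, yz1, ye1), (yu2, yz2, ye2), (yu3, yz3, ye3)).
(* [X] and [Y] become opaque: applied to coefficients they stay atoms for [ring], and only on the
   frame derivatives of [f] are they expanded, by [EX] and [EY]. *)
move: XD XM YD YM EX EY; rewrite -/X -/Y; move: X Y => X Y XD XM YD YM EX EY {FD FM}.
rewrite !XD !XM !YD !YM.
rewrite !(EX (a f), EX (b f), EX (u i1 f), EX (u i2 f), EX (u i3 f), EX (z i1 f),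
  EX (z i2 f), EX (z i3 f), EX (e i1 f), EX (e i2 f), EX (e i3 f)).
rewrite !(EY (a f), EY (b f), EY (u i1 f), EY (u i2 f), EY (u i3 f), EY (z i1 f),
  EY (z i2 f), EY (z i3 f), EY (e i1 f), EY (e i2 f), EY (e i3 f)).
rewrite !(abC f) !(zu f) !(eu f) !(ez f) !(sameC f).
ring.
Qed.

Lemma der0 d : is_der d -> d zero = zero.
Proof.
move=> [dD _]; have E : d (zero + zero) = zero by rewrite dD; ring.
by rewrite -[RHS]E; congr (d _); ring.
Qed.

Definition gen_pair (F1 F2 : A) :=
  forall i, [/\ z i F1 = zero, e i F1 = z i F2 & e i F2 = zero].

Definition pair_coefs (F1 F2 : A) : coefs :=
  (F1, F2, (z i1 F2, u i1 F2, u i1 F1), (z i2 F2, u i2 F2, u i2 F1),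
   (z i3 F2, u i3 F2, u i3 F1)).

(** The generators of [X^F, X^G]: the coefficient along a for [G1], [F1], and along b for [G2],
    [F2]. The derivatives of the generators along the u's and the odd directions cancel in pairs;
    the products of u- and z-derivatives listed here come from the structure constants. *)
Definition pair_bracket (F1 F2 G1 G2 G : A) (F : A) : A :=
  F1 * a G + F2 * b G + (G1 * a F + G2 * b F) +
  (u i1 F * z i1 G2 + u i1 G * z i1 F2) + (u i2 F * z i2 G2 + u i2 G * z i2 F2) +
  (u i3 F * z i3 G2 + u i3 G * z i3 F2).

Section Pairs.
Variables F1 F2 G1 G2 : A.
Hypothesis genF : gen_pair F1 F2.
Hypothesis genG : gen_pair G1 G2.

Let H1 := pair_bracket F1 F2 G1 G2 G1 F1.
Let H2 := pair_bracket F1 F2 G1 G2 G2 F2.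

Let a0 := der0 a_der. Let b0 := der0 b_der.
Let u0 i := der0 (u_der i). Let z0 i := der0 (z_der i). Let e0 i := der0 (e_der i).

Section Jets.
Variables P1 P2 : A.
Hypothesis genP : gen_pair P1 P2.

Lemma gen_z1 i : z i P1 = zero. Proof. by case: (genP i). Qed.
Lemma gen_e1 i : e i P1 = z i P2. Proof. by case: (genP i). Qed.
Lemma gen_e2 i : e i P2 = zero. Proof. by case: (genP i). Qed.
Lemma gen_zz_eq i : z i (z i P2) = zero.
Proof. by rewrite -gen_e1 -ezC gen_z1 e0. Qed.
(** Commuting e_i past z_k in e_i (z_k P1) = 0 leaves z_k (e_i P1) + u_j P1, where e_i P1 is z_i
    P2. *)
Lemma gen_zz_neq i j k : distinct3 i j k -> z k (z i P2) = u j P1.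
Proof.
move=> t; have := ez_neq P1 t; rewrite gen_z1 e0 gen_e1 => E.
transitivity (z k (z i P2) + (z k (z i P2) + u j P1)); last by ring.
by rewrite -E; ring.
Qed.
Lemma gen_ez_eq i : e i (z i P2) = zero.
Proof. by rewrite ezC gen_e2 z0. Qed.
Lemma gen_ez_neq i j k : distinct3 i j k -> e i (z k P2) = u j P2.
Proof. by move=> t; rewrite (ez_neq _ t) gen_e2 z0; ring. Qed.

(** As rewrite rules these leave the z_i P2 as the only odd derivatives, so that both sides of an
    identity between generating pairs reach a common normal form. *)
Definition jets := ((gen_z1, gen_e1, gen_e2),
  (gen_zz_eq i1, gen_zz_eq i2, gen_zz_eq i3,
   gen_zz_neq t123, gen_zz_neq t132, gen_zz_neq t213,
   gen_zz_neq t231, gen_zz_neq t312, gen_zz_neq t321),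
  (gen_ez_eq i1, gen_ez_eq i2, gen_ez_eq i3,
   gen_ez_neq t123, gen_ez_neq t132, gen_ez_neq t213,
   gen_ez_neq t231, gen_ez_neq t312, gen_ez_neq t321)).

End Jets.

Let Der := ((aD, bD, uD, zD, eD), (aM, bM, uM, zM, eM)).
Let J := (jets genF, jets genG).
Let S1 := (abC F1, zu F1, eu F1).
Let S2 := (abC F2, zu F2, eu F2).
Let S3 := (abC G1, zu G1, eu G1).
Let S4 := (abC G2, zu G2, eu G2).
Let Z := (a0, b0, u0, z0, e0).

Lemma bracket_pair_coefs :
  bracket_coefs (pair_coefs F1 F2) (pair_coefs G1 G2) = pair_coefs H1 H2.
Proof.
rewrite /bracket_coefs /pair_coefs /framed /H1 /H2 /pair_bracket.
congr (_, _, (_, _, _), (_, _, _), (_, _, _)).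
all: rewrite ?Der.
all: rewrite ?S1 ?S2 ?S3 ?S4.
all: rewrite ?J ?Z ?(sameC F1) ?(sameC F2) ?(sameC G1) ?(sameC G2).
all: ring.
Qed.

Lemma bracket_gen_pair : (forall P : T -> Prop, P i1 -> P i2 -> P i3 -> forall i, P i) ->
  gen_pair H1 H2.
Proof.
move=> enumT; apply: enumT; rewrite /H1 /H2 /pair_bracket; split.
all: rewrite ?Der.
all: rewrite ?S1 ?S2 ?S3 ?S4.
all: rewrite ?J ?Z ?(sameC F1) ?(sameC F2) ?(sameC G1) ?(sameC G2).
all: ring.
Qed.

(** The last four products are the cocycle. They appear where z_1 meets z_2 or z_3 of the second
    generators, as in z_1 (z_2 G2) = u_3 G1. *)
Lemma z_pair_bracket : z i1 H2 =
  F1 * a (z i1 G2) + F2 * b (z i1 G2) + z i1 F2 * u i1 (z i1 G2) +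
  z i2 F2 * u i2 (z i1 G2) + z i3 F2 * u i3 (z i1 G2) +
  (G1 * a (z i1 F2) + G2 * b (z i1 F2) + z i1 G2 * u i1 (z i1 F2) +
  z i2 G2 * u i2 (z i1 F2) + z i3 G2 * u i3 (z i1 F2)) +
  (u i2 F1 * u i3 G2 + u i2 F2 * u i3 G1 + (u i3 F1 * u i2 G2 + u i3 F2 * u i2 G1)).
Proof.
rewrite /H2 /pair_bracket ?Der ?S1 ?S2 ?S3 ?S4 ?J ?Z.
rewrite ?(sameC F1) ?(sameC F2) ?(sameC G1) ?(sameC G2); ring.
Qed.
End Pairs.
End Frame.

(** * Generating pairs with prescribed restriction *)

Section Construct.
Variables (A : Type) (zero one : A) (add mul : A -> A -> A).
Hypothesis A_ring : ring_theory zero one add mul add id eq.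
Add Ring construct_ring : A_ring (morphism (of_bool_morph A_ring)).

Local Notation "x + y" := (add x y).
Local Notation "x * y" := (mul x y).

Variables (T : Type) (d : T -> A -> A).
Hypothesis dD : forall v f g, d v (f + g) = d v f + d v g.
Hypothesis dM : forall v f g, d v (f * g) = d v f * g + f * d v g.
Hypothesis dC : forall v w f, d v (d w f) = d w (d v f).

(* even directions: p1 p2 p3 along the u's, a and b along the chi's;
   odd directions: n along the eta's, z along the zeta's *)
Variables (p1 p2 p3 a b n1 n2 n3 z1 z2 z3 : T) (h1 h2 h3 t1 t2 t3 : A).
Hypothesis sq_h1 : h1 * h1 = zero. Hypothesis sq_h2 : h2 * h2 = zero.
Hypothesis sq_h3 : h3 * h3 = zero. Hypothesis sq_t1 : t1 * t1 = zero.
Hypothesis sq_t2 : t2 * t2 = zero. Hypothesis sq_t3 : t3 * t3 = zero.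
Definition odd_values v c1 c2 c3 c4 c5 c6 : Type :=
  ((d v h1 = c1) * (d v h2 = c2) * (d v h3 = c3) *
   (d v t1 = c4) * (d v t2 = c5) * (d v t3 = c6))%type.
Definition kills v : Type := odd_values v zero zero zero zero zero zero.
Hypothesis ep1 : kills p1. Hypothesis ep2 : kills p2. Hypothesis ep3 : kills p3.
Hypothesis ea : kills a. Hypothesis eb : kills b.
Hypothesis on1 : odd_values n1 one zero zero zero zero zero.
Hypothesis on2 : odd_values n2 zero one zero zero zero zero.
Hypothesis on3 : odd_values n3 zero zero one zero zero zero.
Hypothesis oz1 : odd_values z1 zero zero zero one zero zero.
Hypothesis oz2 : odd_values z2 zero zero zero zero one zero.
Hypothesis oz3 : odd_values z3 zero zero zero zero zero one.

Definition even_fun f : Type :=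
  ((d n1 f = zero) * (d n2 f = zero) * (d n3 f = zero) *
   (d z1 f = zero) * (d z2 f = zero) * (d z3 f = zero))%type.
Let d0 v : d v zero = zero.
Proof.
have E : d v (zero + zero) = zero by rewrite dD; ring.
by rewrite -[RHS]E; congr (d v _); ring.
Qed.

Let oddC := ((dC n1 p1, dC n1 p2, dC n1 p3, dC n1 a, dC n1 b),
  (dC n2 p1, dC n2 p2, dC n2 p3, dC n2 a, dC n2 b),
  (dC n3 p1, dC n3 p2, dC n3 p3, dC n3 a, dC n3 b),
  (dC z1 p1, dC z1 p2, dC z1 p3, dC z1 a, dC z1 b),
  (dC z2 p1, dC z2 p2, dC z2 p3, dC z2 a, dC z2 b),
  (dC z3 p1, dC z3 p2, dC z3 p3, dC z3 a, dC z3 b)).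
Let evenC := (dC p2 p1, dC p3 p1, dC a p1, dC b p1, dC p3 p2, dC a p2, dC b p2,
  dC a p3, dC b p3, dC b a).
Let odd := (on1, on2, on3, oz1, oz2, oz3).
Let even := (ep1, ep2, ep3, ea, eb).
Definition u_op (p : T) (h t f : A) : A := d p f + h * d a f + t * d b f.

Definition eta_op (n pj pk : T) (hj hk tj tk f : A) : A :=
  d n f + tk * d pj f + tj * d pk f + (tk * hj + tj * hk) * d a f + tj * tk * d b f.

Local Notation Yu1 := (u_op p1 h1 t1).
Local Notation Yu2 := (u_op p2 h2 t2).
Local Notation Yu3 := (u_op p3 h3 t3).
Local Notation Ye1 := (eta_op n1 p2 p3 h2 h3 t2 t3).
Local Notation Ye2 := (eta_op n2 p3 p1 h3 h1 t3 t1).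

Lemma eta_zeta_rels f :
  prod (Ye1 (d z1 f) = d z1 (Ye1 f))
 (prod (Ye1 (d z3 f) = d z3 (Ye1 f) + Yu2 f) (Ye1 (d z2 f) = d z2 (Ye1 f) + Yu3 f)).
Proof.
by do !split; rewrite /eta_op /u_op ?(dD, dM) ?oddC ?odd ?d0
  ?(dC z1 n1) ?(dC z2 n1) ?(dC z3 n1); ring.
Qed.

Lemma eta_u_rels f :
  prod (Ye1 (Yu1 f) = Yu1 (Ye1 f) + d a f)
 (prod (Ye1 (Yu2 f) = Yu2 (Ye1 f)) (Ye1 (Yu3 f) = Yu3 (Ye1 f))).
Proof.
by do !split; rewrite /eta_op /u_op ?(dD, dM) ?oddC ?odd ?even ?d0 ?evenC; ring.
Qed.

Lemma zeta_u_rels f :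
  prod (d z1 (Yu1 f) = Yu1 (d z1 f) + d b f)
 (prod (d z1 (Yu2 f) = Yu2 (d z1 f)) (d z1 (Yu3 f) = Yu3 (d z1 f))).
Proof.
by do !split; rewrite /u_op ?(dD, dM) ?oddC ?odd ?d0; ring.
Qed.

Lemma eta_eta_rel f : Ye1 (Ye2 f) = Ye2 (Ye1 f).
Proof.
by rewrite /eta_op ?(dD, dM) ?oddC ?odd ?even ?d0 ?evenC ?(dC n2 n1); ring.
Qed.

Lemma u_u_rel f : Yu1 (Yu2 f) = Yu2 (Yu1 f).
Proof. by rewrite /u_op ?(dD, dM) ?even ?evenC; ring. Qed.

Lemma chi_rels v f : v = a \/ v = b -> prod (Ye1 (d v f) = d v (Ye1 f))
  (prod (Yu1 (d v f) = d v (Yu1 f)) (d z1 (d v f) = d v (d z1 f))).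
Proof.
by case=> ->; do !split; rewrite /eta_op /u_op ?(dD, dM) ?oddC ?even ?evenC; ring.
Qed.

Section FirstGenerator.
Variables f1 f2 f3 f4 f5 : A.
Hypothesis ev1 : even_fun f1. Hypothesis ev2 : even_fun f2. Hypothesis ev3 : even_fun f3.
Hypothesis ev4 : even_fun f4. Hypothesis ev5 : even_fun f5.
Hypothesis div0 : d p1 f1 + d p2 f2 + d p3 f3 + d a f4 + d b f5 = zero.

(** Taylor expansion of F1 in the eta's, F1 being free of the zeta's. The conditions give Y_eta_i
    Y_eta_j F1 = Y_eta_i Y_zeta_j F2 = Y_u_k F2, and Y_chi1 F2 for the third derivative; their
    restrictions are derivatives of [f5]. *)
Definition first_gen : A := f4 + h1 * f1 + h2 * f2 + h3 * f3 +
  h2 * h3 * d p1 f5 + h3 * h1 * d p2 f5 + h1 * h2 * d p3 f5 + h1 * h2 * h3 * d a f5.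

Let fs := (ev1, ev2, ev3, ev4, ev5).

Local Notation P := first_gen.

Lemma z_first_gen : ((d z1 P = zero) * (d z2 P = zero) * (d z3 P = zero))%type.
Proof.
by do !split; rewrite /first_gen ?(dD, dM) ?oddC ?fs ?odd ?d0; ring.
Qed.

Lemma n_first_gen :
  prod (d n1 P = f1 + h3 * d p2 f5 + h2 * d p3 f5 + h2 * h3 * d a f5)
  (prod (d n2 P = f2 + h3 * d p1 f5 + h1 * d p3 f5 + h1 * h3 * d a f5)
   (d n3 P = f3 + h2 * d p1 f5 + h1 * d p2 f5 + h1 * h2 * d a f5)).
Proof.
by do !split; rewrite /first_gen ?(dD, dM) ?oddC ?fs ?odd ?d0; ring.
Qed.

Lemma nn_first_gen :
  prod (d n1 (d n1 P) = zero) (prod (d n1 (d n2 P) = d p3 f5 + h3 * d a f5)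
   (d n1 (d n3 P) = d p2 f5 + h2 * d a f5)).
Proof.
by do !split; rewrite !n_first_gen ?(dD, dM) ?oddC ?fs ?odd ?d0; ring.
Qed.

(** The zero divergence, known at eta = 0, propagates to all eta: this is the restriction to zeta =
    0 of the relation between F1 and F2 along the frame. *)
Lemma div_first_gen : d p1 (d n1 P) + h1 * d a (d n1 P) +
  (d p2 (d n2 P) + h2 * d a (d n2 P)) + (d p3 (d n3 P) + h3 * d a (d n3 P)) +
  d a P + d b f5 = zero.
Proof.
rewrite !n_first_gen /first_gen ?(dD, dM) ?even ?evenC.
have solve x1 x2 x3 x4 x5 : x1 + x2 + x3 + x4 + x5 = zero -> x5 = x1 + x2 + x3 + x4.
  move=> h; transitivity (x1 + x2 + x3 + x4 + x5 + (x1 + x2 + x3 + x4)); first ring.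
  by rewrite h; ring.
rewrite (solve _ _ _ _ _ div0); ring [sq_h1 sq_h2 sq_h3].
Qed.

End FirstGenerator.

Section SecondGenerator.
Variables P f5 : A.
Hypothesis zP : ((d z1 P = zero) * (d z2 P = zero) * (d z3 P = zero))%type.
Hypothesis f5_even : even_fun f5.
Hypothesis nnP : prod (d n1 (d n1 P) = zero)
  (prod (d n1 (d n2 P) = d p3 f5 + h3 * d a f5) (d n1 (d n3 P) = d p2 f5 + h2 * d a f5)).
Hypothesis divP : d p1 (d n1 P) + h1 * d a (d n1 P) +
  (d p2 (d n2 P) + h2 * d a (d n2 P)) + (d p3 (d n3 P) + h3 * d a (d n3 P)) +
  d a P + d b f5 = zero.

(** Taylor expansion of F2 in the zeta's: Y_zeta_i F2 = Y_eta_i F1 restricts at zeta = 0 to an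
    eta-derivative of [P], the second derivatives are Y_zeta_i Y_zeta_j F2 = Y_u_k F1, and the third
    is Y_chi2 F1. *)
Definition second_gen : A := f5 + t1 * d n1 P + t2 * d n2 P + t3 * d n3 P +
  t2 * t3 * (d p1 P + h1 * d a P) + t3 * t1 * (d p2 P + h2 * d a P) +
  t1 * t2 * (d p3 P + h3 * d a P) + t1 * t2 * t3 * d b P.

Lemma z_second_gen : d z1 second_gen = eta_op n1 p2 p3 h2 h3 t2 t3 P.
Proof.
rewrite /second_gen /eta_op ?(dD, dM) ?oddC ?odd ?(dC z1 n1) ?(dC z1 n2) ?(dC z1 n3).
by rewrite ?zP ?f5_even ?d0; ring.
Qed.

(** The divergence enters through [d b f5], which [eta_op] produces with the factor [t2 * t3]; the
    other terms cancel by the vanishing squares of the odd variables. *)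
Lemma eta_second_gen : eta_op n1 p2 p3 h2 h3 t2 t3 second_gen = zero.
Proof.
have solve x1 x2 x3 x4 x5 : x1 + x2 + x3 + x4 + x5 = zero -> x5 = x1 + x2 + x3 + x4.
  move=> h; transitivity (x1 + x2 + x3 + x4 + x5 + (x1 + x2 + x3 + x4)); first ring.
  by rewrite h; ring.
rewrite /second_gen /eta_op ?(dD, dM) ?oddC ?odd ?even ?nnP ?f5_even ?(dD, dM) ?evenC ?even.
rewrite (solve _ _ _ _ _ divP).
ring [sq_h1 sq_h2 sq_h3 sq_t1 sq_t2 sq_t3].
Qed.

End SecondGenerator.

End Construct.

Section Rotation.
Variables (A : Type) (zero one : A) (add mul : A -> A -> A).
Hypothesis A_ring : ring_theory zero one add mul add id eq.
Add Ring rotation_ring : A_ring (morphism (of_bool_morph A_ring)).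
Variables (T : Type) (d : T -> A -> A) (p1 p2 p3 a b n1 n2 n3 : T).
Variables (h1 h2 h3 t1 t2 t3 f1 f2 f3 f4 f5 P : A).

(** Cyclic symmetry extends to every index the relations proved above for the first one. *)
Lemma first_gen_rot : first_gen add mul d p2 p3 p1 a h2 h3 h1 f2 f3 f1 f4 f5 =
  first_gen add mul d p1 p2 p3 a h1 h2 h3 f1 f2 f3 f4 f5.
Proof. rewrite /first_gen; ring. Qed.

Lemma second_gen_rot :
  second_gen add mul d p2 p3 p1 a b n2 n3 n1 h2 h3 h1 t2 t3 t1 P f5 =
  second_gen add mul d p1 p2 p3 a b n1 n2 n3 h1 h2 h3 t1 t2 t3 P f5.
Proof. rewrite /second_gen; ring. Qed.
End Rotation.

(** * The frame as derivations of the untruncated algebra *)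

Section FieldOperators.
Variables (K : fieldType) (I : finType).
Hypothesis char2 : 2%N \in [pchar K].
Implicit Types (N : I -> height) (f g : dp K I) (D E : vfield K I).

Definition wm f D : vfield K I := [ffun v => f ** D v].

Lemma wmE f D v : wm f D v = f ** D v.
Proof. by rewrite ffunE. Qed.

Lemma vapp_wm f D g : wm f D @@ g = f ** (D @@ g).
Proof.
rewrite !vappE linear_sum; apply: eq_bigr => v _ /=.
by rewrite wmE wmulA.
Qed.

Lemma vpartialE v w : vpartial K v w = if w == v then wone K I else 0.
Proof. by rewrite ffunE woneE. Qed.

Lemma vapp_vpartial v f : vpartial K v @@ f = pd v f.
Proof.
rewrite vappE (bigD1 v) //= vpartialE eqxx wmul1 big1 ?addr0 // => w /negbTE wv.
by rewrite vpartialE wv wmul0l.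
Qed.

Lemma vapp_sum (J : Type) (s : seq J) (D : J -> vfield K I) f :
  (\sum_(j <- s) D j) @@ f = \sum_(j <- s) (D j @@ f).
Proof.
elim: s => [|j s IH]; last by rewrite !big_cons vappDl IH.
by rewrite !big_nil vappE big1 // => v _; rewrite vfield0 wmul0l.
Qed.

Lemma vmul_wide N f D : divpow N f -> (forall v, divpow N (D v)) -> vmul N f D = wm f D.
Proof.
by move=> Nf ND; apply/ffunP => v; rewrite wmE ffunE (dpmul_wide char2 Nf (ND v)).
Qed.

Lemma divpow_wm N f D : divpow N f -> (forall v, divpow N (D v)) ->
  forall v, divpow N (wm f D v).
Proof. by move=> Nf ND v; rewrite wmE; apply: divpow_wmul. Qed.

Lemma divpow_vpartial N v : forall w, divpow N (vpartial K v w).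
Proof.
move=> w; rewrite vpartialE; case: ifP => _; first exact: divpow_one.
exact: subspace0 (divpow_subspace K N).
Qed.

Lemma divpow_vfieldD N D E : (forall v, divpow N (D v)) -> (forall v, divpow N (E v)) ->
  forall v, divpow N ((D + E) v).
Proof.
by move=> ND NE v; rewrite vfieldD; apply: (subspaceD (divpow_subspace K N)).
Qed.

Lemma dpvar_sq v : dpvar K v ** dpvar K v = 0 :> dp K I.
Proof.
rewrite wmul.unlock dpmulU mmul_unconstrained.
suff : (2 %| mbin [ffun i => (i == v : nat)] [ffun i => (i == v : nat)])%N.
  by rewrite (dvdn_pcharf char2) => /eqP->; rewrite scale0r.
by rewrite /mbin (bigD1 v) //= !ffunE eqxx dvdn_mulr.
Qed.

Lemma vapp_is_der D : is_der +%R (@wmul K I) (vapp D).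
Proof. by split; [exact: vappD | exact: vappM]. Qed.

End FieldOperators.

Definition distinct3 (i j k : 'I_3) : Prop := [/\ i != j, j != k & i != k].

Lemma distinct3_cases i j k : distinct3 i j k ->
  (j = i + 1 /\ k = i + 2%:R) \/ (j = i + 2%:R /\ k = i + 1).
Proof.
by case; elim/ord3P: i; elim/ord3P: j; elim/ord3P: k => //= _ _ _;
  [left|right|right|left|left|right]; split; apply: val_inj.
Qed.

Lemma ord3_add (k : 'I_3) : prod (prod (k + 1 + 1 = k + 2%:R) (k + 1 + 2%:R = k))
  (prod (k + 2%:R + 1 = k) (k + 2%:R + 2%:R = k + 1)).
Proof. by do !split; elim/ord3P: k; apply: val_inj. Qed.

Lemma ord3_neqs (k : 'I_3) : ((k == k + 1) = false) * ((k == k + 2%:R) = false) *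
  ((k + 1 == k) = false) * ((k + 2%:R == k) = false) *
  ((k + 1 == k + 2%:R) = false) * ((k + 2%:R == k + 1) = false).
Proof. by do !split; elim/ord3P: k. Qed.

Lemma ord3_step (P : 'I_3 -> 'I_3 -> Prop) :
  (forall i, P i i) -> (forall i, P i (i + 1)) -> (forall i, P (i + 1) i) ->
  forall i j, P i j.
Proof.
move=> P0 P1 P1' i j.
have : j = i \/ j = i + 1 \/ i = j + 1.
  elim/ord3P: i; elim/ord3P: j; try (by left); try (by right; left; apply: val_inj);
  by right; right; apply: val_inj.
by case=> [->|[->|->]].
Qed.

Section FrameFields.
Variable K : fieldType.
Local Notation eta i := (dpvar K (veta i)).
Local Notation zeta i := (dpvar K (vzeta i)).
Implicit Types (i j k : 'I_3).

Definition wYeta i : vfield K var11 :=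
  let j := i + 1 in let k := i + 2%:R in
  vpartial K (veta i) + wm (zeta k) (vpartial K (vu j)) + wm (zeta j) (vpartial K (vu k))
  + wm (zeta k ** eta j + zeta j ** eta k) (vpartial K (vchi 0))
  + wm (zeta j ** zeta k) (vpartial K (vchi 1)).

Definition wYu i : vfield K var11 :=
  vpartial K (vu i) + wm (eta i) (vpartial K (vchi 0)) + wm (zeta i) (vpartial K (vchi 1)).

End FrameFields.

(* The derivations given by Y_eta, Y_u, Y_zeta, Y_chi1 and Y_chi2. *)
HB.lock Definition Ye (K : fieldType) (i : 'I_3) (f : dp K var11) := wYeta K i @@ f.
HB.lock Definition Yu (K : fieldType) (i : 'I_3) (f : dp K var11) := wYu K i @@ f.
HB.lock Definition Yz (K : fieldType) (i : 'I_3) (f : dp K var11) :=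
  vpartial K (vzeta i) @@ f.
HB.lock Definition Ya (K : fieldType) (f : dp K var11) := vpartial K (vchi 0) @@ f.
HB.lock Definition Yb (K : fieldType) (f : dp K var11) := vpartial K (vchi 1) @@ f.

Section Mb3Operators.
Variable K : fieldType.
Hypothesis char2 : 2%N \in [pchar K].
Local Notation A := (dp K var11).
Local Notation eta i := (dpvar K (veta i)).
Local Notation zeta i := (dpvar K (vzeta i)).
Local Notation d := (@pd K var11).
Implicit Types (i j k : 'I_3) (f g : A).

Local Notation Ye := (@Ye K). Local Notation Yu := (@Yu K).
Local Notation Yz := (@Yz K). Local Notation Ya := (@Ya K). Local Notation Yb := (@Yb K).

Lemma Ye_vapp i f : Ye i f = wYeta K i @@ f. Proof. by rewrite Ye.unlock. Qed.
Lemma Yu_vapp i f : Yu i f = wYu K i @@ f. Proof. by rewrite Yu.unlock. Qed.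
Lemma Yz_vapp i f : Yz i f = vpartial K (vzeta i) @@ f. Proof. by rewrite Yz.unlock. Qed.
Lemma YzE i f : Yz i f = d (vzeta i) f. Proof. by rewrite Yz_vapp; exact: vapp_vpartial. Qed.
Lemma YaE f : Ya f = d (vchi 0) f. Proof. by rewrite Ya.unlock; exact: vapp_vpartial. Qed.
Lemma YbE f : Yb f = d (vchi 1) f. Proof. by rewrite Yb.unlock; exact: vapp_vpartial. Qed.

Lemma YuE i f : Yu i f =
  u_op +%R (@wmul K var11) d (vchi 0) (vchi 1) (vu i) (eta i) (zeta i) f.
Proof. by rewrite Yu_vapp /wYu !vappDl !vapp_wm !vapp_vpartial. Qed.

Lemma YeE i f : Ye i f = eta_op +%R (@wmul K var11) d (vchi 0) (vchi 1) (veta i)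
  (vu (i + 1)) (vu (i + 2%:R)) (eta (i + 1)) (eta (i + 2%:R))
  (zeta (i + 1)) (zeta (i + 2%:R)) f.
Proof. by rewrite Ye_vapp /wYeta !vappDl !vapp_wm !vapp_vpartial. Qed.

Let rt := wide_ring_theory var11 char2.
Let dD := @pdD K var11.
Let dM := @pdM K var11.
Let dC := @pdC K var11.

Definition values v i c1 c2 c3 c4 c5 c6 := odd_values d
  (eta i) (eta (i + 1)) (eta (i + 2%:R)) (zeta i) (zeta (i + 1)) (zeta (i + 2%:R))
  v c1 c2 c3 c4 c5 c6.

Lemma values_even (v : 'I_5) i : values (inl v) i 0 0 0 0 0 0.
Proof. by do !split; rewrite pd_var. Qed.

Let ee i j : (veta i == veta j) = (i == j). Proof. by []. Qed.
Let zz i j : (vzeta i == vzeta j) = (i == j). Proof. by []. Qed.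
Let ez i j : (veta i == vzeta j) = false. Proof. by []. Qed.
Let ze i j : (vzeta i == veta j) = false. Proof. by []. Qed.

Lemma values_eta i : prod (values (veta i) i (wone K var11) 0 0 0 0 0)
  (prod (values (veta (i + 1)) i 0 (wone K var11) 0 0 0 0)
  (values (veta (i + 2%:R)) i 0 0 (wone K var11) 0 0 0)).
Proof.
by do !split; rewrite pd_var ?ee ?ez ?eqxx ?ord3_neqs.
Qed.

Lemma values_zeta i : prod (values (vzeta i) i 0 0 0 (wone K var11) 0 0)
  (prod (values (vzeta (i + 1)) i 0 0 0 0 (wone K var11) 0)
  (values (vzeta (i + 2%:R)) i 0 0 0 0 0 (wone K var11))).
Proof.
by do !split; rewrite pd_var ?zz ?ze ?eqxx ?ord3_neqs.
Qed.

Let ev i := fun v => values_even v i.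

Lemma Ye_Yz_eq i f : Ye i (Yz i f) = Yz i (Ye i f).
Proof.
rewrite !YzE !YeE.
exact: (eta_zeta_rels rt dD dM dC _ _ _ _ _ (values_zeta i).1 (values_zeta i).2.1
  (values_zeta i).2.2 f).1.
Qed.

Lemma Ye_Yz_neq i j k f : distinct3 i j k -> Ye i (Yz k f) = Yz k (Ye i f) + Yu j f.
Proof.
have R := eta_zeta_rels rt dD dM dC (vu (i + 1)) (vu (i + 2%:R)) (vchi 0) (vchi 1)
  (veta i) (values_zeta i).1 (values_zeta i).2.1 (values_zeta i).2.2 f.
by case/distinct3_cases => -[-> ->]; rewrite !YzE !YeE !YuE; [exact: R.2.1|exact: R.2.2].
Qed.

Lemma Ye_Yu_eq i f : Ye i (Yu i f) = Yu i (Ye i f) + Ya f.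
Proof.
rewrite !YuE !YeE YaE.
exact: (eta_u_rels rt dD dM dC (ev i _) (ev i _) (ev i _) (ev i _) (ev i _)
  (values_eta i).1 f).1.
Qed.

Lemma Ye_Yu_neq i j k f : distinct3 i j k -> Ye i (Yu j f) = Yu j (Ye i f).
Proof.
have R := eta_u_rels rt dD dM dC (ev i (iu i)) (ev i (iu (i + 1))) (ev i (iu (i + 2%:R)))
  (ev i (ichi 0)) (ev i (ichi 1)) (values_eta i).1 f.
by case/distinct3_cases => -[-> _]; rewrite !YeE !YuE; [exact: R.2.1|exact: R.2.2].
Qed.

Lemma Yz_Yu_eq i f : Yz i (Yu i f) = Yu i (Yz i f) + Yb f.
Proof.
rewrite !YuE !YzE YbE.
exact: (zeta_u_rels rt dD dM dC _ (vu (i + 1)) (vu (i + 2%:R)) _ _ (values_zeta i).1 f).1.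
Qed.

Lemma Yz_Yu_neq i j k f : distinct3 i j k -> Yz i (Yu j f) = Yu j (Yz i f).
Proof.
have R := zeta_u_rels rt dD dM dC (vu i) (vu (i + 1)) (vu (i + 2%:R)) (vchi 0) (vchi 1)
  (values_zeta i).1 f.
by case/distinct3_cases => -[-> _]; rewrite !YzE !YuE; [exact: R.2.1|exact: R.2.2].
Qed.

Lemma YeC i j f : Ye i (Ye j f) = Ye j (Ye i f).
Proof.
have R l : Ye l (Ye (l + 1) f) = Ye (l + 1) (Ye l f).
  rewrite !YeE !ord3_add.
  exact: (eta_eta_rel rt dD dM dC (ev l (iu l)) (ev l (iu (l + 1)))
    (ev l (iu (l + 2%:R))) (ev l (ichi 0)) (ev l (ichi 1))
    (values_eta l).1 (values_eta l).2.1 f).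
exact: (@ord3_step (fun i j => Ye i (Ye j f) = Ye j (Ye i f)) (fun=> erefl) R
  (fun l => esym (R l)) i j).
Qed.

Lemma YuC i j f : Yu i (Yu j f) = Yu j (Yu i f).
Proof.
have R l : Yu l (Yu (l + 1) f) = Yu (l + 1) (Yu l f).
  rewrite !YuE.
  exact: (u_u_rel rt dD dM dC (ev l (iu l)) (ev l (iu (l + 1))) (ev l (ichi 0))
    (ev l (ichi 1)) f).
exact: (@ord3_step (fun i j => Yu i (Yu j f) = Yu j (Yu i f)) (fun=> erefl) R
  (fun l => esym (R l)) i j).
Qed.

Lemma YzC i j f : Yz i (Yz j f) = Yz j (Yz i f).
Proof. by rewrite !YzE pdC. Qed.

Lemma Y_Ya i f :
  prod (Ye i (Ya f) = Ya (Ye i f)) (prod (Yu i (Ya f) = Ya (Yu i f)) (Yz i (Ya f) = Ya (Yz i f))).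
Proof.
have R := chi_rels rt dD dM dC (vu i) (vu (i + 1)) (vu (i + 2%:R)) (veta i) (vzeta i)
  (ev i (ichi 0)) (ev i (ichi 1)) (v := vchi 0) f (or_introl erefl).
by rewrite !YaE !YzE !YeE !YuE; exact: R.
Qed.

Lemma Y_Yb i f :
  prod (Ye i (Yb f) = Yb (Ye i f)) (prod (Yu i (Yb f) = Yb (Yu i f)) (Yz i (Yb f) = Yb (Yz i f))).
Proof.
have R := chi_rels rt dD dM dC (vu i) (vu (i + 1)) (vu (i + 2%:R)) (veta i) (vzeta i)
  (ev i (ichi 0)) (ev i (ichi 1)) (v := vchi 1) f (or_intror erefl).
by rewrite !YbE !YzE !YeE !YuE; exact: R.
Qed.

Lemma YbYaC f : Yb (Ya f) = Ya (Yb f).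
Proof. by rewrite !YaE !YbE pdC. Qed.

(* [wX F1 F2] is the field X^F of the untruncated algebra. *)
Definition wX (F1 F2 : A) : vfield K var11 :=
  wm F1 (vpartial K (vchi 0)) + wm F2 (vpartial K (vchi 1)) +
  \sum_(i : 'I_3) (wm (Yu i F2) (vpartial K (vzeta i)) + wm (Yu i F1) (wYeta K i) +
                   wm (Yz i F2) (wYu K i)).

Local Notation mulA := (@wmul K var11).
Local Notation coefs_at k := (pair_coefs Yu Yz k (k + 1) (k + 2%:R)).
Local Notation framed_at k := (framed +%R mulA Ya Yb Yu Yz Ye k (k + 1) (k + 2%:R)).

Lemma wX_framed k F1 F2 f : wX F1 F2 @@ f = framed_at k (coefs_at k F1 F2) f.
Proof.
have E i : (wm (Yu i F2) (vpartial K (vzeta i)) + wm (Yu i F1) (wYeta K i) +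
    wm (Yz i F2) (wYu K i)) @@ f = Yu i F2 ** Yz i f + Yu i F1 ** Ye i f + Yz i F2 ** Yu i f.
  by rewrite !vappDl !vapp_wm -Ye_vapp -Yu_vapp -Yz_vapp.
rewrite /wX !vappDl vapp_sum !vapp_wm (eq_bigr _ (fun i _ => E i)) (sum_ord3 _ k).
by rewrite /framed /pair_coefs Ya.unlock Yb.unlock addrA [X in X + _ = _]addrA.
Qed.

Definition gen (F1 F2 : A) : Prop := gen_pair 0 Yz Ye F1 F2.

Lemma distinct3_perms k : [/\ distinct3 k (k + 1) (k + 2%:R), distinct3 k (k + 2%:R) (k + 1),
  distinct3 (k + 1) k (k + 2%:R) & [/\ distinct3 (k + 1) (k + 2%:R) k,
  distinct3 (k + 2%:R) k (k + 1) & distinct3 (k + 2%:R) (k + 1) k]].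
Proof. by do !split; elim/ord3P: k. Qed.

Definition gen_bracket k F1 F2 G1 G2 :=
  (pair_bracket +%R mulA Ya Yb Yu Yz k (k + 1) (k + 2%:R) F1 F2 G1 G2 G1 F1,
   pair_bracket +%R mulA Ya Yb Yu Yz k (k + 1) (k + 2%:R) F1 F2 G1 G2 G2 F2).

Let dera : is_der +%R mulA Ya.
Proof. rewrite Ya.unlock; exact: (vapp_is_der (vpartial K (vchi 0))). Qed.
Let derb : is_der +%R mulA Yb.
Proof. rewrite Yb.unlock; exact: (vapp_is_der (vpartial K (vchi 1))). Qed.
Lemma Yu_is_der i : is_der +%R mulA (Yu i).
Proof. rewrite Yu.unlock; exact: (vapp_is_der (wYu K i)). Qed.
Lemma Yz_is_der i : is_der +%R mulA (Yz i).
Proof. rewrite Yz.unlock; exact: (vapp_is_der (vpartial K (vzeta i))). Qed.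
Lemma Ye_is_der i : is_der +%R mulA (Ye i).
Proof. rewrite Ye.unlock; exact: (vapp_is_der (wYeta K i)). Qed.
Let deru := Yu_is_der. Let derz := Yz_is_der. Let dere := Ye_is_der.
Let uaC i f := (Y_Ya i f).2.1. Let ubC i f := (Y_Yb i f).2.1.
Let zaC i f := (Y_Ya i f).2.2. Let zbC i f := (Y_Yb i f).2.2.
Let eaC i f := (Y_Ya i f).1. Let ebC i f := (Y_Yb i f).1.

Lemma gen_gen_bracket k F1 F2 G1 G2 : gen F1 F2 -> gen G1 G2 ->
  gen (gen_bracket k F1 F2 G1 G2).1 (gen_bracket k F1 F2 G1 G2).2.
Proof.
move=> gF gG; have [t1 t2 t3 [t4 t5 t6]] := distinct3_perms k.
apply: (bracket_gen_pair rt dera derb deru derz dere zaC zbC eaC ebC Ye_Yz_eq Yz_Yu_eq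
  Ye_Yu_eq Yz_Yu_neq Ye_Yu_neq Ye_Yz_neq t1 t2 t3 t4 t5 t6 gF gG) => P.
have all3 : forall i, i = k \/ i = k + 1 \/ i = k + 2%:R.
  move=> i; elim/ord3P: k {t1 t2 t3 t4 t5 t6}; elim/ord3P: i;
    try (by left); try (by right; left; apply: val_inj); by right; right; apply: val_inj.
by move=> P0 P1 P2 i; case: (all3 i) => [->|[->|->]].
Qed.

Lemma wbr_wX k F1 F2 G1 G2 : gen F1 F2 -> gen G1 G2 ->
  wbr (wX F1 F2) (wX G1 G2) =
  wX (gen_bracket k F1 F2 G1 G2).1 (gen_bracket k F1 F2 G1 G2).2.
Proof.
move=> gF gG; have [t1 t2 t3 [t4 t5 t6]] := distinct3_perms k.
apply: vfield_ext => f; rewrite (wbr_apply char2) !(wX_framed k).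
rewrite (framed_bracket rt dera derb deru derz dere YbYaC uaC ubC zaC zbC eaC ebC
  YuC YzC YeC Ye_Yz_eq Yz_Yu_eq Ye_Yu_eq Yz_Yu_neq Ye_Yu_neq Ye_Yz_neq t1 t2 t3 t4 t5 t6).
by rewrite (bracket_pair_coefs rt deru derz dere uaC ubC zaC zbC YuC Ye_Yz_eq Yz_Yu_eq
  Ye_Yu_eq Yz_Yu_neq Ye_Yu_neq Ye_Yz_neq t1 t2 t3 t4 t5 t6 gF gG).
Qed.

Lemma Yz_gen_bracket k F1 F2 G1 G2 : gen F1 F2 -> gen G1 G2 ->
  Yz k (gen_bracket k F1 F2 G1 G2).2 =
  F1 ** Ya (Yz k G2) + F2 ** Yb (Yz k G2) + Yz k F2 ** Yu k (Yz k G2) +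
  Yz (k + 1) F2 ** Yu (k + 1) (Yz k G2) + Yz (k + 2%:R) F2 ** Yu (k + 2%:R) (Yz k G2) +
  (G1 ** Ya (Yz k F2) + G2 ** Yb (Yz k F2) + Yz k G2 ** Yu k (Yz k F2) +
  Yz (k + 1) G2 ** Yu (k + 1) (Yz k F2) + Yz (k + 2%:R) G2 ** Yu (k + 2%:R) (Yz k F2)) +
  (Yu (k + 1) F1 ** Yu (k + 2%:R) G2 + Yu (k + 1) F2 ** Yu (k + 2%:R) G1 +
   (Yu (k + 2%:R) F1 ** Yu (k + 1) G2 + Yu (k + 2%:R) F2 ** Yu (k + 1) G1)).
Proof.
move=> gF gG; have [t1 t2 t3 [t4 t5 t6]] := distinct3_perms k.
exact: (z_pair_bracket rt derz dere zaC zbC Ye_Yz_eq Yz_Yu_eq Yz_Yu_neq Ye_Yz_neq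
  t1 t2 t4 t6 gF gG).
Qed.

End Mb3Operators.

(** * Restriction to eta = zeta = 0 *)

Section Support.
Variables (K : fieldType) (I : finType).
Implicit Types (f g : dp K I) (r : mindex I) (v : I).

Definition minc v r : mindex I := [ffun i => (r i + (i == v))%N].

Lemma minc_mdec v r : r v != 0%N -> minc v (mdec v r) = r.
Proof.
move=> rv; apply/ffunP => i; rewrite !ffunE.
by case: eqP => [->|_] /=; rewrite ?subn0 ?addn0 // subnK // lt0n.
Qed.

(** In divided powers [pd v] sends a monomial of positive exponent at [v] to one monomial with
    coefficient 1. Raising the exponent again recovers everything but the part free of [v], whatever
    the characteristic. *)
Lemma pd0_supp v f : pd v f = 0 -> supp_in (fun r => r v = 0%N) f.
Proof.
pose kv := lext (fun r => if r v == 0%N then << r >> else 0 : dp K I).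
have split_f g : g = kv g + lext (fun r => << minc v r >>) (pd v g).
  move: g; apply: lin_eq => [c g h|c g h|r]; first by [].
    rewrite pd_linear /kv (lext_linear _ c g h).
  by rewrite (lext_linear _ c (pd v g)) scalerDr addrACA.
  rewrite pd.unlock dpartialU /kv lextU; case: ifPn => rv.
    by rewrite linear0 addr0.
  by rewrite lextU minc_mdec // add0r.
move=> f0; rewrite [f]split_f f0 linear0 addr0.
rewrite /kv; apply: (@lext_in _ _ _ (@supp_in_subspace K _ _)) => r _; case: ifP => [/eqP rv|_].
  exact: (@supp_in1 K _ _ r rv).
exact: subspace0 (@supp_in_subspace K _ _).
Qed.

Lemma lext_id (Q : mindex I -> dp K I) (P : mindex I -> Prop) f :
  (forall r, P r -> Q r = << r >>) -> supp_in P f -> lext Q f = f.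
Proof.
move=> QP Pf; rewrite [RHS]malg_sumZ; apply: eq_big_seq => r /Pf Pr.
by rewrite QP.
Qed.

End Support.

Definition mext (s : mindex 'I_5) : mindex var11 :=
  [ffun v => if v is inl i then s i else 0%N].
Definition mrst (r : mindex var11) : mindex 'I_5 := [ffun i => r (inl i)].
Definition even_ix (r : mindex var11) : bool := [forall o, r (inr o) == 0%N].
Definition zeta_free (r : mindex var11) : bool := [forall i, r (vzeta i) == 0%N].

HB.lock Definition res (K : fieldType) : dp K var11 -> dp K 'I_5 :=
  lext (fun r => if even_ix r then << mrst r >> else 0).
HB.lock Definition emb (K : fieldType) : dp K 'I_5 -> dp K var11 :=
  lext (fun s : mindex 'I_5 => << mext s >>).
(** An intermediate restriction, to zeta = 0 alone: modulo the zeta's, Y_eta_i is the plain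
    derivative along eta_i, since its u- and chi-terms all have coefficients in the zeta's. *)
HB.lock Definition kz (K : fieldType) : dp K var11 -> dp K var11 :=
  lext (fun r => if zeta_free r then << r >> else 0).

Section Restriction.
Variable K : fieldType.
Hypothesis char2 : 2%N \in [pchar K].
Local Notation A := (dp K var11).
Local Notation B := (dp K 'I_5).
Implicit Types (f g : A) (r s : mindex var11) (v : 'I_5) (o : 'I_3 + 'I_3).

Lemma res_linear : linear (@res K). Proof. by rewrite res.unlock; exact: lext_linear. Qed.
Lemma emb_linear : linear (@emb K). Proof. by rewrite emb.unlock; exact: lext_linear. Qed.
Lemma kz_linear : linear (@kz K). Proof. by rewrite kz.unlock; exact: lext_linear. Qed.
HB.instance Definition _ := GRing.isLinear.Build K A B *:%R (@res K) res_linear.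
HB.instance Definition _ := GRing.isLinear.Build K B A *:%R (@emb K) emb_linear.
HB.instance Definition _ := GRing.isLinear.Build K A A *:%R (@kz K) kz_linear.

Lemma resD f g : res (f + g) = res f + res g. Proof. exact: linearD. Qed.
Lemma res0 : res 0 = 0 :> B. Proof. exact: linear0. Qed.
Lemma kzD f g : kz (f + g) = kz f + kz g. Proof. exact: linearD. Qed.
Lemma kz0 : kz 0 = 0 :> A. Proof. exact: linear0. Qed.
Lemma embD (f g : B) : emb (f + g) = emb f + emb g. Proof. exact: linearD. Qed.
Lemma emb0 : emb 0 = 0 :> A. Proof. exact: linear0. Qed.
Lemma resU r : res << r >> = if even_ix r then << mrst r >> else 0 :> B.
Proof. rewrite res.unlock; exact: lextU. Qed.
Lemma embU (s : mindex 'I_5) : emb << s >> = << mext s >> :> A.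
Proof. rewrite emb.unlock; exact: lextU. Qed.
Lemma kzU r : kz << r >> = if zeta_free r then << r >> else 0 :> A.
Proof. rewrite kz.unlock; exact: lextU. Qed.

Lemma even_ix_madd r s : even_ix (madd r s) = even_ix r && even_ix s.
Proof.
apply/forallP/andP => [H|[/forallP Hr /forallP Hs] o].
  by split; apply/forallP => o; have := H o; rewrite ffunE addn_eq0 => /andP[].
by rewrite ffunE (eqP (Hr o)) (eqP (Hs o)).
Qed.

Lemma zeta_free_madd r s : zeta_free (madd r s) = zeta_free r && zeta_free s.
Proof.
apply/forallP/andP => [H|[/forallP Hr /forallP Hs] o].
  by split; apply/forallP => o; have := H o; rewrite ffunE addn_eq0 => /andP[].
by rewrite ffunE (eqP (Hr o)) (eqP (Hs o)).
Qed.

Lemma mrst_madd r s : mrst (madd r s) = madd (mrst r) (mrst s).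
Proof. by apply/ffunP => i; rewrite !ffunE. Qed.

Lemma mbin_mrst r s : even_ix r -> mbin (mrst r) (mrst s) = mbin r s.
Proof.
move=> /forallP er; rewrite /mbin [RHS]big_sumType /=.
rewrite [X in _ = (_ * X)%N]big1 ?muln1; last by move=> o _; rewrite (eqP (er o)) bin0.
by apply: eq_bigr => i _; rewrite !ffunE.
Qed.

Lemma wmulU (I : finType) (r s : mindex I) :
  << r >> ** << s >> = (mbin r s)%:R *: << madd r s >> :> dp K I.
Proof. by rewrite wmul.unlock dpmulU mmul_unconstrained. Qed.

Lemma resM f g : res (f ** g) = res f ** res g.
Proof.
move: f; apply: lin_eq => [c x y|c x y|r].
- by rewrite wmul_linear_l res_linear.
- by rewrite res_linear wmul_linear_l.
move: g; apply: lin_eq => [c x y|c x y|s].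
- by rewrite wmul_linear res_linear.
- by rewrite res_linear wmul_linear.
rewrite wmulU linearZ /= !resU even_ix_madd.
case er : (even_ix r); last by rewrite scaler0 wmul0l.
case es : (even_ix s); last by rewrite scaler0 wmul0r.
by rewrite wmulU mrst_madd mbin_mrst.
Qed.

Lemma kzM f g : kz (f ** g) = kz f ** kz g.
Proof.
move: f; apply: lin_eq => [c x y|c x y|r].
- by rewrite wmul_linear_l kz_linear.
- by rewrite kz_linear wmul_linear_l.
move: g; apply: lin_eq => [c x y|c x y|s].
- by rewrite wmul_linear kz_linear.
- by rewrite kz_linear wmul_linear.
rewrite wmulU linearZ /= !kzU zeta_free_madd.
case er : (zeta_free r); last by rewrite scaler0 wmul0l.
case es : (zeta_free s); last by rewrite scaler0 wmul0r.
by rewrite wmulU.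
Qed.

Lemma pdU (I : finType) (v : I) (r : mindex I) :
  pd v << r >> = if r v == 0%N then 0 else << mdec v r >> :> dp K I.
Proof. by rewrite pd.unlock dpartialU. Qed.

Lemma res_pd v f : res (pd (inl v) f) = pd v (res f).
Proof.
move: f; apply: lin_eq => [c x y|c x y|r].
- by rewrite pd_linear res_linear.
- by rewrite res_linear pd_linear.
rewrite pdU resU.
have e : even_ix (mdec (inl v) r) = even_ix r.
  by apply: eq_forallb => o; rewrite ffunE subn0.
have m : mrst (mdec (inl v) r) = mdec v (mrst r) by apply/ffunP => i; rewrite !ffunE.
have z : (mrst r v == 0%N) = (r (inl v) == 0%N) by rewrite ffunE.
case: ifP => rv; case er : (even_ix r); rewrite ?linear0 ?resU ?e ?er ?pdU ?z ?rv ?m //.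
Qed.

Lemma emb_pd v (f : B) : emb (pd v f) = pd (inl v) (emb f).
Proof.
move: f; apply: lin_eq => [c x y|c x y|r].
- by rewrite pd_linear emb_linear.
- by rewrite emb_linear pd_linear.
rewrite pdU embU pdU ffunE; case: ifP => _; first by rewrite linear0.
rewrite embU; congr << _ >>; apply/ffunP => -[i|o]; rewrite !ffunE //.
Qed.

Lemma emb_odd o (f : B) : pd (inr o) (emb f) = 0.
Proof.
move: f; apply: lin_eq => [c x y|c x y|r].
- by rewrite emb_linear pd_linear.
- by rewrite scaler0 addr0.
by rewrite embU pdU ffunE.
Qed.

Lemma res_emb (f : B) : res (emb f) = f.
Proof.
move: f; apply: lin_eq => [c x y|//|r].
  by rewrite emb_linear res_linear.
rewrite embU resU ifT; first by congr << _ >>; apply/ffunP => i; rewrite !ffunE.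
by apply/forallP => o; rewrite ffunE.
Qed.

Lemma emb_res f : (forall o, pd (inr o) f = 0) -> emb (res f) = f.
Proof.
move=> f0.
have -> : emb (res f) = lext (fun r => if even_ix r then << mext (mrst r) >> else 0) f.
  move: f {f0}; apply: lin_eq => [c x y||r]; [|exact: lext_linear|].
    by rewrite res_linear emb_linear.
  by rewrite resU lextU; case: ifP => _; rewrite ?linear0 ?embU.
apply: (lext_id (P := fun r => forall o, r (inr o) = 0%N)) => [r r0|r fr o].
  rewrite ifT; last by apply/forallP => o; rewrite r0.
  by congr << _ >>; apply/ffunP => -[i|o]; rewrite !ffunE.
exact: (pd0_supp (f0 o) fr).
Qed.

Lemma res_odd0 f : (forall o, pd (inr o) f = 0) -> res f = 0 -> f = 0.
Proof. by move=> f0 r0; rewrite -(emb_res f0) r0 linear0. Qed.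

Lemma kz_id f : (forall i, pd (vzeta i) f = 0) -> kz f = f.
Proof.
move=> f0; rewrite kz.unlock; apply: (lext_id (P := zeta_free)) => [r ->//|r fr].
by apply/forallP => i; rewrite (pd0_supp (f0 i) fr).
Qed.

Lemma kz_pd (w : var11) f : (forall i, w != vzeta i) -> kz (pd w f) = pd w (kz f).
Proof.
move=> wz; move: f; apply: lin_eq => [c x y|c x y|r].
- by rewrite pd_linear kz_linear.
- by rewrite kz_linear pd_linear.
rewrite pdU kzU.
have e : zeta_free (mdec w r) = zeta_free r.
  by apply: eq_forallb => i; rewrite ffunE [vzeta i == w]eq_sym (negbTE (wz i)) subn0.
by case: ifP => rv; case er : (zeta_free r); rewrite ?linear0 ?kzU ?e ?er ?pdU ?rv.
Qed.

Lemma pd_kz i f : pd (vzeta i) (kz f) = 0.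
Proof.
move: f; apply: lin_eq => [c x y|c x y|r].
- by rewrite kz_linear pd_linear.
- by rewrite scaler0 addr0.
by rewrite kzU; case: ifP => [/forallP rz|_]; rewrite ?pd0 // pdU rz.
Qed.

Lemma res_kz f : res (kz f) = res f.
Proof.
move: f; apply: lin_eq => [c x y||r]; [|exact: res_linear|].
  by rewrite kz_linear res_linear.
rewrite kzU; case: ifPn => // /forallPn[i rz]; rewrite linear0 resU ifN //.
by apply/forallPn; exists (inr i).
Qed.

Lemma res_var o : res (dpvar K (inr o)) = 0.
Proof.
rewrite resU ifN //; apply/forallPn; exists o.
by rewrite ffunE eqxx.
Qed.

Lemma kz_zeta i : kz (dpvar K (vzeta i)) = 0.
Proof. by rewrite kzU ifN //; apply/forallPn; exists i; rewrite ffunE eqxx. Qed.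

Lemma kz_eta i : kz (dpvar K (veta i)) = dpvar K (veta i).
Proof. by rewrite kzU ifT //; apply/forallP => j; rewrite ffunE. Qed.

Lemma divpow_res (N : 'I_5 -> height) f : divpow (Ntilde N) f -> divpow N (res f).
Proof.
move=> Nf; rewrite res.unlock; apply: (@lext_in _ _ _ (divpow_subspace K N)) => r /Nf /forallP Nr.
case: ifP => _; last exact: subspace0 (divpow_subspace K N).
by apply: supp_in1; apply/forallP => i; rewrite ffunE; apply: (Nr (inl i)).
Qed.

Lemma divpow_emb (N : 'I_5 -> height) (f : B) : divpow N f -> divpow (Ntilde N) (emb f).
Proof.
move=> Nf; rewrite emb.unlock; apply: (@lext_in _ _ _ (divpow_subspace K (Ntilde N))).
move=> r /Nf /forallP Nr.
by apply: supp_in1; apply/forallP => -[i|o]; rewrite ffunE //=; apply: Nr.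
Qed.

End Restriction.

(** * Rearrangements, closure and algebra morphisms *)

Section Shuffles.
Variables (A : Type) (zero one : A) (add mul : A -> A -> A).
Hypothesis A_ring : ring_theory zero one add mul add id eq.
Add Ring shuffle_ring : A_ring (morphism (of_bool_morph A_ring)).
Local Notation "x + y" := (add x y).
Local Notation "x * y" := (mul x y).

Lemma chi_shuffle x4 x5 g4 g5 y4 y5 f4 f5 p1 p2 p3 q1 q2 q3 r1 r2 r3 s1 s2 s3 :
  x4 * g4 + x5 * g5 + (y4 * f4 + y5 * f5) + (p1 * q1 + r1 * s1) + (p2 * q2 + r2 * s2) +
    (p3 * q3 + r3 * s3) =
  s1 * r1 + s2 * r2 + s3 * r3 + x4 * g4 + x5 * g5 +
    (q1 * p1 + q2 * p2 + q3 * p3 + y4 * f4 + y5 * f5).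
Proof. ring. Qed.

Lemma u_shuffle x4 x5 x1 x2 x3 y4 y5 y1 y2 y3 g4 g5 g1 g2 g3 f4 f5 f1 f2 f3 a b c d
    a' b' c' d' :
  x4 * g4 + x5 * g5 + x1 * g1 + x2 * g2 + x3 * g3 +
    (y4 * f4 + y5 * f5 + y1 * f1 + y2 * f2 + y3 * f3) +
    (a * a' + b * b' + (c * c' + d * d')) =
  x1 * g1 + x2 * g2 + x3 * g3 + x4 * g4 + x5 * g5 +
    (y1 * f1 + y2 * f2 + y3 * f3 + y4 * f4 + y5 * f5) +
    (a * a' + b * b' + (c * c' + d * d')).
Proof. ring. Qed.

Lemma move_all x y w p b : x + p = y + b + w -> x + w + y + p + b = zero.
Proof.
move=> E; transitivity (x + p + (y + b + w)); first ring.
by rewrite E; ring.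
Qed.
End Shuffles.

Section Closure.
Variables (A : Type) (add mul : A -> A -> A) (P : A -> Prop).
Hypothesis PD : forall f g, P f -> P g -> P (add f g).
Hypothesis PM : forall f g, P f -> P g -> P (mul f g).

Lemma pair_bracket_closed (T : Type) (a b : A -> A) (u z : T -> A -> A) i1 i2 i3
    F1 F2 G1 G2 G F :
  (forall f, P f -> P (a f)) -> (forall f, P f -> P (b f)) ->
  (forall i f, P f -> P (u i f)) -> (forall i f, P f -> P (z i f)) ->
  P F1 -> P F2 -> P G1 -> P G2 -> P G -> P F ->
  P (pair_bracket add mul a b u z i1 i2 i3 F1 F2 G1 G2 G F).
Proof. by move=> Pa Pb Pu Pz ? ? ? ? ? ?; rewrite /pair_bracket; auto 20. Qed.

Variables (T : Type) (d : T -> A -> A).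
Hypothesis Pd : forall v f, P f -> P (d v f).

Lemma first_gen_closed p1 p2 p3 a h1 h2 h3 f1 f2 f3 f4 f5 :
  P h1 -> P h2 -> P h3 -> P f1 -> P f2 -> P f3 -> P f4 -> P f5 ->
  P (first_gen add mul d p1 p2 p3 a h1 h2 h3 f1 f2 f3 f4 f5).
Proof. by move=> *; rewrite /first_gen; auto 20. Qed.

Lemma second_gen_closed p1 p2 p3 a b n1 n2 n3 h1 h2 h3 t1 t2 t3 F f :
  P h1 -> P h2 -> P h3 -> P t1 -> P t2 -> P t3 -> P F -> P f ->
  P (second_gen add mul d p1 p2 p3 a b n1 n2 n3 h1 h2 h3 t1 t2 t3 F f).
Proof. by move=> *; rewrite /second_gen; auto 20. Qed.
End Closure.

Section Morphisms.
Variables (A B : Type) (zero one : B) (addA mulA : A -> A -> A) (addB mulB : B -> B -> B).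
Hypothesis B_ring : ring_theory zero one addB mulB addB id eq.
Add Ring morphism_ring : B_ring (morphism (of_bool_morph B_ring)).
Variable phi : A -> B.
Hypothesis phiD : forall f g, phi (addA f g) = addB (phi f) (phi g).
Hypothesis phiM : forall f g, phi (mulA f g) = mulB (phi f) (phi g).
Variables (T : Type) (d : T -> A -> A) (a b : T).

Lemma u_op_morph p h t f : phi t = zero ->
  phi (u_op addA mulA d a b p h t f) = addB (phi (d p f)) (mulB (phi h) (phi (d a f))).
Proof. by move=> t0; rewrite /u_op !phiD !phiM t0; ring. Qed.

Lemma eta_op_morph n pj pk hj hk tj tk f : phi tj = zero -> phi tk = zero ->
  phi (eta_op addA mulA d a b n pj pk hj hk tj tk f) = phi (d n f).
Proof. by move=> j0 k0; rewrite /eta_op !(phiD, phiM) j0 k0; ring. Qed.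

Lemma first_gen_morph p1 p2 p3 h1 h2 h3 f1 f2 f3 f4 f5 :
  phi h1 = zero -> phi h2 = zero -> phi h3 = zero ->
  phi (first_gen addA mulA d p1 p2 p3 a h1 h2 h3 f1 f2 f3 f4 f5) = phi f4.
Proof. by move=> E1 E2 E3; rewrite /first_gen !(phiD, phiM) E1 E2 E3; ring. Qed.

Lemma first_gen_deriv_morph h2 h3 f1 x y w : phi h2 = zero -> phi h3 = zero ->
  phi (addA (addA (addA f1 (mulA h3 x)) (mulA h2 y)) (mulA (mulA h2 h3) w)) = phi f1.
Proof. by move=> E2 E3; rewrite !(phiD, phiM) E2 E3; ring. Qed.

Lemma second_gen_morph p1 p2 p3 n1 n2 n3 h1 h2 h3 t1 t2 t3 F f :
  phi t1 = zero -> phi t2 = zero -> phi t3 = zero ->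
  phi (second_gen addA mulA d p1 p2 p3 a b n1 n2 n3 h1 h2 h3 t1 t2 t3 F f) = phi f.
Proof. by move=> E1 E2 E3; rewrite /second_gen !(phiD, phiM) E1 E2 E3; ring. Qed.

Lemma framed_morph (a' b' : A -> A) (u z e : T -> A -> A) i1 i2 i3 F1 F2 f :
  (forall i, phi (z i f) = zero) -> (forall i, phi (e i f) = zero) ->
  phi (framed addA mulA a' b' u z e i1 i2 i3 (pair_coefs u z i1 i2 i3 F1 F2) f) =
  addB (addB (addB (addB (mulB (phi F1) (phi (a' f))) (mulB (phi F2) (phi (b' f))))
    (mulB (phi (z i1 F2)) (phi (u i1 f)))) (mulB (phi (z i2 F2)) (phi (u i2 f))))
    (mulB (phi (z i3 F2)) (phi (u i3 f))).
Proof. by move=> z0 e0; rewrite /framed /= !(phiD, phiM) !z0 !e0; ring. Qed.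
End Morphisms.

Section Mb3.
Variable K : fieldType.
Hypothesis char2 : 2%N \in [pchar K].
Local Notation A := (dp K var11).
Local Notation B := (dp K 'I_5).
Local Notation eta i := (dpvar K (veta i)).
Local Notation zeta i := (dpvar K (vzeta i)).
Local Notation d := (@pd K var11).
Local Notation mulA := (@wmul K var11).
Implicit Types (i j k : 'I_3) (f g : A) (F G : A) (D : vfield K 'I_5).

Let rtA := wide_ring_theory var11 char2.
Let rtB := wide_ring_theory 'I_5 char2.

Section Heights.
Variable N : 'I_5 -> height.
Local Notation Nt := (Ntilde N).

Lemma divpow_odd (o : 'I_3 + 'I_3) : divpow Nt (dpvar K (inr o)).
Proof. by apply: (@divpow_var K var11). Qed.

Lemma divpow_wYu i v : divpow Nt (wYu K i v).
Proof.
move: v; do 2?[apply: divpow_vfieldD]; first exact: divpow_vpartial.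
  exact: (divpow_wm char2 (@divpow_odd _) (@divpow_vpartial K var11 Nt _)).
exact: (divpow_wm char2 (@divpow_odd _) (@divpow_vpartial K var11 Nt _)).
Qed.

Let oo o o' : divpow Nt (dpvar K (inr o) ** dpvar K (inr o')).
Proof. exact: (divpow_wmul char2 (@divpow_odd _) (@divpow_odd _)). Qed.

Let oooo i j : divpow Nt (zeta i ** eta j + zeta j ** eta i).
Proof. exact: (subspaceD (divpow_subspace K Nt) (@oo _ _) (@oo _ _)). Qed.

Lemma divpow_wYeta i v : divpow Nt (wYeta K i v).
Proof.
move: v; do 4?[apply: divpow_vfieldD]; first exact: divpow_vpartial.
- exact: (divpow_wm char2 (@divpow_odd _) (@divpow_vpartial K var11 Nt _)).
- exact: (divpow_wm char2 (@divpow_odd _) (@divpow_vpartial K var11 Nt _)).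
- exact: (divpow_wm char2 (@oooo _ _) (@divpow_vpartial K var11 Nt _)).
exact: (divpow_wm char2 (@oo _ _) (@divpow_vpartial K var11 Nt _)).
Qed.

Let vmul_odd o v : vmul Nt (dpvar K (inr o)) (vpartial K v) =
  wm (dpvar K (inr o)) (vpartial K v).
Proof. exact: (vmul_wide char2 (@divpow_odd o) (@divpow_vpartial K var11 Nt v)). Qed.

Let mul_odd o o' : dpmul Nt (dpvar K (inr o)) (dpvar K (inr o')) =
  dpvar K (inr o) ** dpvar K (inr o').
Proof. exact: (dpmul_wide char2 (@divpow_odd o) (@divpow_odd o')). Qed.

Lemma Yu_wide i : Defs.Yu K N i = wYu K i.
Proof.
exact: (f_equal2 +%R (f_equal2 +%R (erefl _) (vmul_odd (inl i) (vchi 0)))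
  (vmul_odd (inr i) (vchi 1))).
Qed.

Lemma Yeta_wide i : Yeta K N i = wYeta K i.
Proof.
rewrite /Yeta /wYeta; cbv zeta; move: (i + 1) (i + 2%:R) => j k.
have chi0 : vmul Nt (dpmul Nt (zeta k) (eta j) + dpmul Nt (zeta j) (eta k))
    (vpartial K (vchi 0)) = wm (zeta k ** eta j + zeta j ** eta k) (vpartial K (vchi 0)).
  rewrite -(vmul_wide char2 (@oooo k j) (@divpow_vpartial K var11 Nt (vchi 0))).
  exact: (congr1 (fun f => vmul Nt f _)
    (f_equal2 +%R (mul_odd (inr k) (inl j)) (mul_odd (inr j) (inl k)))).
have chi1 : vmul Nt (dpmul Nt (zeta j) (zeta k)) (vpartial K (vchi 1)) =
    wm (zeta j ** zeta k) (vpartial K (vchi 1)).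
  rewrite -(vmul_wide char2 (@oo (inr j) (inr k)) (@divpow_vpartial K var11 Nt (vchi 1))).
  exact: (congr1 (fun f => vmul Nt f _) (mul_odd (inr j) (inr k))).
apply: (f_equal2 +%R _ chi1); apply: (f_equal2 +%R _ chi0).
apply: (f_equal2 +%R _ (vmul_odd (inr j) (vu k))).
exact: (f_equal2 +%R (erefl _) (vmul_odd (inr k) (vu j))).
Qed.

Lemma Yu_apply i f : divpow Nt f -> vapply Nt (Defs.Yu K N i) f = Yu i f.
Proof. by move=> Nf; rewrite Yu_wide (vapply_wide char2 (@divpow_wYu i) Nf) Yu_vapp. Qed.

Lemma Yeta_apply i f : divpow Nt f -> vapply Nt (Yeta K N i) f = Ye i f.
Proof. by move=> Nf; rewrite Yeta_wide (vapply_wide char2 (@divpow_wYeta i) Nf) Ye_vapp. Qed.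

Lemma Yzeta_apply i f : divpow Nt f -> vapply Nt (Yzeta K i) f = Yz i f.
Proof. by move=> Nf; rewrite (vapply_wide char2 (@divpow_vpartial K var11 Nt _) Nf) Yz_vapp. Qed.

Lemma divpow_Yu i f : divpow Nt f -> divpow Nt (Yu i f).
Proof. rewrite Yu_vapp; exact: (divpow_vapp char2 (@divpow_wYu i)). Qed.

Lemma divpow_Yz i f : divpow Nt f -> divpow Nt (Yz i f).
Proof. rewrite Yz_vapp; exact: (divpow_vapp char2 (@divpow_vpartial K var11 Nt _)). Qed.

Lemma mb3_field_wide F1 F2 : divpow Nt F1 -> divpow Nt F2 ->
  mb3_field N F1 F2 = wX F1 F2.
Proof.
move=> N1 N2; rewrite /mb3_field /wX.
rewrite (vmul_wide char2 N1 (@divpow_vpartial K var11 Nt _)).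
rewrite (vmul_wide char2 N2 (@divpow_vpartial K var11 Nt _)); congr (_ + _).
apply: eq_bigr => i _.
rewrite (Yu_apply i N1) (Yu_apply i N2) (Yzeta_apply i N2) Yu_wide Yeta_wide.
rewrite (vmul_wide char2 (@divpow_Yu i _ N2) (@divpow_vpartial K var11 Nt _)).
rewrite (vmul_wide char2 (@divpow_Yu i _ N1) (@divpow_wYeta i)).
by rewrite (vmul_wide char2 (@divpow_Yz i _ N2) (@divpow_wYu i)).
Qed.

Lemma divpow_wX F1 F2 : divpow Nt F1 -> divpow Nt F2 ->
  forall v, divpow Nt (wX F1 F2 v).
Proof.
move=> N1 N2; apply: divpow_vfieldD.
  apply: divpow_vfieldD; first exact: (divpow_wm char2 N1 (@divpow_vpartial K var11 Nt _)).
  exact: (divpow_wm char2 N2 (@divpow_vpartial K var11 Nt _)).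
move=> v; rewrite sum_ffunE; apply: (subspace_sumT (divpow_subspace K Nt)) => i.
move: v; do 2?[apply: divpow_vfieldD].
- exact: (divpow_wm char2 (@divpow_Yu i _ N2) (@divpow_vpartial K var11 Nt _)).
- exact: (divpow_wm char2 (@divpow_Yu i _ N1) (@divpow_wYeta i)).
exact: (divpow_wm char2 (@divpow_Yz i _ N2) (@divpow_wYu i)).
Qed.

Lemma mb3_generating_wide F1 F2 : mb3_generating N F1 F2 <->
  [/\ divpow Nt F1, divpow Nt F2 & gen F1 F2].
Proof.
split=> -[N1 N2 G]; apply: (And3 N1 N2 _) => i; have [G1 G2 G3] := G i; apply: And3.
- exact: etrans (esym (Yzeta_apply i N1)) G1.
- exact: etrans (esym (Yeta_apply i N1)) (etrans G2 (Yzeta_apply i N2)).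
- exact: etrans (esym (Yeta_apply i N2)) G3.
- exact: etrans (Yzeta_apply i N1) G1.
- exact: etrans (Yeta_apply i N1) (etrans G2 (esym (Yzeta_apply i N2))).
exact: etrans (Yeta_apply i N2) G3.
Qed.

End Heights.
End Mb3.

(** * The even part of a field and of a bracket *)

Section Evaluation.
Variable K : fieldType.
Hypothesis char2 : 2%N \in [pchar K].
Local Notation A := (dp K var11).
Local Notation eta i := (dpvar K (veta i)).
Local Notation zeta i := (dpvar K (vzeta i)).
Local Notation d := (@pd K var11).
Implicit Types (i j k : 'I_3) (f g : A) (F G : A) (D : vfield K 'I_5).

Let rtA := wide_ring_theory var11 char2.
Let rtB := wide_ring_theory 'I_5 char2.

Lemma res_Ya f : res (Ya f) = pd (ichi 0) (res f).
Proof. by rewrite YaE res_pd. Qed.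

Lemma res_Yb f : res (Yb f) = pd (ichi 1) (res f).
Proof. by rewrite YbE res_pd. Qed.

Let res_eta i : res (eta i) = 0 := res_var K (inl i).
Let res_zeta i : res (zeta i) = 0 := res_var K (inr i).

Lemma res_Yu i f : res (Yu i f) = pd (iu i) (res f).
Proof.
rewrite YuE (u_op_morph rtB (@resD K) (@resM K) _ _ _ _ _ _ (res_zeta i)).
by rewrite res_eta wmul0l addr0; apply: (res_pd (iu i)).
Qed.

Lemma res_Ye i f : res (Ye i f) = res (pd (veta i) f).
Proof.
rewrite YeE.
exact: (eta_op_morph rtB (@resD K) (@resM K) _ _ _ _ _ _ _ _ _ (res_zeta _) (res_zeta _)).
Qed.

Lemma kz_Yu i f : kz (Yu i f) = pd (vu i) (kz f) + eta i ** pd (vchi 0) (kz f).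
Proof.
rewrite YuE (u_op_morph rtA (@kzD K) (@kzM K) _ _ _ _ _ _ (kz_zeta K i)) kz_eta.
by rewrite (@kz_pd K (vu i)) // (@kz_pd K (vchi 0)).
Qed.

Lemma kz_Ye i f : kz (Ye i f) = pd (veta i) (kz f).
Proof.
rewrite YeE -(@kz_pd K (veta i)) //.
exact: (eta_op_morph rtA (@kzD K) (@kzM K) _ _ _ _ _ _ _ _ _ (kz_zeta K _) (kz_zeta K _)).
Qed.

Lemma res_even (v : 'I_5) : res (dpvar K (inl v)) = dpvar K v.
Proof.
rewrite resU ifT; first by congr << _ >>; apply/ffunP => i; rewrite !ffunE.
by apply/forallP => o; rewrite ffunE.
Qed.

Definition even_part (X : vfield K var11) : vfield K 'I_5 := [ffun v => res (X (inl v))].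

Lemma even_partE X v : even_part X v = res (X (inl v)).
Proof. by rewrite ffunE. Qed.

Lemma even_part_linear : linear even_part.
Proof.
by move=> c X Y; apply/ffunP => v; rewrite vfield_lin !even_partE vfield_lin res_linear.
Qed.

Lemma even_part_wX F1 F2 (v : 'I_5) k : even_part (wX F1 F2) v =
  res F1 ** pd (ichi 0) (dpvar K v) + res F2 ** pd (ichi 1) (dpvar K v) +
  res (Yz k F2) ** pd (iu k) (dpvar K v) +
  res (Yz (k + 1) F2) ** pd (iu (k + 1)) (dpvar K v) +
  res (Yz (k + 2%:R) F2) ** pd (iu (k + 2%:R)) (dpvar K v).
Proof.
set x : A := dpvar K (inl v); have rx : res x = dpvar K v := res_even v.
have z0 i : res (Yz i x) = 0 by rewrite YzE pd_var res0.
have e0 i : res (Ye i x) = 0 by rewrite res_Ye pd_var res0.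
rewrite even_partE -(vapp_var (wX F1 F2) (inl v)) -/x (wX_framed k).
rewrite (framed_morph rtB (@resD K) (@resM K) _ _ _ _ _ _ _ _ z0 e0).
by rewrite res_Ya res_Yb !res_Yu rx.
Qed.

Lemma even_part_wX_u F1 F2 k : even_part (wX F1 F2) (iu k) = res (Yz k F2).
Proof.
rewrite (even_part_wX _ _ _ k) !pd_var !ichi_iu !(inj_eq iu_inj) eqxx !ord3_neqs.
by rewrite wmulr1 !wmul0r !add0r !addr0.
Qed.

Lemma even_part_wX_chi0 F1 F2 : even_part (wX F1 F2) (ichi 0) = res F1.
Proof.
rewrite (even_part_wX _ _ _ 0) !pd_var !iu_ichi eqxx.
have -> : (ichi 1 == ichi 0) = false by [].
by rewrite wmulr1 !wmul0r !addr0.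
Qed.

Lemma even_part_wX_chi1 F1 F2 : even_part (wX F1 F2) (ichi 1) = res F2.
Proof.
rewrite (even_part_wX _ _ _ 0) !pd_var !iu_ichi eqxx.
have -> : (ichi 0 == ichi 1) = false by [].
by rewrite wmulr1 !wmul0r !addr0 add0r.
Qed.

(** Two evaluations of Y_eta_k Y_u_k F1, directly and with Y_u_k F1 written as Y_zeta_(k+2)
    Y_zeta_(k+1) F2. The commutators leave Y_chi1 F1 on one side and Y_chi2 F2 on the other. *)
Lemma gen_div F1 F2 k : gen F1 F2 -> Yu k (Yz k F2) + Yu (k + 1) (Yz (k + 1) F2) +
  Yu (k + 2%:R) (Yz (k + 2%:R) F2) + Ya F1 + Yb F2 = 0.
Proof.
move=> gF; have [t1 t2 t3 _] := distinct3_perms k.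
have E : Yz (k + 2%:R) (Yz (k + 1) F2) = Yu k F1.
  exact: (gen_zz_neq rtA (Ye_is_der K) (Ye_Yz_neq char2) gF t3).
have E' : Ye k (Yz (k + 1) F2) = Yu (k + 2%:R) F2.
  exact: (gen_ez_neq rtA (Yz_is_der K) (Ye_Yz_neq char2) gF t2).
apply: (move_all rtA); rewrite -(gen_e1 gF k) -(Ye_Yu_eq char2) -E.
by rewrite (Ye_Yz_neq char2 _ t1) E' (Yz_Yu_eq char2).
Qed.

Lemma even_part_div F1 F2 : gen F1 F2 -> wdiv (even_part (wX F1 F2)) = 0.
Proof.
move=> gF; rewrite /wdiv (sum_ord5 _ 0) !even_part_wX_u even_part_wX_chi0 even_part_wX_chi1.
rewrite -!res_Yu -res_Ya -res_Yb -!resD.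
by rewrite (gen_div 0 gF) res0.
Qed.

Lemma Yu_linear i : linear (@Yu K i).
Proof. by rewrite Yu.unlock; apply: vapp_linear. Qed.
Lemma Yz_linear i : linear (@Yz K i).
Proof. by rewrite Yz.unlock; apply: vapp_linear. Qed.
Lemma Ye_linear i : linear (@Ye K i).
Proof. by rewrite Ye.unlock; apply: vapp_linear. Qed.

Lemma gen_linear c F1 F2 G1 G2 : gen F1 F2 -> gen G1 G2 ->
  gen (c *: F1 + G1) (c *: F2 + G2).
Proof.
move=> gF gG i; have [E1 E2 E3] := gF i; have [E1' E2' E3'] := gG i.
rewrite !Yz_linear !Ye_linear E1 E2 E3 E1' E2' E3'.
by rewrite scaler0 addr0.
Qed.

Lemma wm_linear_l c f g (X : vfield K var11) :
  wm (c *: f + g) X = c *: wm f X + wm g X.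
Proof. by apply/ffunP => v; rewrite vfield_lin !wmE wmul_linear_l. Qed.

Lemma wX_linear c F1 F2 G1 G2 :
  wX (c *: F1 + G1) (c *: F2 + G2) = c *: wX F1 F2 + wX G1 G2.
Proof.
have shuffle (V : lmodType K) (x y x' y' : V) :
    c *: x + y + (c *: x' + y') = c *: (x + x') + (y + y').
  by rewrite scalerDr addrACA.
rewrite /wX !wm_linear_l shuffle.
under eq_bigr => i _ do rewrite Yu_linear Yz_linear Yu_linear !wm_linear_l shuffle shuffle.
by rewrite big_split /= -scaler_sumr shuffle.
Qed.

(* With rho the restriction to zeta = 0, rho G2 is killed by all odd derivatives and
   vanishes at eta = zeta = 0; then so are successively the eta-derivatives of G1,
   G1 itself, and G2. *)
Lemma gen_res_inj F1 F2 : gen F1 F2 -> res F1 = 0 -> res F2 = 0 ->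
  (forall k, res (Yz k F2) = 0) -> F1 = 0 /\ F2 = 0.
Proof.
move=> gF r1 r2 r3.
have Ye0 i : Ye i (0 : A) = 0 := der0 rtA (Ye_is_der K i).
have kzF2 : kz F2 = 0.
  apply: res_odd0; last by rewrite res_kz.
  case=> i; last exact: pd_kz.
  by rewrite -/(veta i) -kz_Ye (gen_e2 gF) kz0.
have kzYz i : kz (Yz i F2) = 0.
  apply: res_odd0; last by rewrite res_kz.
  case=> j; last exact: pd_kz.
  rewrite -/(veta j) -kz_Ye; have [<-|ji] := eqVneq j i.
    by rewrite (gen_ez_eq rtA (Yz_is_der K) (Ye_Yz_eq char2) gF) kz0.
  have [l tl] : exists l, distinct3 j l i.
    by move: ji; elim/ord3P: j; elim/ord3P: i => // _;
      first [by exists 0 | by exists 1 | by exists 2%:R].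
  rewrite (gen_ez_neq rtA (Yz_is_der K) (Ye_Yz_neq char2) gF tl).
  by rewrite kz_Yu kzF2 !pd0 wmul0r addr0.
have kzF1 : kz F1 = F1.
  by apply: kz_id => i; rewrite -YzE (gen_z1 gF).
have F10 : F1 = 0.
  apply: res_odd0 r1; case=> i; last by rewrite -/(vzeta i) -YzE (gen_z1 gF).
  by rewrite -/(veta i) -kzF1 -kz_Ye (gen_e1 gF).
split=> //; rewrite -kzF2; apply/esym/kz_id => i.
by rewrite -YzE -(gen_e1 gF) F10.
Qed.

Lemma even_part_wX_inj F1 F2 G1 G2 : gen F1 F2 -> gen G1 G2 ->
  even_part (wX F1 F2) = even_part (wX G1 G2) -> F1 = G1 /\ F2 = G2.
Proof.
move=> gF gG E; have gH := gen_linear (-1) gF gG.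
have H0 : even_part (wX (-1 *: F1 + G1) (-1 *: F2 + G2)) = 0.
  by rewrite wX_linear even_part_linear E scaleN1r addNr.
have [||k|] := gen_res_inj gH.
- by rewrite -(even_part_wX_chi0 _ (-1 *: F2 + G2)) H0 vfield0.
- by rewrite -(even_part_wX_chi1 (-1 *: F1 + G1)) H0 vfield0.
- by rewrite -(even_part_wX_u (-1 *: F1 + G1)) H0 vfield0.
by rewrite !scaleN1r !(addrC (- _)) => /subr0_eq-> /subr0_eq->.
Qed.

Lemma vapp_even_part F1 F2 (f : dp K 'I_5) k : even_part (wX F1 F2) @@ f =
  res (Yz k F2) ** pd (iu k) f + res (Yz (k + 1) F2) ** pd (iu (k + 1)) f +
  res (Yz (k + 2%:R) F2) ** pd (iu (k + 2%:R)) f + res F1 ** pd (ichi 0) f +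
  res F2 ** pd (ichi 1) f.
Proof. by rewrite vappE (sum_ord5 _ k) !even_part_wX_u even_part_wX_chi0 even_part_wX_chi1. Qed.

Lemma res_pair_bracket F1 F2 G1 G2 G F :
  res (pair_bracket +%R (@wmul K var11) (@Ya K) (@Yb K) (@Yu K) (@Yz K) 0 (0 + 1) (0 + 2%:R)
    F1 F2 G1 G2 G F) = even_part (wX F1 F2) @@ res G + even_part (wX G1 G2) @@ res F.
Proof.
rewrite !(vapp_even_part _ _ _ 0) /pair_bracket !resD !resM !res_Ya !res_Yb !res_Yu.
exact: (chi_shuffle rtB).
Qed.

(** Along the u's, restriction turns the Y_u in [Yz_gen_bracket] into partial derivatives, and its
    last four products into [wcoc]. Along the chi's the components are the restricted generators of
    the bracket, where the cocycle has no component. *)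
Lemma even_part_wbr F1 F2 G1 G2 : gen F1 F2 -> gen G1 G2 ->
  even_part (wbr (wX F1 F2) (wX G1 G2)) = dbr 1 (even_part (wX F1 F2)) (even_part (wX G1 G2)).
Proof.
move=> gF gG; apply/ffunP => v; rewrite /dbr vfieldD vfieldZ scale1r.
rewrite (wbrE char2); elim/ord5P: v => [k||].
- have -> : even_part (wbr (wX F1 F2) (wX G1 G2)) (iu k) =
      res (Yz k (gen_bracket k F1 F2 G1 G2).2).
    by rewrite (wbr_wX char2 k gF gG) even_part_wX_u.
  rewrite (Yz_gen_bracket char2 k gF gG) wcoc_u /grad2 !(vapp_even_part _ _ _ k).
  have := even_part_wX_chi1 G1 G2; have := even_part_wX_chi0 G1 G2; have := even_part_wX_u G1 G2.
  have := even_part_wX_chi1 F1 F2; have := even_part_wX_chi0 F1 F2; have := even_part_wX_u F1 F2.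
  move: (even_part (wX F1 F2)) (even_part (wX G1 G2)) => X Y X1 X4 X5 Y1 Y4 Y5.
  rewrite X1 X4 X5 Y1 Y4 Y5 !resD !resM !res_Ya !res_Yb !res_Yu.
  exact: (u_shuffle rtB).
- have -> : even_part (wbr (wX F1 F2) (wX G1 G2)) (ichi 0) = res (gen_bracket 0 F1 F2 G1 G2).1.
    by rewrite (wbr_wX char2 0 gF gG) even_part_wX_chi0.
  by rewrite wcoc_chi addr0 !even_part_wX_chi0; apply: res_pair_bracket.
have -> : even_part (wbr (wX F1 F2) (wX G1 G2)) (ichi 1) = res (gen_bracket 0 F1 F2 G1 G2).2.
  by rewrite (wbr_wX char2 0 gF gG) even_part_wX_chi1.
by rewrite wcoc_chi addr0 !even_part_wX_chi1; apply: res_pair_bracket.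
Qed.

End Evaluation.

(** * The isomorphism *)

HB.lock Definition smb3 (K : fieldType) (N : 'I_5 -> height) : set (vfield K var11) :=
  car (mb3 K N).

Section Isomorphism.
Variable K : fieldType.
Hypothesis char2 : 2%N \in [pchar K].
Local Notation A := (dp K var11).
Local Notation eta i := (dpvar K (veta i)).
Local Notation zeta i := (dpvar K (vzeta i)).
Local Notation d := (@pd K var11).
Local Notation mulA := (@wmul K var11).
Implicit Types (N : 'I_5 -> height) (i j k : 'I_3) (X : vfield K var11).
Implicit Types (D : vfield K 'I_5).

Let rtA := wide_ring_theory var11 char2.
Let rtB := wide_ring_theory 'I_5 char2.
Let dD := @pdD K var11.
Let dM := @pdM K var11.
Let dC := @pdC K var11.

Lemma mb3E N : mb3 K N = Lie (@smb3 K N) (vbracket (Ntilde N)).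
Proof. by rewrite smb3.unlock. Qed.

Lemma smb3P N X : smb3 N X <-> exists F1 F2 : A,
  [/\ divpow (Ntilde N) F1, divpow (Ntilde N) F2, gen F1 F2 & X = wX F1 F2].
Proof.
rewrite smb3.unlock; split=> [[F1 [F2 [/(mb3_generating_wide char2)[N1 N2 gF] ->]]]|].
  exists F1, F2; apply: (And4 N1 N2 gF); exact: (mb3_field_wide char2 N1 N2).
move=> [F1 [F2 [N1 N2 gF ->]]]; exists F1, F2; split.
  by apply/(mb3_generating_wide char2).
exact: esym (mb3_field_wide char2 N1 N2).
Qed.

Lemma smb3_divpow N X : smb3 N X -> forall v, divpow (Ntilde N) (X v).
Proof.
move=> /smb3P[F1 [F2 [N1 N2 _ ->]]]; exact: (divpow_wX char2 N1 N2).
Qed.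

Lemma smb3_subspace N : subspace (@smb3 K N).
Proof.
have S := divpow_subspace K (Ntilde N).
split=> [|c X Y /smb3P[F1 [F2 [N1 N2 gF ->]]] /smb3P[G1 [G2 [M1 M2 gG ->]]]].
  apply/smb3P; exists 0, 0; apply: And4; [exact: subspace0 S|exact: subspace0 S| |].
    by move=> i; rewrite (der0 rtA (Ye_is_der K i)) (der0 rtA (Yz_is_der K i)).
  have := wX_linear (-1) (0 : A) 0 0 0.
  by rewrite !scaler0 !add0r scaleN1r addNr => ->.
apply/smb3P; exists (c *: F1 + G1), (c *: F2 + G2); apply: And4.
- exact: (proj2 S).
- exact: (proj2 S).
- exact: gen_linear.
by rewrite wX_linear.
Qed.

Lemma smb3_bracket N X Y : smb3 N X -> smb3 N Y -> vbracket (Ntilde N) X Y = wbr X Y.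
Proof. move=> NX NY; exact: (vbracket_wide char2 (smb3_divpow NX) (smb3_divpow NY)). Qed.

Lemma smb3_wbr N X Y : smb3 N X -> smb3 N Y -> smb3 N (wbr X Y).
Proof.
move=> /smb3P[F1 [F2 [N1 N2 gF ->]]] /smb3P[G1 [G2 [M1 M2 gG ->]]].
have cl (G F : A) : divpow (Ntilde N) G -> divpow (Ntilde N) F -> divpow (Ntilde N)
    (pair_bracket +%R mulA (@Ya K) (@Yb K) (@Yu K) (@Yz K) 0 (0 + 1) (0 + 2%:R)
      F1 F2 G1 G2 G F).
  move=> NG NF; apply: (pair_bracket_closed (P := @divpow K var11 (Ntilde N))).
  - move=> f g; exact: (subspaceD (divpow_subspace K (Ntilde N))).
  - move=> f g; exact: (divpow_wmul char2).
  - by move=> f Nf; rewrite YaE; apply: divpow_pd.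
  - by move=> f Nf; rewrite YbE; apply: divpow_pd.
  - by move=> i f Nf; apply: divpow_Yu.
  - by move=> i f Nf; apply: divpow_Yz.
  - exact: N1.
  - exact: N2.
  - exact: M1.
  - exact: M2.
  - exact: NG.
  exact: NF.
apply/smb3P; exists (gen_bracket 0 F1 F2 G1 G2).1, (gen_bracket 0 F1 F2 G1 G2).2.
apply: And4; [exact: cl M1 N1|exact: cl M2 N2| |].
  exact: gen_gen_bracket.
exact: wbr_wX.
Qed.

Lemma mb3_lie N : is_lie_algebra (mb3 K N).
Proof.
rewrite mb3E; apply: (sub_vect_lie char2 (smb3_subspace N)).
  move=> X NX; exact: smb3_divpow NX.
by move=> X Y NX NY; rewrite (smb3_bracket NX NY); apply: smb3_wbr.
Qed.

Lemma svs_even_part N X : smb3 N X -> svs N (even_part X).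
Proof.
move=> NX; apply/svsP; split.
  by move=> v; rewrite even_partE; apply: divpow_res; apply: smb3_divpow.
by move: NX => /smb3P[F1 [F2 [_ _ gF ->]]]; apply: even_part_div.
Qed.

Section Lift.
Variable D : vfield K 'I_5.
Local Notation f v := (emb (D v)).

(** Written starting from [k], though independent of it, so that every index can play the role of
    the first. *)
Definition fst_lift k : A := first_gen +%R mulA d (vu k) (vu (k + 1)) (vu (k + 2%:R))
  (vchi 0) (eta k) (eta (k + 1)) (eta (k + 2%:R))
  (f (iu k)) (f (iu (k + 1))) (f (iu (k + 2%:R))) (f (ichi 0)) (f (ichi 1)).

Definition snd_lift k : A := second_gen +%R mulA d
  (vu k) (vu (k + 1)) (vu (k + 2%:R)) (vchi 0) (vchi 1)
  (veta k) (veta (k + 1)) (veta (k + 2%:R)) (eta k) (eta (k + 1)) (eta (k + 2%:R))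
  (zeta k) (zeta (k + 1)) (zeta (k + 2%:R)) (fst_lift 0) (f (ichi 1)).

Lemma fst_liftE k : fst_lift k = fst_lift 0.
Proof.
apply: ord3_const => {}k; rewrite /fst_lift !ord3_add; exact: (first_gen_rot rtA).
Qed.

Lemma snd_liftE k : snd_lift k = snd_lift 0.
Proof.
apply: ord3_const => {}k; rewrite /snd_lift !ord3_add; exact: (second_gen_rot rtA).
Qed.

Let ev v k : even_fun 0 d (veta k) (veta (k + 1)) (veta (k + 2%:R))
  (vzeta k) (vzeta (k + 1)) (vzeta (k + 2%:R)) (f v).
Proof. by do !split; apply: emb_odd. Qed.

Lemma z_fst_lift k : Yz k (fst_lift 0) = 0.
Proof.
rewrite YzE -(fst_liftE k).
exact: (z_first_gen rtA dD dM dC _ _ _ _ (values_zeta K k).1 (values_zeta K k).2.1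
  (values_zeta K k).2.2 (ev _ k) (ev _ k) (ev _ k) (ev _ k) (ev _ k)).1.1.
Qed.

Lemma eta_fst_lift k : Ye k (fst_lift 0) = Yz k (snd_lift 0).
Proof.
rewrite YzE -(snd_liftE k) YeE; apply/esym.
apply: (z_second_gen rtA dD dM dC _ _ _ _ _ (values_zeta K k).1 _ (ev _ k)).
by do !split; rewrite -YzE z_fst_lift.
Qed.

Hypothesis div0 : wdiv D = 0.

Lemma eta_snd_lift k : Ye k (snd_lift 0) = 0.
Proof.
have sq := dpvar_sq char2.
have val := values_even K.
rewrite -(snd_liftE k) YeE /snd_lift -(fst_liftE k).
apply: (eta_second_gen rtA dD dM dC (sq _ _) (sq _ _) (sq _ _) (sq _ _) (sq _ _) (sq _ _)
  (val _ k) (val _ k) (val _ k) (val _ k) (values_eta K k).1 (ev _ k)).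
  exact: (nn_first_gen rtA dD dM dC _ _ _ _ (values_eta K k).1 (values_eta K k).2.1
    (values_eta K k).2.2 (ev _ k) (ev _ k) (ev _ k) (ev _ k) (ev _ k)).
apply: (div_first_gen rtA dD dM dC (sq _ _) (sq _ _) (sq _ _) (val _ k) (val _ k)
  (val _ k) (val _ k) (values_eta K k).1 (values_eta K k).2.1 (values_eta K k).2.2
  (ev _ k) (ev _ k) (ev _ k) (ev _ k) (ev _ k)).
rewrite -!emb_pd -!embD -(sum_ord5 (fun v => pd v (D v)) k) -[X in emb X]/(wdiv D) div0.
exact: emb0.
Qed.

Lemma gen_lift : gen (fst_lift 0) (snd_lift 0).
Proof.
move=> k; apply: And3; [exact: z_fst_lift|exact: eta_fst_lift|exact: eta_snd_lift].
Qed.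

Lemma even_part_lift : even_part (wX (fst_lift 0) (snd_lift 0)) = D.
Proof.
have r_eta i : res (eta i) = 0 := res_var K (inl i).
have r_zeta i : res (zeta i) = 0 := res_var K (inr i).
apply/ffunP => v; elim/ord5P: v => [k||].
(* Y_zeta_k F2 is traded for Y_eta_k F1, whose restriction is that of a plain eta-derivative of
   [first_gen]. *)
- rewrite (even_part_wX_u char2) -(eta_fst_lift k) (res_Ye char2) -(fst_liftE k) /fst_lift.
  rewrite (n_first_gen rtA dD dM dC _ _ _ _ (values_eta K k).1 (values_eta K k).2.1
    (values_eta K k).2.2 (ev _ k) (ev _ k) (ev _ k) (ev _ k) (ev _ k)).1.
  rewrite (first_gen_deriv_morph rtB (@resD K) (@resM K) _ _ _ _ (r_eta _) (r_eta _)).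
  exact: res_emb.
- rewrite (even_part_wX_chi0 char2).
  rewrite (first_gen_morph rtB (@resD K) (@resM K) _ _ _ _ _ _ _ _ _ _
    (r_eta _) (r_eta _) (r_eta _)).
  exact: res_emb.
rewrite (even_part_wX_chi1 char2).
rewrite (second_gen_morph rtB (@resD K) (@resM K) _ _ _ _ _ _ _ _ _ _ _ _ _ _
  (r_zeta _) (r_zeta _) (r_zeta _)).
exact: res_emb.
Qed.

Lemma divpow_fst_lift N : (forall v, divpow N (D v)) -> divpow (Ntilde N) (fst_lift 0).
Proof.
move=> ND; have Nf v : divpow (Ntilde N) (f v) by apply: divpow_emb.
apply: (first_gen_closed (P := @divpow K var11 (Ntilde N))).
- move=> g h; exact: (subspaceD (divpow_subspace K (Ntilde N))).
- move=> g h; exact: (divpow_wmul char2).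
- by move=> v g Ng; apply: divpow_pd.
all: by [exact: Nf | apply: divpow_odd].
Qed.

Lemma divpow_snd_lift N : (forall v, divpow N (D v)) -> divpow (Ntilde N) (snd_lift 0).
Proof.
move=> ND; apply: (second_gen_closed (P := @divpow K var11 (Ntilde N))).
- move=> g h; exact: (subspaceD (divpow_subspace K (Ntilde N))).
- move=> g h; exact: (divpow_wmul char2).
- by move=> v g Ng; apply: divpow_pd.
7: exact: divpow_fst_lift.
7: exact: (divpow_emb (ND _)).
all: by apply: divpow_odd.
Qed.
End Lift.

Lemma even_part_surj N D : svs N D -> exists2 X, smb3 N X & even_part X = D.
Proof.
move=> /svsP[ND D0]; exists (wX (fst_lift D 0) (snd_lift D 0)); last exact: even_part_lift.
apply/smb3P; exists (fst_lift D 0), (snd_lift D 0).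
exact: (And4 (divpow_fst_lift ND) (divpow_snd_lift ND) (gen_lift D0) (erefl _)).
Qed.

Lemma even_part_inj N X Y : smb3 N X -> smb3 N Y -> even_part X = even_part Y -> X = Y.
Proof.
move=> /smb3P[F1 [F2 [_ _ gF ->]]] /smb3P[G1 [G2 [_ _ gG ->]]] E.
by have [-> ->] := even_part_wX_inj char2 gF gG E.
Qed.

Lemma even_part_smb3_wbr N X Y : smb3 N X -> smb3 N Y ->
  even_part (wbr X Y) = dbr 1 (even_part X) (even_part Y).
Proof.
move=> /smb3P[F1 [F2 [_ _ gF ->]]] /smb3P[G1 [G2 [_ _ gG ->]]]; exact: (even_part_wbr char2).
Qed.

Lemma mb3_iso N : lie_isomorphism (mb3 K N) (Ldeform K N) (@even_part K).
Proof.
have L := deform_lie char2 N 1; have M := mb3_lie N.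
split=> [//|//|c X Y _ _||]; first exact: even_part_linear.
  rewrite /Ldeform svectE mb3E /=; split.
  - by move=> X; apply: svs_even_part.
  - by move=> X Y /set_mem NX /set_mem NY; apply: even_part_inj NX NY.
  by move=> D /even_part_surj[X NX <-]; exists X.
rewrite /Ldeform svectE mb3E /= => X Y NX NY.
rewrite (smb3_bracket NX NY) (deform_brE char2 1 (svs_even_part NX) (svs_even_part NY)).
exact: even_part_smb3_wbr NX NY.
Qed.

Lemma smb3_unconstrained N : @smb3 K N `<=` @smb3 K (unconstrained (I := 'I_5)).
Proof.
move=> X /smb3P[F1 [F2 [N1 N2 gF ->]]]; apply/smb3P; exists F1, F2.
have U (g : A) : divpow (Ntilde N) g -> divpow (Ntilde (unconstrained (I := 'I_5))) g.
  by move=> Ng r /Ng /forallP Nr; apply/forallP => -[i|o] //=; apply: (Nr (inr o)).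
exact: (And4 (U _ N1) (U _ N2) gF (erefl _)).
Qed.

End Isomorphism.

(** * Transport of W-gradings *)

Section Spans.
Variables (K : fieldType) (V : lmodType K).
Implicit Types A B : set V.

Lemma lspan_sub A B : subspace B -> A `<=` B -> lspan A `<=` B.
Proof. by move=> sB AB x; apply. Qed.

Lemma sub_lspan A : A `<=` lspan A.
Proof. by move=> x Ax B [_]; apply. Qed.

Lemma lspan_subspace A : subspace (lspan A).
Proof.
split=> [B [[B0 _] _] //|c x y Ax Ay B sB]; apply: (proj2 sB.1); [exact: Ax|exact: Ay].
Qed.

Lemma subspaceI A B : subspace A -> subspace B ->
  subspace (A `&` B).
Proof.
move=> [A0 AD] [B0 BD]; split=> // c x y [Ax Bx] [Ay By].
by split; [exact: AD|exact: BD].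
Qed.

End Spans.

Section GradingTransport.
Variables (K : fieldType) (V W : lmodType K) (phi : V -> W).
Hypothesis phi_lin : linear phi.
Implicit Types (A B C : set V) (g : lie V) (h : lie W).

Lemma image_subspace A : subspace A -> subspace (phi @` A).
Proof.
move=> [A0 AD]; split=> [|c _ _ [x Ax <-] [y Ay <-]].
  by exists 0 => //; have := phi_lin (-1) 0 0; rewrite !scaleN1r !addNr.
by exists (c *: x + y); [exact: AD|exact: phi_lin].
Qed.

Lemma preimage_subspace (B : set W) : subspace B -> subspace (phi @^-1` B).
Proof.
move=> [B0 BD]; split=> [|c x y Bx By] /=; last by rewrite phi_lin; apply: BD.
suff -> : phi 0 = 0 by [].
by have := phi_lin (-1) 0 0; rewrite !scaleN1r !addNr.
Qed.

Lemma image_lspan A : phi @` lspan A = lspan (phi @` A).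
Proof.
rewrite eqEsubset; split=> [_ [x Ax <-]|].
  apply: (@lspan_sub _ _ _ (phi @^-1` lspan (phi @` A)) _ _ x Ax) => [|a Aa].
    exact/preimage_subspace/lspan_subspace.
  by apply: sub_lspan; exists a.
have S := image_subspace (@lspan_subspace K V A).
by apply: (lspan_sub S); apply: image_subset; apply: sub_lspan.
Qed.

Lemma filtration_of_image (G : int -> set V) (j : int) :
  filtration_of (fun i => phi @` G i) j = phi @` filtration_of G j.
Proof. by rewrite /filtration_of image_lspan image_bigcup. Qed.

Section Isomorphism.
Variables (g : lie V) (h : lie W).
Hypothesis iso : lie_isomorphism g h phi.

Let closed_g : closed_on (car g) (brk g). Proof. by case: iso => -[]. Qed.
Let inj x y : car g x -> car g y -> phi x = phi y -> x = y.
Proof. by case: iso => _ _ _ [_ inj _] _ gx gy; apply: inj; exact: mem_set. Qed.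
Let phi_brk x y : car g x -> car g y -> phi (brk g x y) = brk h (phi x) (phi y).
Proof. by case: iso => _ _ _ _; apply. Qed.
Let subspace_g : subspace (car g). Proof. by case: iso => -[]. Qed.

Lemma image_car : phi @` car g = car h.
Proof.
case: iso => _ _ _ [fun_ _ surj] _; rewrite eqEsubset; split; last exact: surj.
by move=> _ [x gx <-]; apply: fun_.
Qed.

(** [phi] is linear on all of [V] but injective only on [car g]; hence the inclusions in [car g]
    that accompany the set operations below. *)
Lemma image_car_mem A x : A `<=` car g -> car g x -> (phi @` A) (phi x) -> A x.
Proof. by move=> Ag gx [y Ay /(inj (Ag _ Ay) gx) <-]. Qed.

Lemma image_carI A B : A `<=` car g -> B `<=` car g ->
  phi @` (A `&` B) = phi @` A `&` phi @` B.
Proof.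
move=> Ag Bg; rewrite eqEsubset; split=> [_ [x [Ax Bx] <-]|_ [[x Ax <-] Bx]].
  by split; exists x.
by exists x => //; split=> //; apply: (image_car_mem Bg (Ag _ Ax) Bx).
Qed.

Lemma image_car_proper A B : A `<=` car g -> B `<=` car g ->
  (phi @` A `<` phi @` B) <-> (A `<` B).
Proof.
move=> Ag Bg; split=> -[AB nBA]; split=> //.
- by move=> x Ax; apply: (image_car_mem Bg (Ag _ Ax)); apply: AB; exists x.
- by move=> BA; apply: nBA; apply: image_subset.
- exact: image_subset.
by move=> BA; apply: nBA => x Bx; apply: (image_car_mem Ag (Bg _ Bx)); apply: BA; exists x.
Qed.

(** Competitors in a maximality or minimality condition of [h] are thus images of subsets of
    [car g], and the condition can be tested in [g]. *)
Lemma pullback (C : set W) : C `<=` car h -> phi @` (car g `&` phi @^-1` C) = C.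
Proof.
move=> Ch; rewrite eqEsubset; split=> [_ [x [_ Cx] <-] //|y Cy].
have : (phi @` car g) y by rewrite image_car; apply: Ch.
by move=> [x gx xy]; exists x => //; split=> //=; rewrite xy.
Qed.

Lemma image_subalgebra B : subalgebra g B -> subalgebra h (phi @` B).
Proof.
move=> [sB Bg cB]; split; first exact: image_subspace.
  by rewrite -image_car; apply: image_subset.
move=> _ _ [x Bx <-] [y By <-]; exists (brk g x y); first exact: cB.
by rewrite phi_brk //; apply: Bg.
Qed.

Lemma pullback_subalgebra (C : set W) : subalgebra h C -> subalgebra g (car g `&` phi @^-1` C).
Proof.
move=> [sC Ch cC]; split; last 1 first.
- move=> x y [gx Cx] [gy Cy]; split; first exact: closed_g.
  by rewrite /= phi_brk //; apply: cC.
- exact: subspaceI subspace_g (preimage_subspace sC).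
by move=> x [].
Qed.

Lemma image_maximal B : maximal_subalgebra g B -> maximal_subalgebra h (phi @` B).
Proof.
move=> [sB Bg maxB]; have Bsub : B `<=` car g by case: sB.
split; first exact: image_subalgebra.
  by rewrite -image_car; apply/image_car_proper.
move=> C sC BC Ch; have Csub : C `<=` car h by case: sC.
rewrite -(pullback Csub) in Ch *; congr (phi @` _).
apply: maxB; first exact: pullback_subalgebra.
  by move=> x Bx; split; [exact: Bsub|apply: BC; exists x].
by apply/image_car_proper; rewrite ?image_car // => x [].
Qed.

Lemma image_seq (s : seq V) : phi @` [set` s] = [set` map phi s].
Proof.
rewrite eqEsubset; split=> [_ [x xs <-]|y] /=; first exact: map_f.
by move=> /mapP[x xs ->]; exists x.
Qed.

Lemma image_finite_codim B : finite_codim g B -> finite_codim h (phi @` B).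
Proof.
move=> [s sB]; exists (map phi s).
by rewrite -image_seq -image_setU -image_lspan sB image_car.
Qed.

Lemma image_invariant B C : B `<=` car g -> invariant_above g B C ->
  invariant_above h (phi @` B) (phi @` C).
Proof.
move=> Bg [sC Cg BC inv]; split; first exact: image_subspace.
- by rewrite -image_car; apply: image_subset.
- exact/image_car_proper.
move=> _ _ [x Bx <-] [y Cy <-]; exists (brk g x y); first exact: inv.
by rewrite phi_brk //; [exact: Bg|exact: Cg].
Qed.

Lemma image_minimal B C : B `<=` car g -> minimal_invariant_above g B C ->
  minimal_invariant_above h (phi @` B) (phi @` C).
Proof.
move=> Bg [invC minC]; split; first exact: image_invariant.
have Cg : C `<=` car g by case: invC.
move=> M [sM Mh BM invM] MC; rewrite -(pullback Mh) in BM MC *; congr (phi @` _).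
have Pg : car g `&` phi @^-1` M `<=` car g by move=> x [].
apply: minC.
  split=> //; first exact: subspaceI subspace_g (preimage_subspace sM).
    exact: (proj1 (image_car_proper Bg Pg) BM).
  move=> x y Bx [gy My]; split; first by apply: closed_g => //; apply: Bg.
  by rewrite /= phi_brk //; [apply: invM => //; exists x|exact: Bg].
move=> x Px; apply: (image_car_mem Cg (Pg _ Px)); apply: MC; by exists x.
Qed.

Lemma image_brackets A B : A `<=` car g -> B `<=` car g ->
  phi @` [set brk g x y | x in A & y in B] =
  [set brk h x y | x in phi @` A & y in phi @` B].
Proof.
move=> Ag Bg; rewrite eqEsubset; split=> [_ [_ [x Ax [y By <-]] <-]|].
  exists (phi x); first by exists x.
  exists (phi y); first by exists y.
  by rewrite phi_brk //; [exact: Ag|exact: Bg].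
move=> _ [_ [x Ax <-] [_ [y By <-] <-]]; exists (brk g x y).
  by exists x => //; exists y.
by rewrite phi_brk //; [exact: Ag|exact: Bg].
Qed.

Lemma image_Z_grading (G : int -> set V) :
  Z_grading g G -> Z_grading h (fun i => phi @` G i).
Proof.
move=> [sG cG spanG dirG].
have Gg i : G i `<=` car g.
  by move=> x Gx; rewrite -spanG; apply: sub_lspan; exists i.
split=> [i|i j _ _ [x Gx <-] [y Gy <-]||i].
- exact: image_subspace.
- exists (brk g x y); first exact: cG.
  by rewrite phi_brk //; [exact: Gg Gx|exact: Gg Gy].
- by rewrite -image_bigcup -image_lspan spanG image_car.
rewrite -image_bigcup -image_lspan -image_carI //; last first.
  by apply: lspan_sub => // x [j _ Gx]; exact: Gg Gx.
rewrite dirG image_set1; congr [set _].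
by have := phi_lin (-1) 0 0; rewrite !scaleN1r !addNr.
Qed.

Lemma image_W_filtration (L : int -> set V) : (forall i, L i `<=` car g) ->
  W_filtration g L -> W_filtration h (fun i => phi @` L i).
Proof.
move=> Lg [maxL codimL minL negL posL]; split.
- exact: image_maximal.
- exact: image_finite_codim.
- exact: image_minimal.
- move=> n n0; rewrite (negL n n0) image_lspan image_setU image_brackets //.
move=> n n0; rewrite (posL n n0) eqEsubset; split.
  move=> _ [D [LD LE] <-]; split; first by exists D.
  move=> _ [E Em <-]; exists (brk g D E); first exact: LE.
  by rewrite phi_brk //; [exact: Lg LD|exact: Lg Em].
move=> _ [[D LD <-] LE]; exists D => //; split=> // E Em.
have gD := Lg _ _ LD; have gE := Lg _ _ Em.
apply: (image_car_mem (Lg _) (closed_g gD gE)).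
by rewrite phi_brk //; apply: LE; exists E.
Qed.

Lemma image_W_grading (G : int -> set V) :
  W_grading g G -> W_grading h (fun i => phi @` G i).
Proof.
move=> [ZG WG]; split; first exact: image_Z_grading.
have -> : filtration_of (fun i => phi @` G i) = fun j => phi @` filtration_of G j.
  by apply: boolp.funext => j; apply: filtration_of_image.
apply: image_W_filtration WG => j; apply: lspan_sub => // x [i _ Gx].
by case: ZG => _ _ <- _; apply: sub_lspan; exists i.
Qed.

End Isomorphism.

Lemma image_W_grading_in (ginf g : lie V) (hinf h : lie W) (G : int -> set V) :
  lie_isomorphism ginf hinf phi -> lie_isomorphism g h phi -> car g `<=` car ginf ->
  W_grading_in ginf g G -> W_grading_in hinf h (fun i => phi @` G i).
Proof.
move=> isoinf iso sub [ZG [H [WH GH]]]; split; first exact: (image_Z_grading iso ZG).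
exists (fun i => phi @` H i); split; first exact: (image_W_grading isoinf WH).
move=> i; rewrite GH -(image_car iso) (image_carI isoinf _ sub) //.
move=> x Hx; case: WH => -[_ _ <- _] _; apply: sub_lspan; by exists i.
Qed.

End GradingTransport.

Theorem theorem4p1 (K : closedFieldType) (charK : 2%N \in [pchar K])
    (N : 'I_5 -> height) (shearN : shearing_vector N) :
  true_deform (svect K N) (svect_cocycle N) /\
  exists phi : vfield K var11 -> vfield K 'I_5,
    lie_isomorphism (mb3 K N) (Ldeform K N) phi /\
    forall G : int -> set (vfield K var11),
      W_grading_in (mb3 K (unconstrained (I := 'I_5))) (mb3 K N) G ->
      W_grading_in (Ldeform K (unconstrained (I := 'I_5))) (Ldeform K N)
        (fun i => phi @` G i).
Proof.
split.
  split.
  - split; [exact: svect_lie|exact: svect_cocycle_cocycle|exact: deform_lie].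
  - exact: svect_cocycle_not_coboundary.
  by move=> [_]; apply: deform_not_isomorphic.
exists (@even_part K); split; first exact: mb3_iso.
(* [even_part] does not mention the heights: one map is the isomorphism both for [N] and for
   unconstrained heights, so it respects the cutting out of gradings from the larger algebra. *)
move=> G; apply: (@image_W_grading_in K _ _ (@even_part K) (@even_part_linear K)).
- exact: (mb3_iso charK (unconstrained (I := 'I_5))).
- exact: (mb3_iso charK N).
rewrite !mb3E; exact: smb3_unconstrained.
Qed.
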